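(* Any type $\mathfrak{P}$-group $G$ in $\mathrm{PGL}_3(\mathbb{C})$ is pseudo-real except when $G$ equals $\mathrm{A}_5$. More concretely, $\mathrm{A}_5$ has a real field of moduli, and we can always descend it to $\mathbb{R}$ as $\phi^{-1}\langle A,B,C\rangle\phi$, where for some $\alpha,\beta\in\mathbb{C}^*$, $\phi\in \mathrm{PGL}_3(\mathbb{C})$ is the class of $\begin{pmatrix}1&0&0\\0&\alpha&\beta\\0&\overline{\alpha}&\overline{\beta}\end{pmatrix}$ and, in $\mathrm{PGL}_3(\mathbb{C})$, $$\phi^{-1}A\,\phi=\begin{pmatrix} 2\,\mathrm{Im}(\alpha\overline{\beta}) & 0 & 0\\ 0 & 2\,\mathrm{Im}(\alpha\overline{\beta}\,\zeta_5^{4}) & 2|\beta|^2\sin(8\pi/5)\\ 0 & -2|\alpha|^2\sin(8\pi/5) & 2\,\mathrm{Im}(\alpha\overline{\beta}\,\zeta_5^{-4})\end{pmatrix},$$ $$\phi^{-1}B\,\phi=\begin{pmatrix} 2\,\mathrm{Im}(\alpha\overline{\beta}) & 0 & 0\\ 0 & -2\,\mathrm{Im}(\alpha\beta) & -2\,\mathrm{Im}(\beta^2)\\ 0 & 2\,\mathrm{Im}(\alpha^2) & 2\,\mathrm{Im}(\alpha\beta)\end{pmatrix},$$ and $\phi^{-1}C\,\phi$ equals the class of the matrix with rows $$\left(4\,\mathrm{Im}(\alpha\overline{\beta}),\ \ 8\,\mathrm{Im}(\alpha\overline{\beta})\,\mathrm{Re}(\alpha),\ \ 8\,\mathrm{Im}(\alpha\overline{\beta})\,\mathrm{Re}(\beta)\right),$$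 $$\left(2\,\mathrm{Im}(\overline{\beta}),\ \ 2\left(\cos(4\pi/5)\,\mathrm{Im}(\alpha\overline{\beta})-\cos(2\pi/5)\,\mathrm{Im}(\alpha\beta)\right),\ \ -2\cos(2\pi/5)\,\mathrm{Im}(\beta^2)\right),$$ $$\left(2\,\mathrm{Im}(\alpha),\ \ 2\cos(2\pi/5)\,\mathrm{Im}(\alpha^2),\ \ 2\left(\cos(4\pi/5)\,\mathrm{Im}(\alpha\overline{\beta})+\cos(2\pi/5)\,\mathrm{Im}(\alpha\beta)\right)\right).$$
   Context: Here $\zeta_n=e^{2\pi i/n}$, and $\sigma$ is complex conjugation, acting entrywise on $\mathrm{PGL}_3(\mathbb{C})$; for a subgroup $G$ put ${}^{\sigma}G=\{{}^{\sigma}g: g\in G\}$. A matrix in $\mathrm{GL}_3(\mathbb{C})$ is identified with its class in $\mathrm{PGL}_3(\mathbb{C})$. For linear forms $L_1,L_2,L_3$ in $X,Y,Z$, $[L_1:L_2:L_3]$ denotes the class of the matrix whose $i$-th row lists the coefficients of $L_i$. For a finite subgroup $G\subset\mathrm{PGL}_3(\mathbb{C})$: $G$ has a real field of moduli if ${}^{\sigma}G$ and $G$ are conjugate in $\mathrm{PGL}_3(\mathbb{C})$; $G$ is definable over $\mathbb{R}$ (descends to $\mathbb{R}$) if it is $\mathrm{PGL}_3(\mathbb{C})$-conjugate to some $G'\subset\mathrm{PGL}_3(\mathbb{R})$; $G$ is pseudo-real if it has a real field of moduli but is not definable over $\mathbb{R}$. Type $\mathfrak{P}$-groups are the finite primitive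 subgroups of $\mathrm{PGL}_3(\mathbb{C})$, namely the subgroups belonging, up to $\mathrm{PGL}_3(\mathbb{C})$-conjugation, to the following list (each forms a single conjugacy class). (i) The Hessian groups $\mathrm{Hess}_{216}=\langle S,T,U,V\rangle$, $\mathrm{Hess}_{72}=\langle S,T,V,UVU^{-1}\rangle$, $\mathrm{Hess}_{36}=\langle S,T,V\rangle$ of orders $216,72,36$, where $S=\mathrm{diag}(1,\zeta_3,\zeta_3^{-1})$, $U=\mathrm{diag}(1,1,\zeta_3)$, $T=[Y:Z:X]$ and $V=\begin{pmatrix}1&1&1\\1&\zeta_3&\zeta_3^{-1}\\1&\zeta_3^{-1}&\zeta_3\end{pmatrix}$. (ii) The alternating group $\mathrm{A}_5$, for which the paper fixes the copy $\langle A,B,C\rangle$ with $A=\mathrm{diag}(1,\zeta_5^{-1},\zeta_5)$, $B=[X:Z:Y]$ and $$C=\begin{pmatrix}2&2&2\\1&\cos(4\pi/5)&\cos(2\pi/5)\\1&\cos(2\pi/5)&\cos(4\pi/5)\end{pmatrix}.$$ (iii) The alternating group $\mathrm{A}_6$. (iv) The Klein group $\mathrm{PSL}(2,7)$ of order $168$.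
   Formalization: As printed, C (first row 2,2,2) has infinite order, so ⟨A,B,C⟩ is not A_5; the group ⟨A,B,C⟩ is taken with C's first row (1/2,1/2,1/2). The formula for φ⁻¹Cφ is proved for the printed C and, with its first row divided by 4, for the corrected C. *)

(* Defs.v *)
(* MathComp / MathComp-Analysis; the complex numbers are R[i] for R : realType. *)
From HB Require Import structures.
From mathcomp Require Import all_boot all_order all_algebra all_fingroup.
From mathcomp Require Import all_solvable.
From mathcomp Require Import generic_quotient complex.
From mathcomp Require Import all_classical reals trigo ring lra.

Set Implicit Arguments.
Unset Strict Implicit.
Unset Printing Implicit Defensive.

Import Order.TTheory GRing.Theory Num.Theory.

Local Open Scope classical_set_scope.
Local Open Scope ring_scope.
Local Open Scope complex_scope.
Local Open Scope quotient_scope.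

(* PGL_n(F) is the quotient of the type of invertible matrices by the relation
   "differ by a scalar matrix", with the induced group structure. *)
Section PGL.
Variables (F : fieldType) (n : nat).

Definition GLn : Type := {M : 'M[F]_n | M \in unitmx}.
HB.instance Definition _ := Choice.on GLn.

Implicit Types M N P : GLn.

Definition pgl_rel : rel GLn :=
  fun M N => `[< exists2 c : F, c != 0 & val N = c *: val M >].

Lemma pgl_relE M N :
  pgl_rel M N <-> exists2 c : F, c != 0 & val N = c *: val M.
Proof. by split=> /asboolP. Qed.

Lemma pgl_rel_refl : reflexive pgl_rel.
Proof. by move=> M; apply/pgl_relE; exists 1; rewrite ?oner_neq0// scale1r. Qed.

Lemma pgl_rel_sym : symmetric pgl_rel.
Proof.
suff H M N : pgl_rel M N -> pgl_rel N M by move=> M N; apply/idP/idP; apply: H.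
move=> /pgl_relE[c uc E]; apply/pgl_relE; exists c^-1; first by rewrite invr_eq0.
by rewrite E scalerA mulVf// scale1r.
Qed.

Lemma pgl_rel_trans : transitive pgl_rel.
Proof.
move=> N M P /pgl_relE[c uc E] /pgl_relE[d ud E']; apply/pgl_relE.
by exists (d * c); rewrite ?mulf_neq0// E' E scalerA.
Qed.

Canonical pgl_equiv := EquivRel pgl_rel pgl_rel_refl pgl_rel_sym pgl_rel_trans.

Definition PGL : Type := {eq_quot pgl_rel}.
HB.instance Definition _ := Choice.on PGL.
HB.instance Definition _ := EqQuotient.on PGL.

Lemma GLn_one_subproof : (1%:M : 'M[F]_n) \in unitmx.
Proof. exact: unitmx1. Qed.
Definition GLn_one : GLn := Sub 1%:M GLn_one_subproof.

Lemma GLn_mul_subproof M N : val M *m val N \in unitmx.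
Proof. by rewrite unitmx_mul (valP M) (valP N). Qed.
Definition GLn_mul M N : GLn := Sub (val M *m val N) (GLn_mul_subproof M N).

Lemma GLn_inv_subproof M : invmx (val M) \in unitmx.
Proof. by rewrite unitmx_inv (valP M). Qed.
Definition GLn_inv M : GLn := Sub (invmx (val M)) (GLn_inv_subproof M).

Definition PGL_one : PGL := \pi_PGL GLn_one.
Definition PGL_mul (x y : PGL) : PGL := \pi_PGL (GLn_mul (repr x) (repr y)).
Definition PGL_inv (x : PGL) : PGL := \pi_PGL (GLn_inv (repr x)).

Lemma pglP M N :
  \pi_PGL M = \pi_PGL N <->
  exists2 c : F, c != 0 & val N = c *: val M.
Proof. by rewrite -pgl_relE; split=> /eqmodP. Qed.

Lemma pgl_repr M :
  exists2 c : F, c != 0 & val (repr (\pi_PGL M)) = c *: val M.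
Proof. by apply/pglP; rewrite reprK. Qed.

Lemma PGL_mulE M N : PGL_mul (\pi_PGL M) (\pi_PGL N) = \pi_PGL (GLn_mul M N).
Proof.
have [c uc Ec] := pgl_repr M; have [d ud Ed] := pgl_repr N.
apply/esym/pglP; exists (c * d); first by rewrite mulf_neq0.
by rewrite /= Ec Ed -scalemxAl -scalemxAr scalerA.
Qed.

Lemma PGL_invE M : PGL_inv (\pi_PGL M) = \pi_PGL (GLn_inv M).
Proof.
have [c uc Ec] := pgl_repr M.
apply/esym/pglP; exists c^-1; first by rewrite invr_eq0.
by rewrite /= Ec invmxZ// -Ec; exact: valP.
Qed.

Lemma PGL_mulA : associative PGL_mul.
Proof.
elim/quotW=> M; elim/quotW=> N; elim/quotW=> P.
rewrite (PGL_mulE N P) (PGL_mulE M N) PGL_mulE PGL_mulE.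
by apply: congr1; apply: val_inj; rewrite /= mulmxA.
Qed.

Lemma PGL_mul1 : left_id PGL_one PGL_mul.
Proof.
elim/quotW=> M; rewrite PGL_mulE.
by apply: congr1; apply: val_inj; rewrite /= mul1mx.
Qed.

Lemma PGL_mulr1 : right_id PGL_one PGL_mul.
Proof.
elim/quotW=> M; rewrite PGL_mulE.
by apply: congr1; apply: val_inj; rewrite /= mulmx1.
Qed.

Lemma PGL_mulV : left_inverse PGL_one PGL_inv PGL_mul.
Proof.
elim/quotW=> M; rewrite PGL_invE PGL_mulE.
by apply: congr1; apply: val_inj; rewrite /= mulVmx//; exact: valP.
Qed.

Lemma PGL_mulrV : right_inverse PGL_one PGL_inv PGL_mul.
Proof.
elim/quotW=> M; rewrite PGL_invE PGL_mulE.
by apply: congr1; apply: val_inj; rewrite /= mulmxV//; exact: valP.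
Qed.

HB.instance Definition _ := isGroup.Build PGL
  PGL_mulA PGL_mul1 PGL_mulr1 PGL_mulV PGL_mulrV.

(* Junk value: 1 when M is singular. *)
Definition mxclass (M : 'M[F]_n) : PGL := \pi_PGL (insubd GLn_one M).

Lemma mxclass_repr (g : PGL) : mxclass (val (repr g)) = g.
Proof. by rewrite /mxclass valKd reprK. Qed.

Lemma mxclassP (M N : 'M[F]_n) : M \in unitmx -> N \in unitmx ->
  mxclass M = mxclass N <-> exists2 c : F, c != 0 & N = c *: M.
Proof. by move=> uM uN; rewrite /mxclass pglP !insubdK. Qed.

Lemma mxclass1 : mxclass 1%:M = 1%g.
Proof.
by rewrite /mxclass; apply: congr1; apply: val_inj; rewrite insubdK ?unitmx1.
Qed.

Lemma mxclassM (M N : 'M[F]_n) : M \in unitmx -> N \in unitmx ->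
  mxclass (M *m N) = (mxclass M * mxclass N)%g.
Proof.
move=> uM uN; rewrite /mxclass [RHS]PGL_mulE; apply: congr1; apply: val_inj.
by rewrite /= !insubdK// unitmx_mul uM.
Qed.

Lemma mxclassV (M : 'M[F]_n) : M \in unitmx ->
  mxclass (invmx M) = (mxclass M)^-1%g.
Proof.
move=> uM; rewrite /mxclass [RHS]PGL_invE; apply: congr1; apply: val_inj.
by rewrite /= !insubdK// unitmx_inv.
Qed.

End PGL.

Section PGLmap.
Variables (F F' : fieldType) (f : {rmorphism F -> F'}) (n : nat).

Definition map_PGL (g : PGL F n) : PGL F' n :=
  mxclass (map_mx f (val (repr g))).

Lemma map_PGL_mxclass (M : 'M[F]_n) : M \in unitmx ->
  map_PGL (mxclass M) = mxclass (map_mx f M).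
Proof.
move=> uM; have uM' : map_mx f M \in unitmx by rewrite map_unitmx.
rewrite /map_PGL /mxclass; have [c uc ->] := pgl_repr (insubd (GLn_one F n) M).
rewrite insubdK// map_mxZ; apply/esym/pglP.
have uc' : f c != 0 by rewrite fmorph_eq0.
exists (f c) => //; rewrite !insubdK//.
by rewrite unitmxZ// unitfE.
Qed.

End PGLmap.
Arguments map_PGL {F F'} f {n} g.

Section Subgroups.
Variable gT : groupType.

Definition is_subgroup (G : set gT) : Prop :=
  [/\ G 1%g, forall x y, G x -> G y -> G (x * y)%g & forall x, G x -> G x^-1%g].

Definition generated (A : set gT) : set gT := smallest is_subgroup A.

(* x^-1 G x *)
Definition conj_set (G : set gT) (x : gT) : set gT := [set (g ^ x)%g | g in G].

Definition conjugate_sets (G H : set gT) : Prop := exists x : gT, H = conj_set G x.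

Definition isomorphic_to (hT : finGroupType) (H : {group hT}) (G : set gT) : Prop :=
  exists f : hT -> gT,
    {in H &, {morph f : x y / (x * y)%g}} /\ set_bij [set` H] G f.

End Subgroups.

Section PSL27.
Local Open Scope group_scope.

Definition SL2_7 : {set {'GL_2(7)}} := [set u | \det (GLval u) == 1%R].

Lemma SL2_7_group_set : group_set SL2_7.
Proof.
apply/group_setP; split=> [|u v]; first by rewrite inE GL_1E det1.
by rewrite !inE GL_ME det_mulmx => /eqP-> /eqP->; rewrite mulr1.
Qed.
Canonical SL2_7_group := Group SL2_7_group_set.

Definition PSL2_7 := (SL2_7 / 'Z(SL2_7))%G.

End PSL27.

Section Pseudoreal.
Variable R : realType.
Local Notation C := R[i].
Local Notation PGL3C := (PGL C 3).

Definition sigma : PGL3C -> PGL3C := map_PGL (@conjc R).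

Definition PGL3R : set PGL3C := range (map_PGL (real_complex R)).

Definition has_real_moduli (G : set PGL3C) : Prop :=
  conjugate_sets (sigma @` G) G.

Definition definable_over_R (G : set PGL3C) : Prop :=
  exists2 G' : set PGL3C, conjugate_sets G G' & G' `<=` PGL3R.

Definition pseudo_real (G : set PGL3C) : Prop :=
  has_real_moduli G /\ ~ definable_over_R G.

(* e^(2 pi i / n) *)
Definition zeta (n : nat) : C :=
  cos (2 * pi / n%:R) +i* sin (2 * pi / n%:R).

Definition mx3 (F : nzRingType) (rows : seq (seq F)) : 'M[F]_3 :=
  \matrix_(i, j) (nth [::] rows i)`_j.

Definition class3 (rows : seq (seq C)) : PGL3C := mxclass (mx3 rows).

Definition Hess_S : PGL3C :=
  class3 [:: [:: 1; 0;      0          ];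
             [:: 0; zeta 3; 0          ];
             [:: 0; 0;      (zeta 3)^-1]].

Definition Hess_U : PGL3C :=
  class3 [:: [:: 1; 0; 0     ];
             [:: 0; 1; 0     ];
             [:: 0; 0; zeta 3]].

Definition Hess_T : PGL3C :=
  class3 [:: [:: 0; 1; 0];
             [:: 0; 0; 1];
             [:: 1; 0; 0]].

Definition Hess_V : PGL3C :=
  class3 [:: [:: 1; 1;           1          ];
             [:: 1; zeta 3;      (zeta 3)^-1];
             [:: 1; (zeta 3)^-1; zeta 3     ]].

Definition Hess216 : set PGL3C :=
  generated [set Hess_S; Hess_T; Hess_U; Hess_V].
Definition Hess72 : set PGL3C :=
  generated [set Hess_S; Hess_T; Hess_V; (Hess_U * Hess_V * Hess_U^-1)%g].
Definition Hess36 : set PGL3C :=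
  generated [set Hess_S; Hess_T; Hess_V].

Definition is_A5 (G : set PGL3C) : Prop := isomorphic_to 'Alt_('I_5)%G G.
Definition is_A6 (G : set PGL3C) : Prop := isomorphic_to 'Alt_('I_6)%G G.
Definition is_PSL2_7 (G : set PGL3C) : Prop := isomorphic_to PSL2_7 G.

(* The embeddings of A_5, A_6 and PSL(2,7) into PGL_3(C) form a single
   conjugacy class of subgroups each, so that these three classes are described
   by the isomorphism type; every set satisfying type_P is a finite subgroup. *)
Definition type_P (G : set PGL3C) : Prop :=
  (conjugate_sets Hess216 G \/ conjugate_sets Hess72 G \/ conjugate_sets Hess36 G) \/
  is_A5 G \/ is_A6 G \/ is_PSL2_7 G.

Definition A5_A : PGL3C :=
  class3 [:: [:: 1; 0;           0     ];
             [:: 0; (zeta 5)^-1; 0     ];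
             [:: 0; 0;           zeta 5]].

Definition A5_B : PGL3C :=
  class3 [:: [:: 1; 0; 0];
             [:: 0; 0; 1];
             [:: 0; 1; 0]].

Local Notation c4 := (cos (4 * pi / 5 : R)).
Local Notation c2 := (cos (2 * pi / 5 : R)).

(* The source prints the first row (2, 2, 2), i.e. c = 2.  This is a misprint
   for c = 1/2: A5_C_mx 2 has an eigenvalue > 2 (a root of
   x^2 - (2 + c2 + c4) x - 4 + 2 (c2 + c4)) and the eigenvalue c4 - c2, of
   modulus <= 2, so its class has infinite order (A5_C_2_infinite_order below),
   whereas c = 1/2 gives Klein's involution
   [X + Y + Z : 2X + 2 c4 Y + 2 c2 Z : 2X + 2 c2 Y + 2 c4 Z]. *)
Definition A5_C_mx (c : R) : 'M[C]_3 :=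
  map_mx (real_complex R)
    (mx3 [:: [:: c; c;  c ];
             [:: 1; c4; c2];
             [:: 1; c2; c4]]).

Definition A5_C (c : R) : PGL3C := mxclass (A5_C_mx c).

Definition A5_ABC : set PGL3C := generated [set A5_A; A5_B; A5_C 2^-1].

Definition phi_mx (a b : C) : 'M[C]_3 :=
  mx3 [:: [:: 1; 0;       0      ];
          [:: 0; a;       b      ];
          [:: 0; conjc a; conjc b]].

(* alpha, beta are nonzero and phi does define an element of PGL_3(C). *)
Definition phi_admissible (a b : C) : Prop :=
  [/\ a != 0, b != 0 & phi_mx a b \in unitmx].

(* The R-valued real and imaginary parts, not the C-valued 'Re and 'Im. *)
Local Notation Re := (@complex.Re R).
Local Notation Im := (@complex.Im R).

Definition real_class (rows : seq (seq R)) : PGL3C :=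
  mxclass (map_mx (real_complex R) (mx3 rows)).

Definition real_A (a b : C) : PGL3C :=
  let d := Im (a * conjc b) in
  let s : R := sin (8 * pi / 5) in
  real_class
    [:: [:: 2 * d; 0; 0];
        [:: 0; 2 * Im (a * conjc b * zeta 5 ^+ 4); 2 * Re (`|b| ^+ 2) * s];
        [:: 0; - (2 * Re (`|a| ^+ 2) * s); 2 * Im (a * conjc b * zeta 5 ^- 4)]].

Definition real_B (a b : C) : PGL3C :=
  let d := Im (a * conjc b) in
  real_class
    [:: [:: 2 * d; 0; 0];
        [:: 0; - (2 * Im (a * b)); - (2 * Im (b ^+ 2))];
        [:: 0; 2 * Im (a ^+ 2); 2 * Im (a * b)]].

(* The first row is proportional to c; c = 2 is the printed matrix. *)
Definition real_C (c : R) (a b : C) : PGL3C :=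
  let d := Im (a * conjc b) in
  real_class
    [:: [:: c * (2 * d); c * (4 * d * Re a); c * (4 * d * Re b)];
        [:: 2 * Im (conjc b); 2 * (c4 * d - c2 * Im (a * b)); - (2 * c2 * Im (b ^+ 2))];
        [:: 2 * Im a; 2 * c2 * Im (a ^+ 2); 2 * (c4 * d + c2 * Im (a * b))]].

End Pseudoreal.

Arguments PGL3R R : clear implicits.
Arguments Hess216 R : clear implicits.
Arguments Hess72 R : clear implicits.
Arguments Hess36 R : clear implicits.
Arguments A5_ABC R : clear implicits.

Lemma A5_C_2_infinite_order (R : realType) (n : nat) :
  (A5_C (2 : R) ^+ n.+1)%g <> 1%g.
Proof.
rewrite /A5_C; set M := A5_C_mx _ => gn1.
pose s4 : R := cos (4 * pi / 5); pose s2 : R := cos (2 * pi / 5).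
have [? ?] : -1 <= s4 /\ s4 <= 1 by rewrite cos_geN1 cos_le1.
have [? ?] : -1 <= s2 /\ s2 <= 1 by rewrite cos_geN1 cos_le1.
pose r := Num.sqrt ((2 - (s2 + s4)) ^+ 2 + 16).
have r2 : r ^+ 2 = (2 - (s2 + s4)) ^+ 2 + 16.
  by rewrite sqr_sqrtr// addr_ge0// sqr_ge0.
have r0 : 0 <= r by exact: sqrtr_ge0.
pose x := (2 - (s2 + s4) + r) / 4; pose l := 2 * x + (s2 + s4).
have lx : l * x = 2 * x + 2.
  have : 2 * x ^+ 2 + (s2 + s4 - 2) * x - 2 = (r ^+ 2 - ((2 - (s2 + s4)) ^+ 2 + 16)) / 8.
    by rewrite /x; field.
  by rewrite r2 subrr mul0r /l => e; lra.
have l2 : 2 < l.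
  suff : 2 - (s2 + s4) < r by rewrite /l /x; lra.
  rewrite -(@ltr_pXn2r _ 2)// ?nnegrE// ?r2; last by lra.
  by rewrite ltrDl.
pose v : 'rV[R]_3 := \row_j [:: 0; 1; -1]`_j.
pose w : 'rV[R]_3 := \row_j [:: x; 1; 1]`_j.
pose N : 'M[R]_3 := mx3 [:: [:: 2; 2; 2]; [:: 1; s4; s2]; [:: 1; s2; s4]].
have vN : v *m N = (s4 - s2) *: v.
  apply/rowP => -[[|[|[|//]]] j3]; rewrite !mxE !big_ord_recl big_ord0 !mxE /=; ring.
have wN : w *m N = l *: w.
  apply/rowP => -[[|[|[|//]]] j3]; rewrite !mxE !big_ord_recl big_ord0 !mxE /=.
  - rewrite lx; ring.
  - rewrite /l; ring.
  - rewrite /l; ring.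
have pw (u : 'rV[R]_3) a k : u *m N = a *: u -> u *m (N ^+ k) = a ^+ k *: u.
  move=> uN; elim: k => [|k IH]; first by rewrite !expr0 mulmx1 scale1r.
  by rewrite exprS mulmxA uN -scalemxAl IH scalerA -exprS.
have MN : M = map_mx (real_complex R) N by [].
have s42 : s4 < s2.
  have pi0 : 0 < (pi : R) by exact: pi_gt0.
  rewrite /s4 /s2 ltr_cos ?in_itv /=; first lra.
  - by apply/andP; split; lra.
  - by apply/andP; split; lra.
have detN : \det N = 2 * (s4 - s2) * (s4 + s2 - 2).
  rewrite (expand_det_row _ ord0) !big_ord_recl big_ord0 /cofactor.
  rewrite !(expand_det_row _ ord0) !big_ord_recl !big_ord0 /cofactor.
  by rewrite !det_mx11 !mxE /= /bump /=; ring.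
have uM : M \in unitmx.
  rewrite MN map_unitmx unitmxE detN unitfE !mulf_neq0 ?pnatr_eq0//.
    by rewrite subr_eq0 lt_eqF.
  by rewrite lt_eqF//; lra.
have uMX k : M ^+ k \in unitmx.
  elim: k => [|k IH]; first by rewrite expr0 unitmx1.
  by rewrite exprS unitmx_mul uM.
have clX k : (mxclass M ^+ k)%g = mxclass (M ^+ k).
  elim: k => [|k IH]; first by rewrite expg0 expr0 mxclass1.
  by rewrite expgS IH exprS mxclassM.
move: gn1; rewrite clX -mxclass1 => /esym/mxclassP.
case; rewrite ?unitmx1// => c _.
rewrite MN -[LHS](rmorphXn (map_mx (real_complex R))) => E.
have Nc i j : ((N ^+ n.+1 : 'M_3) i j)%:C = c *+ (i == j).
  by have /matrixP/(_ i j) := E; rewrite !mxE mulr_natr.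
have Nk : N ^+ n.+1 = (complex.Re c)%:M.
  by apply/matrixP => i j; have := congr1 (@complex.Re R) (Nc i j);
    rewrite !mxE /= => ->; case: (i == j).
have ev (u : 'rV[R]_3) a : u *m N = a *: u -> u 0 1 = 1 -> a ^+ n.+1 = complex.Re c.
  move=> uN; have := pw u a n.+1 uN; rewrite Nk mul_mx_scalar => /rowP/(_ 1).
  by rewrite !mxE => /[swap] ->; rewrite !mulr1.
have vk := ev v _ vN; have wk := ev w _ wN.
have : l ^+ n.+1 = (s4 - s2) ^+ n.+1 by rewrite vk ?wk// !mxE.
move/(congr1 Num.norm); rewrite !normrX => /eqP.
rewrite eqrXn2// => /eqP H; have : `|l| <= 2.
  by rewrite H ler_norml; apply/andP; split; lra.
by rewrite ler_norml => /andP[_]; lra.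
Qed.

(* Main.v *)
Require Import Defs.
From mathcomp Require Import all_boot all_order all_algebra all_fingroup.
From mathcomp Require Import all_solvable complex.
From mathcomp Require Import all_classical reals trigo ring lra zify.
Import Defs.

(** The proof rests on a description of tuples of involutions.  An involution of
    PGL_3(C) lifts to a matrix of square 1, one of whose eigenspaces is a line;
    it is therefore a homology, the class of [2 v w - 1] for a column [v] and a
    row [w] with [w v = 1] ([involution_homology]).  A product of two homologies
    has eigenvalues [1, l, l^-1] with [l + l^-1 = 4 (w v')(w' v) - 2], so that
    its order leaves finitely many values for [(w v')(w' v)].  For three
    homologies, put [g i j = w i (v j)].  Rescaling the [v i], and the [w i] inversely, leaves
    invariant the products [g i j * g j i] and the two triangular products
    [p = g 0 1 * g 1 2 * g 2 0] and [q = g 0 2 * g 2 1 * g 1 0]; generically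
    these determine the triple up to conjugation ([triple_rigid]).

    Real moduli of A_6 and PSL(2,7).  Each is generated by involutions x, y, z
    with xy, yz and xz of orders 3, 3 and 4.  This gives [p * q = 1 / 32], and
    the order of [x * z ^ y] shows that [p + q] is real.  Hence complex
    conjugation either fixes p and q or exchanges them.  Reversing the triple
    exchanges them as well, so the conjugate of (x, y, z) is conjugate in
    PGL_3(C) to (x, y, z) or to (z, y, x), which generate the same group
    ([conj_permutes_involutions]).

    A_5.  It is generated by involutions x, y, z with xy, yz and xz of orders 3,
    5 and 2.  Here [p = q = 0], and the only invariant left is a root of
    [16 t ^ 2 - 12 t + 1]; another generating triple of the same group has the
    other root ([icosahedral_switch]).  So all copies of A_5 are conjugate.
    One exists, the rotation group of a dodecahedron, and the generators
    [C], [A^2 B], [B] form such a triple: thus <A, B, C> is a copy of A_5, and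
    the only one up to conjugation ([A5_conjugate_ABC]).  This group commutes
    with the antilinear involution (X, Y, Z) -> (X', Z', Y'), the primes
    denoting complex conjugates; phi maps R^3 onto the vectors fixed by it,
    whence the real matrices, which are computed explicitly.

    Non-definability.  Since real numbers have unique real cube roots,
    SL_3(R) -> PGL_3(R) is an isomorphism ([PGL3_section]), and a group that
    descends to PGL_3(R) has a faithful real representation of degree 3.  In
    such a representation an element of order 3 has trace 0, so that a subgroup
    (Z/3)^2, as in A_6, would fix a space of dimension 3/9.  An element of order
    7 conjugate to its square, as in PSL(2,7), would have a trace t with
    [t ^ 2 + t + 2 = 0], and that equation has no real root.  The Hessian groups
    contain S and T, which commute although their lifts to matrices do not,
    whereas real lifts of determinant 1 would.  They have real moduli because
    conjugation fixes T and inverts S, U and V. *)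

Set Implicit Arguments.
Unset Strict Implicit.
Unset Printing Implicit Defensive.

Import Order.TTheory GRing.Theory Num.Theory.

Local Open Scope classical_set_scope.
Local Open Scope ring_scope.

(** * Matrices of size three and their classes *)

Lemma I3_ind (P : 'I_3 -> Prop) : P 0 -> P 1 -> P 2 -> forall i, P i.
Proof.
move=> P0 P1 P2 [[|[|[|//]]] i3].
- by rewrite (_ : Ordinal i3 = 0) //; apply: val_inj.
- by rewrite (_ : Ordinal i3 = 1) //; apply: val_inj.
- by rewrite (_ : Ordinal i3 = 2) //; apply: val_inj.
Qed.

Lemma det_mx3 (R : comNzRingType) (M : 'M[R]_3) :
  \det M = M 0 0 * (M 1 1 * M 2 2 - M 1 2 * M 2 1)
         - M 0 1 * (M 1 0 * M 2 2 - M 1 2 * M 2 0)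
         + M 0 2 * (M 1 0 * M 2 1 - M 1 1 * M 2 0).
Proof.
rewrite (expand_det_row _ ord0) !big_ord_recl big_ord0 /cofactor.
rewrite !(expand_det_row _ ord0) !big_ord_recl !big_ord0 /cofactor.
rewrite !det_mx11 !mxE.
pose m i j := M (inord i) (inord j).
have ME i j : M i j = m (val i) (val j) by rewrite /m !inord_val.
by rewrite !ME /= /bump /=; ring.
Qed.

Lemma mul_mx3 (F : nzRingType) (a b c d e f g h i a' b' c' d' e' f' g' h' i' : F) :
  mx3 [:: [:: a; b; c]; [:: d; e; f]; [:: g; h; i]] *m
  mx3 [:: [:: a'; b'; c']; [:: d'; e'; f']; [:: g'; h'; i']] =
  mx3 [:: [:: a * a' + b * d' + c * g'; a * b' + b * e' + c * h'; a * c' + b * f' + c * i'];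
          [:: d * a' + e * d' + f * g'; d * b' + e * e' + f * h'; d * c' + e * f' + f * i'];
          [:: g * a' + h * d' + i * g'; g * b' + h * e' + i * h'; g * c' + h * f' + i * i']].
Proof.
apply/matrixP; apply: I3_ind; apply: I3_ind;
  by rewrite !(mxE, big_ord_recl, big_ord0) /= addr0 addrA.
Qed.

Lemma scale_mx3 (F : nzRingType) (k a b c d e f g h i : F) :
  k *: mx3 [:: [:: a; b; c]; [:: d; e; f]; [:: g; h; i]] =
  mx3 [:: [:: k * a; k * b; k * c]; [:: k * d; k * e; k * f]; [:: k * g; k * h; k * i]].
Proof. by apply/matrixP; apply: I3_ind; apply: I3_ind; rewrite !mxE. Qed.

Lemma mx3_scalar (F : nzRingType) (a : F) :
  a%:M = mx3 [:: [:: a; 0; 0]; [:: 0; a; 0]; [:: 0; 0; a]].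
Proof. by apply/matrixP; apply: I3_ind; apply: I3_ind; rewrite !mxE. Qed.

Lemma map_mx3 (F F' : nzRingType) (f : F -> F') (a b c d e f' g h i : F) :
  map_mx f (mx3 [:: [:: a; b; c]; [:: d; e; f']; [:: g; h; i]]) =
  mx3 [:: [:: f a; f b; f c]; [:: f d; f e; f f']; [:: f g; f h; f i]].
Proof. by apply/matrixP; apply: I3_ind; apply: I3_ind; rewrite !mxE. Qed.

Lemma mxclass_surj (F : fieldType) n (g : PGL F n) :
  exists2 M : 'M[F]_n, M \in unitmx & g = mxclass M.
Proof. by exists (val (generic_quotient.repr g)); [apply: valP|rewrite mxclass_repr]. Qed.

Lemma mxclassX (F : fieldType) (M : 'M[F]_3) n : M \in unitmx ->
  (mxclass M ^+ n)%g = mxclass (M ^+ n).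
Proof.
move=> uM; have uMX k : M ^+ k \in unitmx.
  by elim: k => [|k IH]; rewrite ?expr0 ?unitmx1// exprS unitmx_mul uM.
elim: n => [|n IH]; first by rewrite expg0 expr0 mxclass1.
by rewrite expgS IH exprS mxclassM.
Qed.

Lemma mxclassZ (F : fieldType) n (k : F) (M : 'M[F]_n) :
  k != 0 -> M \in unitmx -> mxclass (k *: M) = mxclass M.
Proof.
move=> k0 uM; have ukM : k *: M \in unitmx by rewrite unitmxZ ?unitfE.
by apply/esym/(mxclassP uM ukM); exists k.
Qed.

Lemma mxclass_scalar_inv (F : fieldType) (n : nat) (M N : 'M[F]_n) (k : F) :
  k != 0 -> M *m N = k%:M ->
  [/\ M \in unitmx, N \in unitmx & mxclass N = (mxclass M)^-1%g].
Proof.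
move=> k0 MN; have MN1 : M *m (k^-1 *: N) = 1%:M.
  by rewrite -scalemxAr MN scale_scalar_mx mulVf.
have [uM ukN] := mulmx1_unit MN1.
have uN : N \in unitmx by rewrite -(@unitmxZ _ _ k^-1) ?unitfE ?invr_eq0.
split=> //; apply: (mulgI (mxclass M)); rewrite mulgV -mxclassM// MN -mxclass1.
apply/esym/mxclassP; rewrite ?unitmx1 ?unitmx_mul -?MN ?unitmx_mul ?uM//.
by exists k; rewrite // MN scalemx1.
Qed.

(** The hypothesis avoids inverses: it says that [P^-1 M P] is [N] up to a
    scalar. *)
Lemma mxclass_conj (F : fieldType) n (M N P : 'M[F]_n) k :
  M \in unitmx -> P \in unitmx -> k != 0 -> P *m N = k *: (M *m P) ->
  N \in unitmx /\ ((mxclass P)^-1 * mxclass M * mxclass P)%g = mxclass N.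
Proof.
move=> uM uP k0 e.
have uMP : k *: (M *m P) \in unitmx by rewrite unitmxZ ?unitfE// unitmx_mul uM.
have uN : N \in unitmx by move: uMP; rewrite -e unitmx_mul => /andP[].
split=> //; apply: (mulgI (mxclass P)); rewrite !mulgA mulgV mul1g.
apply: etrans (esym (mxclassM uM uP)) _; apply: etrans _ (mxclassM uP uN).
have uMP' : M *m P \in unitmx by rewrite unitmx_mul uM.
have uPN : P *m N \in unitmx by rewrite unitmx_mul uP.
by apply/(mxclassP uMP' uPN); exists k.
Qed.

Lemma map_PGLM (F F' : fieldType) (f : {rmorphism F -> F'}) n :
  {morph @map_PGL F F' f n : g h / (g * h)%g}.
Proof.
move=> g h; have [M uM ->] := mxclass_surj g; have [N uN ->] := mxclass_surj h.
rewrite -mxclassM// !map_PGL_mxclass ?unitmx_mul ?uM//.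
by rewrite map_mxM mxclassM ?map_unitmx.
Qed.

(** * Subgroups given by generators *)

Section SubgroupSets.
Variable gT : groupType.
Implicit Types (A B G H : set gT) (x y : gT).

Lemma generated_min A B : is_subgroup B -> A `<=` B -> generated A `<=` B.
Proof. by move=> sB AB x; apply; split. Qed.

Lemma sub_generated A : A `<=` generated A.
Proof. by move=> x Ax B [_]; apply. Qed.

Lemma generated_subgroup A : is_subgroup (generated A).
Proof.
split=> [B [[]]//|x y Gx Gy B BA|x Gx B BA]; have [[_ BM BV] _] := BA.
- by apply: BM; [apply: Gx|apply: Gy].
- by apply: BV; apply: Gx.
Qed.

Lemma generated_eq A B :
  A `<=` generated B -> B `<=` generated A -> generated A = generated B.
Proof.
by move=> AB BA; apply/seteqP; split;
  apply: generated_min => //; apply: generated_subgroup.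
Qed.

Lemma conj_setM G x y : conj_set (conj_set G x) y = conj_set G (x * y)%g.
Proof.
apply/seteqP; split=> [_ [_ [g Gg <-] <-]|_ [g Gg <-]].
  by exists g => //; rewrite conjgM.
by exists (g ^ x)%g; [exists g|rewrite conjgM].
Qed.

Lemma conj_set1 G : conj_set G 1%g = G.
Proof.
apply/seteqP; split=> [_ [g Gg <-]|g Gg]; first by rewrite conjg1.
by exists g; rewrite ?conjg1.
Qed.

Lemma conjugate_sets_sym G H : conjugate_sets G H -> conjugate_sets H G.
Proof. by move=> [x ->]; exists x^-1%g; rewrite conj_setM mulgV conj_set1. Qed.

Lemma conjugate_sets_trans G H K :
  conjugate_sets G H -> conjugate_sets H K -> conjugate_sets G K.
Proof. by move=> [x ->] [y ->]; exists (x * y)%g; rewrite conj_setM. Qed.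

End SubgroupSets.

Section Images.
Variables (gT hT : groupType) (f : gT -> hT).
Hypothesis fM : {morph f : x y / (x * y)%g}.

Lemma morph1g : f 1%g = 1%g.
Proof. by apply: (mulgI (f 1%g)); rewrite -fM !mulg1. Qed.

Lemma morphVg x : f x^-1%g = (f x)^-1%g.
Proof. by apply: (mulgI (f x)); rewrite -fM !mulgV morph1g. Qed.

Lemma image_generated A : f @` generated A = generated (f @` A).
Proof.
apply/seteqP; split.
  move=> _ [x Ax <-].
  suff : generated A `<=` f @^-1` generated (f @` A) by apply.
  have [G1 GM GV] := generated_subgroup (f @` A).
  apply: generated_min; last by move=> y Ay; apply: sub_generated; exists y.
  split=> [|y z /= Gy Gz|y /= Gy]; first by rewrite /= morph1g.
    by rewrite fM; apply: GM.
  by rewrite morphVg; apply: GV.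
have [G1 GM GV] := generated_subgroup A.
apply: generated_min => [|_ [x Ax <-]].
  split=> [|_ _ [x Gx <-] [y Gy <-]|_ [x Gx <-]].
  - by exists 1%g; rewrite ?morph1g.
  - by exists (x * y)%g; [apply: GM|rewrite fM].
  - by exists x^-1%g; [apply: GV|rewrite morphVg].
by exists x => //; apply: sub_generated.
Qed.

End Images.

Lemma conj_set_generated (gT : groupType) (A : set gT) (x : gT) :
  conj_set (generated A) x = generated (conj_set A x).
Proof. by apply: image_generated => y z; rewrite conjMg. Qed.

Section PartialMorphism.
Variables (hT : finGroupType) (gT : groupType) (H : {group hT}) (f : hT -> gT).
Hypothesis fM : {in H &, {morph f : x y / (x * y)%g}}.

Lemma pmorph1 : f 1%g = 1%g.
Proof. by apply: (mulgI (f 1%g)); rewrite -fM ?group1// !mulg1. Qed.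

Lemma pmorphV x : x \in H -> f x^-1%g = (f x)^-1%g.
Proof. by move=> Hx; apply: (mulgI (f x)); rewrite -fM ?groupV// !mulgV pmorph1. Qed.

Lemma pmorphX x n : x \in H -> f (x ^+ n)%g = (f x ^+ n)%g.
Proof.
move=> Hx; elim: n => [|n IH]; first by rewrite !expg0 pmorph1.
by rewrite !expgS fM ?groupX// IH.
Qed.

Lemma pmorphJ x y : x \in H -> y \in H -> f (x ^ y)%g = (f x ^ f y)%g.
Proof. by move=> Hx Hy; rewrite !conjgE !fM ?groupM ?groupV// pmorphV. Qed.

End PartialMorphism.

(** The elements of [H] that [f] sends into the subgroup generated by the image
    of [A] form a subgroup containing [A]. *)
Lemma isomorphic_generated (hT : finGroupType) (gT : groupType) (A : {set hT})
    (H : {group hT}) (f : hT -> gT) (G : set gT) :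
  {in H &, {morph f : x y / (x * y)%g}} -> set_bij [set` H] G f ->
  <<A>>%g = H -> G = generated (f @` [set` A]).
Proof.
move=> fM [fG _ Gf] AH.
have AsH : A \subset H by rewrite -AH subset_gen.
have f1 := pmorph1 fM; have fV := pmorphV fM.
have [G1 GM GV] := generated_subgroup (f @` [set` A]).
apply/seteqP; split.
  move=> _ /Gf[x Hx <-].
  pose K := [set y in H | `[< generated (f @` [set` A]) (f y) >]]%SET.
  have KG : group_set K.
    apply/group_setP; split=> [|y z].
      by rewrite inE group1/=; apply/asboolP; rewrite f1.
    rewrite !inE => /andP[Hy /asboolP Gy] /andP[Hz /asboolP Gz].
    by rewrite groupM//=; apply/asboolP; rewrite fM//; apply: GM.
  have AK : A \subset Group KG.
    apply/fintype.subsetP => y Ay; rewrite inE (fintype.subsetP AsH)//=.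
    by apply/asboolP; apply: sub_generated; exists y.
  have : x \in Group KG.
    by apply: (fintype.subsetP (_ : <<A>> \subset Group KG))%g;
      rewrite ?gen_subG// AH.
  by rewrite inE => /andP[_ /asboolP].
apply: generated_min => [|_ [x /= Ax <-]]; last first.
  by apply: fG; rewrite /= (fintype.subsetP AsH).
split=> [|_ _ /Gf[x Hx <-] /Gf[y Hy <-]|_ /Gf[x Hx <-]].
- by rewrite -f1; apply: fG; rewrite /= group1.
- by rewrite -fM//; apply: fG; rewrite /= groupM.
- by rewrite -fV//; apply: fG; rewrite /= groupV.
Qed.

(** * Products of two involutions *)

(** An endomorphism of finite order has no nontrivial Jordan block in
    characteristic 0: if [Z = (X - a) Y] is killed by [X - a], then
    [X ^ n Y = a ^ n Y + n a ^ (n - 1) Z]. *)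
Lemma semisimple_eigen (F : numFieldType) (A : algType F) (X Y : A) (a : F) n :
  (0 < n)%N -> X ^+ n = 1 ->
  (X - a%:A) * ((X - a%:A) * Y) = 0 -> (X - a%:A) * Y = 0.
Proof.
move=> n0 Xn; set Z := _ * Y => /eqP; rewrite mulrBl subr_eq0 mulr_algl => /eqP XZ.
have XY : X * Y = a *: Y + Z by rewrite /Z mulrBl mulr_algl addrC subrK.
have XkZ k : X ^+ k * Z = a ^+ k *: Z.
  elim: k => [|k IH]; first by rewrite !expr0 mul1r scale1r.
  by rewrite exprSr -mulrA XZ -scalerAr IH scalerA -exprS.
have XkY k : X ^+ k.+1 * Y = a ^+ k.+1 *: Y + (a ^+ k *+ k.+1) *: Z.
  elim: k => [|k IH]; first by rewrite !expr1 expr0 scale1r.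
  rewrite exprSr -mulrA XY mulrDr -scalerAr IH XkZ scalerDr !scalerA -addrA.
  by rewrite -exprS -scalerDl mulrnAr -exprS -mulrSr.
case: n n0 Xn => // n _ Xn.
have := XkZ n.+1; rewrite Xn mul1r => /eqP; rewrite -subr_eq0 -{1}[Z]scale1r -scalerBl.
rewrite scaler_eq0 => /orP[|/eqP//]; rewrite subr_eq0 => /eqP an.
have := XkY n; rewrite Xn mul1r -an scale1r => /eqP.
rewrite -subr_eq0 opprD addNKr oppr_eq0 scaler_eq0 mulrn_eq0/= => /orP[|/eqP//].
rewrite expf_eq0 => /andP[_ /eqP a0]; move: an.
by rewrite a0 expr0n/= => /eqP; rewrite ?[0 == _]eq_sym oner_eq0.
Qed.

Section TwoProjectors.
Variables (F : numClosedFieldType) (A : algType F).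
Implicit Types (P Q X Y : A) (t u a b : F).

(** The candidates for [l] and [l^-1] are the roots of [x ^ 2 - u x + 1].  Having
    finite order, [X] is diagonalisable, so that [l = 1] would give [X = 1] and
    [l = -1] would give [X ^ 2 = 1]. *)
Lemma eigenvalue_of_order X u n : (0 < n)%N -> X ^+ n = 1 -> X != 1 ->
  (X * X - u *: X + 1) * (X - 1) = 0 ->
  exists l : F, [/\ l ^+ n = 1, l != 1, u = l + l^-1 & X * X != 1 -> l != -1].
Proof.
move=> n0 Xn X1 q.
(* l and m = l^-1 are the roots of X ^ 2 - u X + 1. *)
pose d := sqrtC (u ^+ 2 - 4); pose l := (u + d) / 2; pose m := (u - d) / 2.
have d2 : d ^+ 2 = u ^+ 2 - 4 by rewrite sqrtCK.
have lm : l * m = 1.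
  have -> : l * m = (u ^+ 2 - d ^+ 2) / 4 by rewrite /l /m; field.
  by rewrite d2; field.
have lDm : l + m = u by rewrite /l /m; field.
have l0 : l != 0.
  by apply/eqP => l0; move: lm; rewrite l0 mul0r => /esym/eqP; rewrite oner_eq0.
have mV : m = l^-1 by apply: (mulfI l0); rewrite lm divff.
have fac : (X - l%:A) * ((X - m%:A) * (X - 1)) = 0.
  rewrite mulrA -[RHS]q; congr (_ * _).
  rewrite mulrBl !mulrBr -scalerAl mul1r -scalerAr mulr1 -[in RHS]lDm scalerDl.
  by rewrite mulr_algl scalerA lm scale1r opprB opprD [1 - _]addrC !addrA [in RHS]addrAC.
have rootn a Z : Z != 0 -> (X - a%:A) * Z = 0 -> a ^+ n = 1.
  move=> Z0 /eqP; rewrite mulrBl subr_eq0 mulr_algl => /eqP XZ.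
  have XkZ k : X ^+ k * Z = a ^+ k *: Z.
    elim: k => [|k IH]; first by rewrite !expr0 mul1r scale1r.
    by rewrite exprSr -mulrA XZ -scalerAr IH scalerA -exprS.
  have /eqP := XkZ n; rewrite Xn mul1r -subr_eq0 -{1}[Z]scale1r -scalerBl.
  by rewrite scaler_eq0 (negPf Z0) orbF subr_eq0 => /eqP.
have Xne : X - 1 != 0 by rewrite subr_eq0.
exists l; split.
- have [e|Z0] := eqVneq ((X - m%:A) * (X - 1)) 0; last exact: rootn Z0 fac.
  have := rootn _ _ Xne e; rewrite mV exprVn => /(congr1 (fun x => x^-1)).
  by rewrite invrK invr1.
- apply/eqP => l1; move: fac; rewrite mV l1 invr1 => fac.
  have E := semisimple_eigen n0 Xn fac.
  have E' : (X - 1%:A) * ((X - 1%:A) * 1) = 0 by rewrite mulr1 -[RHS]E scale1r.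
  have := semisimple_eigen n0 Xn E'.
  by rewrite mulr1 scale1r => /eqP; rewrite (negPf Xne).
- by rewrite -mV.
move=> X2; apply/eqP => l1; move: fac; rewrite mV l1 invrN invr1 => fac.
have := semisimple_eigen n0 Xn fac.
rewrite scaleNr scale1r opprK mulrDl mul1r mulrBr mulr1 addrA subrK => /eqP.
by rewrite subr_eq0 (negPf X2).
Qed.

Lemma involution_of_proj P : P * P = P -> (P *+ 2 - 1) * (P *+ 2 - 1) = 1.
Proof.
move=> PP; rewrite mulrBl mul1r mulrBr mulr1 mulrnAl mulrnAr PP -mulrnA.
by rewrite -mulrnBr// opprB addrA [_ *+ _ + 1]addrC addrK.
Qed.

Lemma involutions_anticomm P Q t :
  P * P = P -> P * Q * P = t *: P ->
  ((P *+ 2 - 1) * (Q *+ 2 - 1) + (Q *+ 2 - 1) * (P *+ 2 - 1)) * P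
  = (4 * t - 2) *: P.
Proof.
move=> PP PQP.
have eP : (P *+ 2 - 1) * P = P.
  by rewrite mulrBl mul1r mulrnAl PP mulr2n addrK.
have eQ : (Q *+ 2 - 1) * P = (Q * P) *+ 2 - P.
  by rewrite mulrBl mul1r mulrnAl.
rewrite mulrDl -!mulrA eP eQ mulrBr eP mulrnAr mulrBl mul1r (mulrnAl P) (mulrA P) PQP.
rewrite mulrnBl -mulrnA -!scaler_nat scalerA.
rewrite -addrA [X in _ + X]addrC -!addrA; set T := Q * P.
have -> : (4 * t - 2) *: P = (4 * t) *: P - P - P.
  by rewrite scalerBl -[2 in LHS](natrD _ 1 1) scalerDl scale1r opprD addrA.
by rewrite addKr addrA.
Qed.

(** The sum [X + X^-1] acts on the images of both projectors as the scalar
    [4 t - 2], and [X - 1] maps into the sum of these images. *)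
Lemma product_of_involutions_quadratic P Q t :
  P * P = P -> Q * Q = Q -> P * Q * P = t *: P -> Q * P * Q = t *: Q ->
  let X := (P *+ 2 - 1) * (Q *+ 2 - 1) in
  (X * X - (4 * t - 2) *: X + 1) * (X - 1) = 0.
Proof.
move=> PP QQ PQP QPQ X; pose Xi := (Q *+ 2 - 1) * (P *+ 2 - 1).
have XXi : X * Xi = 1.
  rewrite /X /Xi mulrA -(mulrA (P *+ 2 - 1)) (involution_of_proj QQ) mulr1.
  exact: involution_of_proj.
have EP := involutions_anticomm PP PQP.
have EQ := involutions_anticomm QQ QPQ; rewrite addrC in EQ.
have -> : X * X - (4 * t - 2) *: X + 1 = X * (X + Xi - (4 * t - 2)%:A).
  by rewrite mulrBr mulrDr XXi -scalerAr mulr1 addrAC.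
have -> : X - 1 = P * (Q *+ 4 - 1 *+ 2) - Q *+ 2.
  rewrite /X mulrBl mul1r mulrBr mulr1 mulrBr mulrnAl mulrnAr -mulrnA.
  by rewrite -[LHS]addrA -opprD subrK !mulrnAr mulr1.
have kP : (X + Xi - (4 * t - 2)%:A) * P = 0.
  by rewrite mulrBl EP mulr_algl subrr.
have kQ : (X + Xi - (4 * t - 2)%:A) * Q = 0.
  by rewrite mulrBl EQ mulr_algl subrr.
by rewrite -mulrA mulrBr mulrA kP mul0r mulrnAr kQ mul0rn subrr mulr0.
Qed.

End TwoProjectors.

Section Homologies.
Variable F : numClosedFieldType.
Implicit Types (v : 'cV[F]_3) (w : 'rV[F]_3) (g h : PGL F 3).

Definition dot w v : F := (w *m v) 0 0.

Definition homology_mx v w : 'M[F]_3 := (v *m w) *+ 2 - 1.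

Definition homology v w : PGL F 3 := mxclass (homology_mx v w).

Lemma mul_rank1 v w v' w' :
  (v *m w) *m (v' *m w') = dot w v' *: (v *m w').
Proof.
rewrite mulmxA -(mulmxA v) [w *m v']mx11_scalar mul_mx_scalar.
by rewrite -scalemxAl.
Qed.

Lemma dotZ a b v w : dot (a *: w) (b *: v) = a * b * dot w v.
Proof. by rewrite /dot -scalemxAl -scalemxAr scalerA mxE. Qed.

Lemma homology_mxK v w : dot w v = 1 ->
  homology_mx v w * homology_mx v w = 1.
Proof.
move=> wv; apply: involution_of_proj.
by rewrite -[LHS]/(v *m w *m (v *m w)) mul_rank1 wv scale1r.
Qed.

Lemma unit_homology_mx v w : dot w v = 1 -> homology_mx v w \in unitmx.
Proof. by move=> /homology_mxK/mulmx1_unit[]. Qed.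

Lemma homologyK v w : dot w v = 1 -> (homology v w * homology v w)%g = 1%g.
Proof.
move=> wv; rewrite -mxclassM ?unit_homology_mx// -mxclass1; congr mxclass.
exact: homology_mxK.
Qed.

(** The projective order of a product of two homologies is also the order of
    the product of their normalised matrices, whose third eigenvalue is 1. *)
Lemma homology_product_eigenvalue v w v' w' n :
  dot w v = 1 -> dot w' v' = 1 -> (0 < n)%N ->
  homology v w != homology v' w' ->
  ((homology v w * homology v' w') ^+ n)%g = 1%g ->
  exists l : F, [/\ l ^+ n = 1, l != 1,
    4 * (dot w v' * dot w' v) - 2 = l + l^-1 &
    ((homology v w * homology v' w') ^+ 2)%g != 1%g -> l != -1].
Proof.
move=> wv wv' n0 ne; set t := dot w v' * _.
have u1 := unit_homology_mx wv; have u2 := unit_homology_mx wv'.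
rewrite -mxclassM// mxclassX ?unitmx_mul ?u1// -mxclass1 mxclassX ?unitmx_mul ?u1//.
set X := _ *m _ => e.
have uX k : X ^+ k \in unitmx.
  elim: k => [|k IH]; first by rewrite expr0 unitmx1.
  by rewrite exprS unitmx_mul IH unitmx_mul u1 u2.
have q : (X * X - (4 * t - 2) *: X + 1) * (X - 1) = 0.
  have -> : X = (v *m w *+ 2 - 1) * (v' *m w' *+ 2 - 1) by [].
  apply: product_of_involutions_quadratic.
  - by rewrite -[LHS]/(v *m w *m (v *m w)) mul_rank1 wv scale1r.
  - by rewrite -[LHS]/(v' *m w' *m (v' *m w')) mul_rank1 wv' scale1r.
  - rewrite -[_ * _ * _]/(v *m w *m (v' *m w') *m (v *m w)).
    by rewrite mul_rank1 -scalemxAl mul_rank1 scalerA.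
  - rewrite -[_ * _ * _]/(v' *m w' *m (v *m w) *m (v' *m w')).
    by rewrite mul_rank1 -scalemxAl mul_rank1 scalerA [dot w' v * _]mulrC.
have Xn : X ^+ n = 1.
  have [c c0 cX] := iffLR (mxclassP (unitmx1 _ _) (uX n)) (esym e).
  rewrite cX.
  (* X - 1 has rank at most 2, so X has a fixed row, and the scalar c is 1. *)
  have [r r0 rX] : exists2 r : 'rV[F]_3, r != 0 & r *m X = r.
    have : (\rank (X - 1%:M)%R <= 2)%N.
      have -> : X - 1%:M = v *m (w *m v' *m w' *+ 4 - w *+ 2) - v' *m (w' *+ 2).
        rewrite /X /homology_mx -!scaler_nat mulmxBl mul1mx !mulmxBr mulmx1.
        rewrite -?scalemxAr -?scalemxAl -?scalemxAr ?scalerA -?mulmxA -?natrM.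
        by rewrite -[LHS]addrA -opprD subrK.
      apply: leq_trans (mxrank_add _ _) _; rewrite mxrank_opp.
      by apply: (@leq_add _ _ 1 1); apply: leq_trans (mxrankM_maxl _ _) (rank_leq_col _).
    move=> rk; have : kermx (X - 1%:M) != 0.
      by rewrite -mxrank_eq0 mxrank_ker -lt0n subn_gt0.
    case/rowV0Pn => r /sub_kermxP; rewrite mulmxBr mulmx1 => /eqP.
    by rewrite subr_eq0 => /eqP rX r0; exists r.
  have : r *m (X ^+ n : 'M_3) = r.
    by elim: (n) => [|k IH]; rewrite ?expr0 ?mulmx1// exprS mulmxA rX.
  rewrite cX -scalemxAr mulmx1 => /eqP; rewrite -subr_eq0 -[Y in _ - Y]scale1r -scalerBl.
  by rewrite scaler_eq0 (negPf r0) orbF subr_eq0 => /eqP ->; rewrite scale1r.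
have X1 : X != 1.
  apply: contraNneq ne => X1; apply/eqP; rewrite /homology; congr mxclass.
  have : homology_mx v w *m X = homology_mx v w by rewrite X1 mulmx1.
  by rewrite mulmxA [_ *m homology_mx v w]homology_mxK// mul1mx => ->.
have [l [l1 l2 l3 l4]] := eigenvalue_of_order n0 Xn X1 q.
exists l; split=> // ne2; apply: l4; apply: contraNneq ne2 => X2.
by rewrite expr2 X2.
Qed.

End Homologies.

(** * Involutions of PGL_3 are homologies *)

Section Idempotents.
Variables (F : fieldType) (n : nat).
Implicit Types (P : 'M[F]_n).

(** For a factorisation [P = B C] through the rank, [C B] is the identity. *)
Lemma mxtrace_idempotent P : P *m P = P -> \tr P = (\rank P)%:R.
Proof.
move=> PP; have := (col_base_full P, row_base_free P, mulmx_base P).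
move: (col_base P) (row_base P) => B C [[fB fC] BC].
rewrite -[in LHS]BC mxtrace_mulC.
suff -> : C *m B = 1%:M by rewrite mxtrace1.
apply: (row_free_inj fC); apply: (row_full_inj fB); rewrite mul1mx.
by rewrite mulmxA mulmxA BC -mulmxA BC.
Qed.

End Idempotents.

Section Triples.
Variable F : numClosedFieldType.
Implicit Types (v : 'cV[F]_3) (w : 'rV[F]_3) (g h : PGL F 3).

Lemma rank1_idempotent (P : 'M[F]_3) : P *m P = P -> \rank P = 1%N ->
  exists v w, dot w v = 1 /\ P = v *m w.
Proof.
move=> PP r1; have P0 : P != 0 by rewrite -mxrank_eq0 r1.
have := mulmx_base P; move: (col_base P) (row_base P); rewrite r1 => v w vw.
exists v, w; split=> //; move: PP; rewrite -vw mul_rank1 => /eqP.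
rewrite -subr_eq0 -[Y in _ - Y]scale1r -scalerBl scaler_eq0 vw (negPf P0) orbF.
by rewrite subr_eq0 => /eqP.
Qed.

(** Once the matrix is scaled to have square 1, its eigenspaces for 1 and -1
    have dimensions adding up to 3, none of them 0. *)
Lemma involution_homology g : (g * g)%g = 1%g -> g != 1%g ->
  exists v w, dot w v = 1 /\ g = homology v w.
Proof.
rewrite -[g]mxclass_repr; set M := val _; have uM : M \in unitmx by apply: valP.
rewrite -mxclassM// -mxclass1 => /esym/mxclassP; rewrite unitmx1 unitmx_mul uM.
move=> /(_ isT isT)[c c0 cM] ne.
pose d := sqrtC c; have d0 : d != 0 by rewrite sqrtC_eq0.
pose N := d^-1 *: M; have uN : N \in unitmx by rewrite unitmxZ ?unitfE ?invr_eq0.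
have NN : N *m N = 1%:M.
  rewrite /N -scalemxAl -scalemxAr scalerA cM scalerA -invfM -expr2 sqrtCK.
  by rewrite mulVf// scale1r.
have gN a : a != 0 -> mxclass M = mxclass (a *: N).
  move=> a0; have uaN : a *: N \in unitmx by rewrite unitmxZ ?unitfE.
  apply/(mxclassP uM uaN).
  by exists (a / d); rewrite ?scalerA// mulf_neq0// invr_eq0.
have N1 a : a != 0 -> a *: N != 1%:M.
  by move=> a0; apply: contraNneq ne => aN; rewrite (gN a)// aN mxclass1.
pose P a : 'M[F]_3 := 2^-1 *: (1%:M + a *: N).
have PP a : a * a = 1 -> P a *m P a = P a.
  move=> aa; rewrite /P -scalemxAl -scalemxAr scalerA mulmxDl mul1mx mulmxDr mulmx1.
  rewrite -scalemxAl -scalemxAr NN scalerA aa scale1r addrACA [a *: _ + _]addrC -mulr2n.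
  by rewrite -scaler_nat scalerA -mulrA mulVf ?pnatr_eq0// mulr1.
have Phom a : a * a = 1 -> \rank (P a) = 1%N ->
  exists v w, dot w v = 1 /\ mxclass M = homology v w.
  move=> aa r1; have [v [w [wv e]]] := rank1_idempotent (PP a aa) r1.
  exists v, w; split=> //; rewrite (gN a); last first.
    by apply/eqP => a0; move: aa; rewrite a0 mul0r => /esym/eqP; rewrite oner_eq0.
  rewrite /homology /homology_mx -e /P -(scaler_nat 2 (_ *: _)) scalerA mulfV ?pnatr_eq0//.
  by rewrite scale1r [1%:M + _]addrC addrK.
have P0 a : a * a = 1 -> \rank (P a) != 0%N.
  move=> aa; rewrite mxrank_eq0 scaler_eq0 invr_eq0 pnatr_eq0/=.
  have := N1 (- a); rewrite oppr_eq0 scaleNr => H.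
  rewrite addr_eq0 eq_sym; apply: H.
  by apply/eqP => a0; move: aa; rewrite a0 mul0r => /esym/eqP; rewrite oner_eq0.
(* the two eigenspaces meet trivially, so one of them is a line *)
have sum : (\rank (P 1%R) + \rank (P (-1)%R) <= 3)%N.
  apply: mulmx0_rank_max; rewrite /P -scalemxAl -scalemxAr mulmxDl mul1mx mulmxDr mulmx1.
  by rewrite !scaleN1r !scale1r mulmxN NN [N - _]addrC addrACA subrr addNr addr0 !scaler0.
have e1 : (1 : F) * 1 = 1 by rewrite mulr1.
have e2 : (-1 : F) * -1 = 1 by rewrite mulrNN mulr1.
have [r1|r1] := eqVneq (\rank (P 1%R)) 1%N; first exact: Phom r1.
apply: (Phom (-1)%R) => //.
suff : \rank (P (-1)%R) = 1%N by [].
have : \rank (P 1%R) != 0%N := P0 _ e1.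
have : \rank (P (-1)%R) != 0%N := P0 _ e2.
by move: sum r1; lia.
Qed.

(** If the Gram matrix is invertible, then the [v i] form a basis, and so do
    the [w i]; the two Gram matrices agreeing up to the scaling [l], the linear
    map that sends [v i] to a multiple of [v' i] also carries the [w i] to
    multiples of the [w' i]. *)
Lemma homologies_rigid (v v' : 'I_3 -> 'cV[F]_3) (w w' : 'I_3 -> 'rV[F]_3)
    (l : 'I_3 -> F) :
  (forall i, dot (w i) (v i) = 1) -> (forall i, dot (w' i) (v' i) = 1) ->
  (forall i, l i != 0) ->
  (forall i j, dot (w' i) (v' j) * l i = dot (w i) (v j) * l j) ->
  \det (\matrix_(i, j) dot (w i) (v j)) != 0 ->
  exists x, forall i, homology (v' i) (w' i) = (homology (v i) (w i) ^ x)%g.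
Proof.
move=> wv wv' l0 E dG.
pose V : 'M[F]_3 := \matrix_(i, j) v j i 0; pose W : 'M[F]_3 := \matrix_(i, j) w i 0 j.
pose V' : 'M[F]_3 := \matrix_(i, j) ((l j)^-1 * v' j i 0).
pose W' : 'M[F]_3 := \matrix_(i, j) (l i * w' i 0 j).
have WV : W *m V = \matrix_(i, j) dot (w i) (v j).
  by apply/matrixP => i j; rewrite !mxE /dot mxE; apply: eq_bigr => k _; rewrite !mxE.
have WV' : W' *m V' = W *m V.
  rewrite WV; apply/matrixP => i j; rewrite !mxE.
  transitivity (l i / l j * dot (w' i) (v' j)); last first.
    by rewrite mulrAC [l i * _]mulrC E mulfK.
  rewrite /dot mxE mulr_sumr; apply: eq_bigr => k _; rewrite !mxE.
  by rewrite mulrACA.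
have [uW uV] : W \in unitmx /\ V \in unitmx.
  by apply/andP; rewrite -unitmx_mul WV unitmxE unitfE.
have uV' : V' \in unitmx.
  by have := unitmx_mul W' V'; rewrite WV' unitmx_mul uW uV => /esym/andP[].
pose X := V' *m invmx V; have uX : X \in unitmx by rewrite unitmx_mul uV' unitmx_inv.
have XV : X *m V = V' by rewrite mulmxKV.
have WX : W' *m X = W by rewrite mulmxA WV' mulmxK.
have Xv i : X *m v i = (l i)^-1 *: v' i.
  have /matrixP e := XV; apply/matrixP => a b; have := e a i; rewrite [b]ord1 !mxE => <-.
  by apply: eq_bigr => k _; rewrite !mxE.
have wX i : w' i *m X = (l i)^-1 *: w i.
  have /matrixP e := WX; apply/matrixP => a b; have := e i b; rewrite [a]ord1 !mxE => <-.
  rewrite mulr_sumr; apply: eq_bigr => k _; rewrite !mxE.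
  by rewrite -mulrA mulKf.
exists (mxclass X)^-1%g => i; rewrite conjgE invgK.
apply: (mulIg (mxclass X)); rewrite -mulgA mulgVK.
rewrite -!mxclassM ?unit_homology_mx//; congr mxclass.
rewrite /homology_mx mulmxBl mul1mx mulmxBr mulmx1 -!scaler_nat -scalemxAl -scalemxAr.
by rewrite -mulmxA wX mulmxA Xv -scalemxAr -scalemxAl.
Qed.

End Triples.

(** * Triples of homologies *)

Section TripleInvariants.
Variable F : numClosedFieldType.
Implicit Types (v : 'cV[F]_3) (w : 'rV[F]_3) (g h : PGL F 3).

(** The triangle of indices is connected through its edges 01 and 12, so that
    the entries of the Gram matrix can be normalised along these edges by a
    scaling; the entries 02 and 20 are then given by the triangular products.
    The last hypothesis is the determinant of the Gram matrix. *)
Lemma triple_rigid (v v' : 'I_3 -> 'cV[F]_3) (w w' : 'I_3 -> 'rV[F]_3) :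
  let g i j := dot (w i) (v j) in let g' i j := dot (w' i) (v' j) in
  (forall i, g i i = 1) -> (forall i, g' i i = 1) ->
  g' 0 1 * g' 1 0 = g 0 1 * g 1 0 -> g 0 1 * g 1 0 != 0 ->
  g' 1 2 * g' 2 1 = g 1 2 * g 2 1 -> g 1 2 * g 2 1 != 0 ->
  g' 0 1 * g' 1 2 * g' 2 0 = g 0 1 * g 1 2 * g 2 0 ->
  g' 0 2 * g' 2 1 * g' 1 0 = g 0 2 * g 2 1 * g 1 0 ->
  1 - g 0 1 * g 1 0 - g 1 2 * g 2 1 - g 0 2 * g 2 0
    + (g 0 1 * g 1 2 * g 2 0 + g 0 2 * g 2 1 * g 1 0) != 0 ->
  exists x, forall i, homology (v' i) (w' i) = (homology (v i) (w i) ^ x)%g.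
Proof.
move=> g g' g1 g'1 t01 t01n0 t12 t12n0 p q dG.
have /andP[g01 g10] : (g 0 1 != 0) && (g 1 0 != 0) by rewrite -negb_or -mulf_eq0.
have /andP[g12 g21] : (g 1 2 != 0) && (g 2 1 != 0) by rewrite -negb_or -mulf_eq0.
have /andP[g'01 g'10] : (g' 0 1 != 0) && (g' 1 0 != 0).
  by rewrite -negb_or -mulf_eq0 t01.
have /andP[g'12 g'21] : (g' 1 2 != 0) && (g' 2 1 != 0).
  by rewrite -negb_or -mulf_eq0 t12.
(* the scaling that matches the entries 01 and 12 of the two Gram matrices *)
pose l (i : 'I_3) : F := nth 0 [:: g 0 1 / g' 0 1; 1; g' 1 2 / g 1 2] i.
apply: (@homologies_rigid _ v v' w w' l) => //.
- by apply: I3_ind => /=; rewrite ?mulf_neq0 ?invr_eq0 ?oner_neq0.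
- apply: I3_ind; apply: I3_ind; rewrite /l /= -?/(g _ _) -?/(g' _ _) ?g1 ?g'1 ?mulr1 ?mul1r//.
  + by rewrite mulrCA divff// mulr1.
  + apply: (mulIf (_ : g' 0 1 * g 1 2 * (g' 2 1 * g' 1 0) != 0)); first by rewrite !mulf_neq0.
    move: q t01 t12 g'01 g12; clear; generalize (g 0 1) (g 1 0) (g 1 2) (g 2 1) (g 0 2)
      (g' 0 1) (g' 1 0) (g' 1 2) (g' 2 1) (g' 0 2) => a b c d e a' b' c' d' e' q t01 t12 a0 c0.
    transitivity ((e' * d' * b') * (a * c)); first by field.
    rewrite q; transitivity (e * ((c * d) * (a * b))); first by ring.
    by rewrite -t12 -t01; field.
  + apply: (mulfI g'01); rewrite t01.
    by rewrite [RHS]mulrC -!mulrA mulVf// mulr1 mulrC.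
  + by rewrite mulrCA divff// mulr1.
  + move: p g'01 g12; clear; generalize (g 0 1) (g 1 2) (g 2 0) (g' 0 1) (g' 1 2) (g' 2 0).
    move=> a c d a' c' d' p a0 c0; apply: (mulfI (_ : a' * c != 0)); first by rewrite mulf_neq0.
    transitivity (a' * c' * d'); first by field.
    by rewrite p; field.
  + by rewrite mulrA mulrC [g' 2 1 * _]mulrC t12 mulKf.
- rewrite det_mx3 !mxE -!/(g _ _) !g1 (_ : _ + _ = 1 - g 0 1 * g 1 0 - g 1 2 * g 2 1 - g 0 2 * g 2 0
    + (g 0 1 * g 1 2 * g 2 0 + g 0 2 * g 2 1 * g 1 0))//.
  by ring.
Qed.

Lemma homology_product_order3 v w v' w' :
  dot w v = 1 -> dot w' v' = 1 -> homology v w != homology v' w' ->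
  ((homology v w * homology v' w') ^+ 3)%g = 1%g ->
  dot w v' * dot w' v = 1 / 4.
Proof.
move=> d d' ne e; set t := _ * _.
have [l [l3 l1 E _]] := homology_product_eigenvalue d d' (isT : (0 < 3)%N) ne e.
have l0 : l != 0 by apply: contra_eq_neq l3 => ->; rewrite expr0n eq_sym oner_neq0.
suff q : l ^+ 2 + l + 1 = 0.
  apply: (mulfI (_ : 4 * l != 0)); first by rewrite mulf_neq0// pnatr_eq0.
  have -> : 4 * l * t = l * (4 * t - 2) + 2 * l by ring.
  rewrite E mulrDr divff//; transitivity (l ^+ 2 + l + 1 + l); first by ring.
  by rewrite q; field.
apply: (mulfI (_ : l - 1 != 0)); first by rewrite subr_eq0.
by transitivity (l ^+ 3 - 1); [ring|rewrite l3; ring].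
Qed.

Lemma homology_product_order4 v w v' w' :
  dot w v = 1 -> dot w' v' = 1 ->
  ((homology v w * homology v' w') ^+ 2)%g != 1%g ->
  ((homology v w * homology v' w') ^+ 4)%g = 1%g ->
  dot w v' * dot w' v = 1 / 2.
Proof.
move=> d d' ne2 e; set t := _ * _.
have ne : homology v w != homology v' w'.
  by apply: contraNneq ne2 => <-; rewrite homologyK// expg1n.
have [l [l4 l1 E lN1]] := homology_product_eigenvalue d d' (isT : (0 < 4)%N) ne e.
have {}lN1 := lN1 ne2.
have l0 : l != 0 by apply: contra_eq_neq l4 => ->; rewrite expr0n eq_sym oner_neq0.
suff q : l ^+ 2 + 1 = 0.
  apply: (mulfI (_ : 4 * l != 0)); first by rewrite mulf_neq0// pnatr_eq0.
  have -> : 4 * l * t = l * (4 * t - 2) + 2 * l by ring.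
  rewrite E mulrDr divff//; transitivity (l ^+ 2 + 1 + 2 * l); first by ring.
  by rewrite q; field.
apply: (mulfI (_ : (l - 1) * (l + 1) != 0)).
  by rewrite mulf_neq0 ?subr_eq0 ?addr_eq0.
by transitivity (l ^+ 4 - 1); [ring|rewrite l4; ring].
Qed.

(** The two roots correspond to the two pairs of inverse primitive fifth roots
    of unity. *)
Lemma homology_product_order5 v w v' w' :
  let t := dot w v' * dot w' v in
  dot w v = 1 -> dot w' v' = 1 -> homology v w != homology v' w' ->
  ((homology v w * homology v' w') ^+ 5)%g = 1%g ->
  16 * t ^+ 2 - 12 * t + 1 = 0.
Proof.
move=> t d d' ne e.
have [l [l5 l1 E _]] := homology_product_eigenvalue d d' (isT : (0 < 5)%N) ne e.
have l0 : l != 0 by apply: contra_eq_neq l5 => ->; rewrite expr0n eq_sym oner_neq0.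
have -> : 16 * t ^+ 2 - 12 * t + 1 = (4 * t - 2) ^+ 2 + (4 * t - 2) - 1 by ring.
apply: (mulfI (_ : l ^+ 2 * (l - 1) != 0)).
  by rewrite mulf_neq0 ?expf_neq0 ?subr_eq0.
by rewrite E; transitivity (l ^+ 5 - 1); [field|rewrite l5; ring].
Qed.

(** The value [3 / 4] would make [l] a primitive sixth root of unity. *)
Lemma homology_product_not6 v w v' w' n :
  dot w v = 1 -> dot w' v' = 1 -> homology v w != homology v' w' ->
  (n == 4) || (n == 5) ->
  ((homology v w * homology v' w') ^+ n)%g = 1%g ->
  dot w v' * dot w' v != 3 / 4.
Proof.
move=> d d' ne n45 e; have n0 : (0 < n)%N by case/orP: n45 => /eqP->.
have [l [ln l1 E _]] := homology_product_eigenvalue d d' n0 ne e.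
have l0 : l != 0.
  by apply: contra_eq_neq ln => ->; rewrite expr0n gtn_eqF// eq_sym oner_neq0.
apply/eqP => t34; move: E; rewrite t34 (_ : 4 * (3 / 4) - 2 = 1); last by field.
move=> /(congr1 (fun x => l * x)); rewrite mulr1 mulrDr divff// => l2.
have l3 : l ^+ 3 = -1.
  transitivity ((l + 1) * (l * l + 1) - (l * l + 1) - l); first by ring.
  by rewrite -l2; transitivity (l * l + 1 - l - 1); [ring|rewrite -l2; ring].
case/orP: n45 ln => /eqP ->.
  rewrite exprS l3 mulrN1 => l4; have lN : l = -1 by rewrite -l4 opprK.
  have /eqP : (3 : F) = 0 by rewrite -(subrr l) [X in X - _]l2 lN; ring.
  by rewrite pnatr_eq0.
rewrite (exprD l 2 3) l3 mulrN1 expr2 => l5.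
have : l = 0 by rewrite l2 -l5 subrr.
by move/eqP; rewrite (negPf l0).
Qed.

Lemma homology_mxv v w x : homology_mx v w *m x = (2 * dot w x) *: v - x.
Proof.
rewrite mulmxBl mul1mx -scaler_nat -scalemxAl -mulmxA [w *m x]mx11_scalar.
by rewrite mul_mx_scalar scalerA.
Qed.

Lemma homology_vmx v w (x : 'rV[F]_3) : x *m homology_mx v w = (2 * dot x v) *: w - x.
Proof.
rewrite mulmxBr mulmx1 -scaler_nat -scalemxAr mulmxA [x *m v]mx11_scalar.
by rewrite mul_scalar_mx scalerA.
Qed.

Lemma dotD w x y : dot w (x + y) = dot w x + dot w y.
Proof. by rewrite /dot mulmxDr mxE. Qed.

Lemma dotZr w k x : dot w (k *: x) = k * dot w x.
Proof. by rewrite /dot -scalemxAr mxE. Qed.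

Lemma dotBZ w k x y : dot w (k *: x - y) = k * dot w x - dot w y.
Proof. by rewrite dotD dotZr -scaleN1r dotZr mulN1r. Qed.

Lemma dotBZl w w' k x : dot (k *: w - w') x = k * dot w x - dot w' x.
Proof. by rewrite /dot mulmxBl -scalemxAl [LHS]mxE [X in X + _]mxE [X in _ + X]mxE. Qed.

(** The eigenvalue computation only gives that one of the two pairings is 0; if
    just one were, the product would not be diagonalisable, hence not of finite
    order. *)
Lemma homology_commute v w v' w' :
  dot w v = 1 -> dot w' v' = 1 -> homology v w != homology v' w' ->
  ((homology v w * homology v' w') ^+ 2)%g = 1%g ->
  dot w v' = 0 /\ dot w' v = 0.
Proof.
move=> d d' ne e.
have [l [l2 l1 E _]] := homology_product_eigenvalue d d' (isT : (0 < 2)%N) ne e.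
have {l2 l1}lN : l = -1.
  apply/eqP; rewrite -addr_eq0; apply/eqP; apply: (mulfI (_ : l - 1 != 0)).
    by rewrite subr_eq0.
  by transitivity (l ^+ 2 - 1); [ring|rewrite l2; ring].
have /eqP : dot w v' * dot w' v = 0.
  apply: (mulfI (_ : 4 != 0)); rewrite ?pnatr_eq0// mulr0.
  by apply: (addIr (-2)); rewrite E lN invrN invr1; ring.
have key (a : 'cV[F]_3) b (a' : 'cV[F]_3) b' : dot b a = 1 -> dot b' a' = 1 ->
    ((homology a b * homology a' b') ^+ 2)%g = 1%g -> dot b a' = 0 -> dot b' a = 0.
  move=> ab ab' {}e ba'; have u1 := unit_homology_mx ab; have u2 := unit_homology_mx ab'.
  pose M := homology_mx a b *m homology_mx a' b'.
  have uM : M \in unitmx by rewrite unitmx_mul u1.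
  have [c c0 cM] : exists2 c, c != 0 & M *m M = c *: 1%:M.
    apply/(mxclassP (unitmx1 _ _) _); first by rewrite unitmx_mul uM.
    by rewrite mxclass1 mxclassM// -expg2 /M mxclassM.
  have Ma : M *m a = - a - (2 * dot b' a) *: a'.
    rewrite /M -mulmxA !homology_mxv dotBZ ba' ab mulr0 sub0r mulrN1 scaleNr.
    by rewrite scaler_nat mulr2n opprB opprD addrA addrNK.
  have Ma' : M *m a' = - a'.
    rewrite /M -mulmxA (homology_mxv a') ab' mulr1 scaler_nat mulr2n addrK.
    by rewrite homology_mxv ba' mulr0 scale0r sub0r.
  have bM : b *m M = - b.
    rewrite /M mulmxA (homology_vmx a) ab mulr1 scaler_nat mulr2n addrK homology_vmx ba'.
    by rewrite mulr0 scale0r sub0r.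
  have c1 : c = 1.
    have : b *m (M *m M) = b by rewrite mulmxA bM mulNmx bM opprK.
    rewrite cM -scalemxAr mulmx1 => /(congr1 (fun x => dot x a)).
    by rewrite -[a in LHS]scale1r dotZ ab !mulr1.
  have : M *m M *m a = a by rewrite cM c1 scale1r mul1mx.
  rewrite -mulmxA Ma mulmxBr mulmxN -scalemxAr Ma Ma' scalerN => /(congr1 (fun x => dot b' x)).
  rewrite opprB !opprK !dotD !dotZr ab' mulr1 => H.
  apply: (mulfI (_ : 4 != 0)); first by rewrite pnatr_eq0.
  by rewrite mulr0; transitivity (2 * dot b' a + dot b' a + 2 * dot b' a - dot b' a);
    [ring|rewrite H subrr].
rewrite mulf_eq0 => /orP[] /eqP H; split=> //.
  exact: key e H.
apply: key H => //.
have -> : (homology v' w' * homology v w)%g = ((homology v w * homology v' w') ^ homology v w)%g.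
  by rewrite conjgE -mulgA mulKg.
by rewrite -conjXg e conj1g.
Qed.

Lemma homologyV v w : dot w v = 1 -> (homology v w)^-1%g = homology v w.
Proof. by move=> d; apply: (mulgI (homology v w)); rewrite mulgV homologyK. Qed.

Lemma homology_conj v w v' w' : dot w v = 1 -> dot w' v' = 1 ->
  (homology v' w' ^ homology v w)%g
  = homology (homology_mx v w *m v') (w' *m homology_mx v w).
Proof.
move=> d d'; have u1 := unit_homology_mx d; have u2 := unit_homology_mx d'.
rewrite conjgE homologyV// -!mxclassM ?unitmx_mul ?u1 ?u2//; congr mxclass.
have : homology_mx v w *m homology_mx v w = 1%:M := homology_mxK d.
move: (homology_mx v w) => B BB; rewrite /homology_mx mulmxBl mul1mx mulmxBr BB.
by rewrite -!(scaler_nat 2 (_ *m _)) -scalemxAl -scalemxAr !mulmxA.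
Qed.

End TripleInvariants.

(** * Complex conjugation of a triple of involutions *)

Section Conjugation.
Variable F : numClosedFieldType.
Local Notation cj := (map_mx Num.conj).
Implicit Types (v : 'cV[F]_3) (w : 'rV[F]_3) (g h : PGL F 3).

Lemma dot_conj v w : dot (cj w) (cj v) = Num.conj (dot w v).
Proof. by rewrite /dot -map_mxM mxE. Qed.

Lemma map_conj_homology v w : dot w v = 1 ->
  map_PGL Num.conj (homology v w) = homology (cj v) (cj w).
Proof.
move=> wv; apply: etrans (map_PGL_mxclass _ (unit_homology_mx wv)) _.
congr mxclass.
by rewrite /homology_mx mulr2n map_mxB map_mxD map_mx1 map_mxM.
Qed.

Lemma conj_eigenvalue_sum (l : F) n : (0 < n)%N -> l ^+ n = 1 ->
  Num.conj (l + l^-1) = l + l^-1.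
Proof.
move=> n0 ln.
have l0 : l != 0.
  by apply: contra_eq_neq ln => ->; rewrite expr0n gtn_eqF// eq_sym oner_neq0.
have /eqP : `|l| ^+ n = 1 by rewrite -normrX ln normr1.
rewrite pexpr_eq1// => /eqP nl.
have cl : Num.conj l = l^-1.
  by apply: (mulfI l0); rewrite -normCK nl expr1n divff.
by rewrite rmorphD/= fmorphV/= cl invrK addrC.
Qed.

(** The eigenvalue [l] is a root of unity, and [l + l^-1] is then real. *)
Lemma homology_product_real v w v' w' n :
  dot w v = 1 -> dot w' v' = 1 -> (0 < n)%N ->
  homology v w != homology v' w' ->
  ((homology v w * homology v' w') ^+ n)%g = 1%g ->
  Num.conj (dot w v' * dot w' v) = dot w v' * dot w' v.
Proof.
move=> d d' n0 ne e; have [l [ln _ E _]] := homology_product_eigenvalue d d' n0 ne e.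
set t := dot w v' * _ in E *; have {E}-> : t = (l + l^-1 + 2) / 4 by rewrite -E; field.
by rewrite rmorphM/= rmorphD/= (conj_eigenvalue_sum n0 ln)
  !(rmorphM, rmorphB, rmorphD, fmorphV, rmorph_nat, rmorph1).
Qed.

Lemma involutions_homologies (h : 'I_3 -> PGL F 3) :
  (forall i, (h i * h i)%g = 1%g) -> (forall i, h i != 1%g) ->
  exists (v : 'I_3 -> 'cV[F]_3) (w : 'I_3 -> 'rV[F]_3),
    forall i, dot (w i) (v i) = 1 /\ h i = homology (v i) (w i).
Proof.
move=> hh h1.
have /choice[vw H] : forall i, exists vw : 'cV[F]_3 * 'rV[F]_3,
    dot vw.2 vw.1 = 1 /\ h i = homology vw.1 vw.2.
  by move=> i; have [v [w H]] := involution_homology (hh i) (h1 i); exists (v, w).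
by exists (fun i => (vw i).1), (fun i => (vw i).2) => i; apply: H.
Qed.

(** The orders of the three products fix the invariants [g i j * g j i], and the
    order of [h 0 * h 2 ^ h 1] makes the sum of the triangular products [p] and
    [q] real, so that conjugation fixes both or exchanges them.
    Accordingly [s] is the identity or the reversal of the three indices, which
    also exchanges [p] and [q]. *)
Lemma conj_permutes_involutions (h : 'I_3 -> PGL F 3) (m : nat) :
  (forall i, (h i * h i)%g = 1%g) -> (forall i, h i != 1%g) ->
  h 0 != h 1 -> ((h 0 * h 1%R) ^+ 3)%g = 1%g ->
  h 1%R != h 2 -> ((h 1%R * h 2) ^+ 3)%g = 1%g ->
  ((h 0 * h 2) ^+ 2)%g != 1%g -> ((h 0 * h 2) ^+ 4)%g = 1%g ->
  (m == 4) || (m == 5) ->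
  h 0 != (h 2 ^ h 1%R)%g -> ((h 0 * h 2 ^ h 1%R) ^+ m)%g = 1%g ->
  exists x s, involutive s /\ forall i, map_PGL Num.conj (h i) = (h (s i) ^ x)%g.
Proof.
move=> hh h1; have [v [w H]] := involutions_homologies hh h1.
have d i : dot (w i) (v i) = 1 by case: (H i).
have {H hh h1} E i : h i = homology (v i) (w i) by case: (H i).
rewrite !E => n01 o01 n12 o12 n02 o02 m45; rewrite homology_conj// => n021 o021.
pose g i j := dot (w i) (v j).
pose v21 := homology_mx (v 1) (w 1) *m v 2; pose w21 := w 2 *m homology_mx (v 1) (w 1).
have d21 : dot w21 v21 = 1.
  rewrite /dot /w21 /v21 mulmxA -(mulmxA (w 2)) [_ *m homology_mx _ _]homology_mxK//.
  by rewrite mulmx1 -/(dot _ _) d.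
have t01 : g 0 1 * g 1 0 = 1 / 4 := homology_product_order3 (d 0) (d 1) n01 o01.
have t12 : g 1 2 * g 2 1 = 1 / 4 := homology_product_order3 (d 1) (d 2) n12 o12.
have t02 : g 0 2 * g 2 0 = 1 / 2 := homology_product_order4 (d 0) (d 2) n02 o02.
pose p := g 0 1 * g 1 2 * g 2 0; pose q := g 0 2 * g 2 1 * g 1 0.
have t021 : dot (w 0) v21 * dot w21 (v 0) = 3 / 4 - 2 * (p + q).
  have -> : dot (w 0) v21 = 2 * g 1 2 * g 0 1 - g 0 2.
    by rewrite /v21 homology_mxv dotBZ.
  have -> : dot w21 (v 0) = 2 * g 2 1 * g 1 0 - g 2 0.
    by rewrite /w21 homology_vmx dotBZl.
  transitivity (4 * (g 0 1 * g 1 0) * (g 1 2 * g 2 1) - 2 * (p + q) + g 0 2 * g 2 0).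
    by rewrite /p /q; ring.
  by rewrite t01 t12 t02; field.
(* p and q are the roots of a quadratic polynomial that conjugation preserves. *)
have pq : p * q = 1 / 32.
  transitivity ((g 0 1 * g 1 0) * (g 1 2 * g 2 1) * (g 0 2 * g 2 0)).
    by rewrite /p /q; ring.
  by rewrite t01 t12 t02; field.
have m0 : (0 < m)%N by case/orP: m45 => /eqP->.
have s0 : p + q != 0.
  have := homology_product_not6 (d 0) d21 n021 m45 o021; rewrite t021.
  by apply: contra_neq => ->; rewrite mulr0 subr0.
have sJ : Num.conj (p + q) = p + q.
  have := homology_product_real (d 0) d21 m0 n021 o021; rewrite t021 => e.
  have -> : p + q = (3 / 4 - (3 / 4 - 2 * (p + q))) / 2 by field.
  by rewrite rmorphM/= rmorphB/= e !(rmorphM, rmorphB, rmorphD, fmorphV, rmorph_nat, rmorph1).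
have det : 1 - g 0 1 * g 1 0 - g 1 2 * g 2 1 - g 0 2 * g 2 0 + (p + q) != 0.
  by rewrite t01 t12 t02 (_ : _ + _ = p + q)//; field.
have gJ i j : dot (cj (w i)) (cj (v j)) = Num.conj (g i j) by rewrite dot_conj.
have n4 : 1 / 4 != 0 :> F by rewrite mulf_neq0 ?oner_neq0// invr_eq0 pnatr_eq0.
have J4 : Num.conj (1 / 4 : F) = 1 / 4.
  by rewrite !(rmorphM, rmorphB, rmorphD, fmorphV, rmorph_nat, rmorph1).
have r0 : rev_ord (0 : 'I_3) = 2 by apply: val_inj.
have r1 : rev_ord (1 : 'I_3) = 1 by apply: val_inj.
have r2 : rev_ord (2 : 'I_3) = 0 by apply: val_inj.
suff [x [s [ss hx]]] : exists x s, involutive s /\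
    forall i, homology (cj (v i)) (cj (w i)) = (homology (v (s i)) (w (s i)) ^ x)%g.
  by exists x, s; split=> // i; rewrite !E map_conj_homology// hx.
have [pJ|pJ] : Num.conj p = p \/ Num.conj p = q.
  have : (Num.conj p - p) * (Num.conj p - q) = 0.
    transitivity (Num.conj p ^+ 2 - (p + q) * Num.conj p + p * q); first by ring.
    have -> : p * q = Num.conj p * Num.conj q.
      by rewrite -rmorphM pq !(rmorphM, rmorphB, rmorphD, fmorphV, rmorph_nat, rmorph1).
    by rewrite -sJ rmorphD; ring.
  by move=> /eqP; rewrite mulf_eq0 !subr_eq0 => /orP[]/eqP; [left|right].
- have qJ : Num.conj q = q.
    by apply: (addrI p); rewrite -{1}pJ -rmorphD.
  case: (@triple_rigid _ v (fun i => cj (v i)) w (fun i => cj (w i))) => //=.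
  - by move=> i; rewrite dot_conj d rmorph1.
  - by rewrite !gJ -rmorphM/= t01 J4 -t01.
  - by rewrite t01.
  - by rewrite !gJ -rmorphM/= t12 J4 -t12.
  - by rewrite t12.
  - by rewrite !gJ -!rmorphM; exact: pJ.
  - by rewrite !gJ -!rmorphM; exact: qJ.
  by move=> x hx; exists x, id.
have qJ : Num.conj q = p.
  by apply: (addrI q); rewrite -{1}pJ -rmorphD/= sJ addrC.
case: (@triple_rigid _ (fun i => v (rev_ord i)) (fun i => cj (v i))
    (fun i => w (rev_ord i)) (fun i => cj (w i))) => //=; rewrite ?r0 ?r1 ?r2.
  - by move=> i; rewrite dot_conj d rmorph1.
  - by rewrite !gJ -rmorphM/= t01 J4 -t12 mulrC.
  - by rewrite mulrC t12.
  - by rewrite !gJ -rmorphM/= t12 J4 -t01 mulrC.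
  - by rewrite mulrC t01.
  - rewrite !gJ -!rmorphM; apply: etrans pJ _; rewrite /q /g.
    by ring.
  - rewrite !gJ -!rmorphM; apply: etrans qJ _; rewrite /p /g.
    by ring.
  - by rewrite (_ : _ + _ = 1 - g 0 1 * g 1 0 - g 1 2 * g 2 1 - g 0 2 * g 2 0
      + (p + q))// /p /q /g; ring.
by move=> x hx; exists x, (@rev_ord 3); split=> //; apply: rev_ordK.
Qed.

End Conjugation.

(** * Generating triples of A_5 and A_6 *)

Section Permutations.
Local Open Scope set_scope.
Local Open Scope group_scope.

Definition dtransp n (a b c d : nat) : {perm 'I_n.+1} :=
  tperm (inord a) (inord b) * tperm (inord c) (inord d).

(** Products of double transpositions are written as lists of quadruples,
    because the functions on [nat] that such words define can be compared by
    evaluation ([word_eq]) whereas elements of [{perm 'I_n}] cannot. *)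
Definition quad := (nat * nat * nat * nat)%type.

Fixpoint act (s : seq quad) (i : nat) : nat :=
  if s is (a, b, c, d) :: s' then
    let j := if i == a then b else if i == b then a else i in
    act s' (if j == c then d else if j == d then c else j)
  else i.

Fixpoint word n (s : seq quad) : {perm 'I_n.+1} :=
  if s is (a, b, c, d) :: s' then dtransp n a b c d * word n s' else 1.

Definition small n (s : seq quad) : bool :=
  all (fun q : quad => let: (a, b, c, d) := q in [&& a <= n, b <= n, c <= n & d <= n]%N) s.

Lemma val_tperm n (a b : nat) (i : 'I_n.+1) : (a <= n)%N -> (b <= n)%N ->
  tperm (inord a) (inord b) i
  = (if i == a :> nat then b else if i == b :> nat then a else i) :> nat.
Proof.
move=> an bn; have e c : (c <= n)%N -> (i == inord c) = (i == c :> nat).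
  by move=> cn; rewrite -val_eqE/= inordK.
by rewrite permE/= !e//; case: ifP => _; [rewrite inordK|case: ifP => _; rewrite ?inordK].
Qed.

Lemma val_word n s (i : 'I_n.+1) : small n s -> word n s i = act s i :> nat.
Proof.
elim: s i => [i _|[[[a b] c] d] s IH i /=]; first by rewrite perm1.
by move=> /andP[/and4P[an bn cn dn] ss]; rewrite permM IH// /dtransp permM !val_tperm.
Qed.

Lemma word_cat n s t : word n (s ++ t) = word n s * word n t.
Proof. by elim: s => [|[[[a b] c] d] s IH] /=; rewrite ?mul1g// IH mulgA. Qed.

Lemma wordX n s k : word n s ^+ k = word n (flatten (nseq k s)).
Proof. by elim: k => [|k IH]; rewrite ?expg0// expgS IH /= word_cat. Qed.

Lemma word_eq n s t : small n s -> small n t ->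
  all (fun i => act s i == act t i) (iota 0 n.+1) -> word n s = word n t.
Proof.
move=> ss st /allP e; apply/permP => i; apply: ord_inj; rewrite !val_word//.
by apply/eqP; apply: e; rewrite mem_iota/= add0n ltn_ord.
Qed.

Lemma word_neq n s t : small n s -> small n t ->
  ~~ all (fun i => act s i == act t i) (iota 0 n.+1) -> word n s != word n t.
Proof.
move=> ss st; apply: contraNneq => e; apply/allP => i.
rewrite mem_iota/= add0n => i_n.
have : word n s (Ordinal i_n) = word n t (Ordinal i_n) :> nat by rewrite e.
by rewrite !val_word//= => ->.
Qed.

Lemma word_even n s :
  all (fun q : quad => let: (a, b, c, d) := q in (a != b) && (c != d)) s ->
  small n s -> word n s \in 'Alt_('I_n.+1).
Proof.
move=> + ss; rewrite Alt_even => os.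
suff -> : odd_perm (word n s) = false by [].
elim: s ss os => [|[[[a b] c] d] s IH] /=; first by rewrite odd_perm1.
move=> /andP[/and4P[an bn cn dn] ss] /andP[/andP[ab cd] os].
have e x y : (x <= n)%N -> (y <= n)%N -> (inord x != inord y :> 'I_n.+1) = (x != y).
  by move=> xn yn; rewrite -val_eqE/= !inordK.
by rewrite odd_permM (IH ss os) odd_permM !odd_tperm !e// ab cd.
Qed.

Lemma card_TI_dvd (gT : finGroupType) (P Q K : {group gT}) :
  Q \subset 'N(P) -> P :&: Q = 1 -> P \subset K -> Q \subset K ->
  (#|P| * #|Q| %| #|K|)%N.
Proof.
by move=> nPQ ti PK QK; rewrite -TI_cardMg// -norm_joinEr// cardSg// join_subG PK.
Qed.

Lemma order4 (gT : finGroupType) (c : gT) : c ^+ 2 != 1 -> c ^+ 4 = 1 -> #[c] = 4%N.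
Proof.
move=> c2 /eqP; rewrite -order_dvdn => c4; rewrite -order_dvdn in c2.
by have := dvdn_leq (isT : 0 < 4)%N c4; move: c4 c2; case: #[c] => [|[|[|[|[|]]]]].
Qed.

(** The subgroup contains a Klein four-group and elements of orders 3 and 5, so
    that 60 divides its order. *)
Lemma Alt5_generated (x y z : {perm 'I_5}) :
  [set x; y; z] \subset 'Alt_('I_5) ->
  #[x * y] = 3%N -> #[y * z] = 5%N -> #[x] = 2%N -> #[z] = 2%N -> x != z -> commute x z ->
  <<[set x; y; z]>> = 'Alt_('I_5).
Proof.
move=> sA o3 o5 ox oz nxz cxz; rewrite -[<<_>>]/(gval <<[set x; y; z]>>%G).
set K := <<_>>%G; have KA : K \subset 'Alt_('I_5) by rewrite gen_subG.
have cA : #|'Alt_('I_5)| = 60%N.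
  by apply/eqP; rewrite -(eqn_pmul2l (isT : 0 < 2)%N) card_Alt card_ord.
have [xK yK zK] : [/\ x \in K, y \in K & z \in K].
  by split; apply: mem_gen; rewrite !inE eqxx ?orbT.
apply/eqP; rewrite eqEcard KA cA dvdn_leq// (_ : 60 = 4 * (3 * 5))%N//.
rewrite !Gauss_dvd//; apply/and3P; split; last first.
- by have := order_dvdG (groupM yK zK); rewrite o5.
- by have := order_dvdG (groupM xK yK); rewrite o3.
suff : (#[x] * #[z] %| #|K|)%N by rewrite ox oz.
have zx : z \notin <[x]>.
  rewrite cycle2g// !inE negb_or eq_sym (eq_sym z) nxz andbT.
  by apply: contra_eqN oz => /eqP <-; rewrite order1.
apply: (@card_TI_dvd _ <[x]>%G <[z]>%G K); rewrite /= ?[_ \subset gval K]cycle_subG//.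
  by rewrite cents_norm// cents_cycle//; apply: commute_sym.
by rewrite finset.setIC prime_TIg ?cycle_subG// -[#|_|]/(#[z]) oz.
Qed.

Definition word_is1 n s := all (fun i => act s i == i) (iota 0 n.+1).

Lemma word_eq1 n s : small n s -> (word n s == 1) = word_is1 n s.
Proof.
move=> ss; apply/idP/idP => [/eqP e|].
  by apply: contraTT isT => /(word_neq (t := [::]) ss isT); rewrite e eqxx.
by move=> e; apply/eqP; apply: (word_eq (t := [::]) ss).
Qed.

Definition order_check n p s :=
  [&& small n s, small n (flatten (nseq p s)), word_is1 n (flatten (nseq p s)) & ~~ word_is1 n s].

Lemma order_word n p s : prime p -> order_check n p s -> #[word n s] = p.
Proof.
move=> pp /and4P[ss ssp e ne]; apply: nt_prime_order => //.
  by apply/eqP; rewrite wordX word_eq1.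
by rewrite word_eq1.
Qed.

(** The Coxeter relations of type H_3, with inequalities that keep the three
    involutions distinct.  The Coxeter group H_3 is the product of A_5 and a
    group of order 2. *)
Definition icosahedral_relations (gT : groupType) (x y z : gT) :=
  [/\ x * x = 1, y * y = 1, z * z = 1, x != 1 & y != 1] /\ z != 1 /\
  [/\ x != y, (x * y) ^+ 3 = 1, y != z & (y * z) ^+ 5 = 1] /\
  [/\ x != z & (x * z) ^+ 2 = 1].

Definition alt5x := word 4 [:: (0, 1, 2, 3)]%N.
Definition alt5y := word 4 [:: (0, 1, 3, 4)]%N.
Definition alt5z := word 4 [:: (0, 2, 1, 3)]%N.

Lemma Alt5_generated_xyz : <<[set alt5x; alt5y; alt5z]>> = 'Alt_('I_5).
Proof.
rewrite /alt5x /alt5y /alt5z.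
apply: Alt5_generated; rewrite -?word_cat ?word_neq//; try exact: order_word.
  by rewrite !finset.subUset !finset.sub1set !word_even.
by rewrite /commute -!word_cat; apply: word_eq.
Qed.

(** The second triple has the same [y], and the product of its last two members
    is the square of [y * z], hence in the other class of elements of order 5. *)
Lemma Alt5_triples : exists x y z x' : {perm 'I_5},
  [/\ icosahedral_relations x y z, icosahedral_relations x' y (y ^ z),
      <<[set x; y; z]>> = 'Alt_('I_5) & <<[set x'; y; y ^ z]>> = 'Alt_('I_5)].
Proof.
pose X : seq quad := [:: (0, 1, 2, 3)]%N.
pose Y : seq quad := [:: (0, 1, 3, 4)]%N.
pose Z : seq quad := [:: (0, 2, 1, 3)]%N.
pose X' : seq quad := [:: (1, 2, 3, 4)]%N.
have inv s : small 4 s -> word_is1 4 (s ++ s) -> word 4 s * word 4 s = 1.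
  by move=> ss e; apply/eqP; rewrite -word_cat word_eq1// /small all_cat -/(small 4 s) ss.
have conjYZ : word 4 Y ^ word 4 Z = word 4 (Z ++ Y ++ Z).
  rewrite conjgE -[(word 4 Z)^-1]mul1g -{1}(inv Z isT isT) mulgK.
  by rewrite !word_cat mulgA.
exists (word 4 X), (word 4 Y), (word 4 Z), (word 4 X').
rewrite conjYZ; split.
- split; first by split; rewrite ?inv ?word_eq1.
  split; first by rewrite word_eq1.
  split; split; rewrite ?word_neq// -word_cat wordX; by apply/eqP; rewrite word_eq1.
- split; first by split; rewrite ?inv ?word_eq1.
  split; first by rewrite word_eq1.
  split; split; rewrite ?word_neq// -word_cat wordX; by apply/eqP; rewrite word_eq1.
- exact: Alt5_generated_xyz.
apply: Alt5_generated; rewrite -?word_cat ?word_neq//; try exact: order_word.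
  by rewrite !finset.subUset !finset.sub1set !word_even.
by rewrite /commute -!word_cat; apply: word_eq.
Qed.

(** The subgroup contains a dihedral group of order 8, a group of type (3, 3)
    and an element of order 5, so that 360 divides its order. *)
Lemma Alt6_generated (x y z b : {perm 'I_6}) :
  [set x; y; z] \subset 'Alt_('I_6) -> b \in <<[set x; y; z]>> ->
  #[x] = 2%N -> #[z] = 2%N -> #[x * z] = 4%N ->
  ~~ (x * (x * z) == x * z * x) ->
  #[x * z ^ y] = 5%N -> #[x * y] = 3%N -> #[b] = 3%N ->
  commute (x * y) b -> b \notin <[x * y]> ->
  <<[set x; y; z]>> = 'Alt_('I_6).
Proof.
move=> sA; rewrite -[<<_>>]/(gval <<[set x; y; z]>>%G).
set K := <<_>>%G => bK ox oz oxz nc o5 o3 ob cb nb.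
have KA : K \subset 'Alt_('I_6) by rewrite gen_subG.
have cA : #|'Alt_('I_6)| = 360%N.
  by apply/eqP; rewrite -(eqn_pmul2l (isT : 0 < 2)%N) card_Alt card_ord.
have [xK yK zK] : [/\ x \in K, y \in K & z \in K].
  by split; apply: mem_gen; rewrite !inE eqxx ?orbT.
apply/eqP; rewrite eqEcard KA cA dvdn_leq// (_ : 360 = 8 * (9 * 5))%N//.
rewrite !Gauss_dvd//; apply/and3P; split; last first.
- by have := order_dvdG (groupM xK (groupJ zK yK)); rewrite o5.
- suff : (#[x * y] * #[b] %| #|K|)%N by rewrite o3 ob.
  apply: (@card_TI_dvd _ <[x * y]>%G <[b]>%G K);
    rewrite /= ?[_ \subset gval K]cycle_subG ?groupM//.
    by rewrite cents_norm// cents_cycle//; apply: commute_sym.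
  by rewrite finset.setIC prime_TIg ?cycle_subG// -[#|_|]/(#[b]) ob.
suff : (#[x * z] * #[x] %| #|K|)%N by rewrite oxz ox.
have xx : x * x = 1 by have := expg_order x; rewrite ox expg2.
have zz : z * z = 1 by have := expg_order z; rewrite oz expg2.
apply: (@card_TI_dvd _ <[x * z]>%G <[x]>%G K);
  rewrite /= ?[_ \subset gval K]cycle_subG ?groupM//.
  rewrite cycle_subG; apply/normP; rewrite -cycleJ -cycleV; congr <[_]>.
  apply: (mulgI ((x * z) ^ x)).
  by rewrite mulgV conjgE -!mulgA mulKg (mulgA x) xx mul1g zz.
rewrite finset.setIC prime_TIg ?cycle_subG// -?[#|_|]/(#[x]) ?ox//.
apply: contra nc => /cycleP[k xk]; apply/eqP.
suff : commute x (x * z) by [].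
by rewrite {1}xk; apply: commute_sym; apply: commuteX.
Qed.

(** The elements [x * y] and [b] generate a group of type (3, 3). *)
Lemma Alt6_triple : exists x y z b : {perm 'I_6},
  [/\ [/\ x * x = 1, y * y = 1, z * z = 1, x != 1 & y != 1], z != 1,
     [/\ x != y, (x * y) ^+ 3 = 1, y != z & (y * z) ^+ 3 = 1],
     [/\ (x * z) ^+ 2 != 1, (x * z) ^+ 4 = 1, x != z ^ y & (x * z ^ y) ^+ 5 = 1] &
     <<[set x; y; z]>> = 'Alt_('I_6)] /\
  [/\ b \in 'Alt_('I_6), #[x * y] = 3%N, #[b] = 3%N, commute (x * y) b & (b \notin <[x * y]>)].
Proof.
pose X : seq quad := [:: (0, 1, 2, 3)]%N.
pose Y : seq quad := [:: (1, 4, 3, 5)]%N.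
pose Z : seq quad := [:: (2, 4, 3, 5)]%N.
have inv s : small 5 s -> word_is1 5 (s ++ s) -> word 5 s * word 5 s = 1.
  by move=> ss e; apply/eqP; rewrite -word_cat word_eq1// /small all_cat -/(small 5 s) ss.
have conjYZ : word 5 Z ^ word 5 Y = word 5 (Y ++ Z ++ Y).
  rewrite conjgE -[(word 5 Y)^-1]mul1g -{1}(inv Y isT isT) mulgK.
  by rewrite !word_cat mulgA.
(* an element of order 3 commuting with xy, outside the subgroup that xy generates *)
pose B := Z ++ Y ++ X ++ Z ++ X ++ Y ++ X ++ Z ++ X ++ Y ++ Z ++ Y.
exists (word 5 X), (word 5 Y), (word 5 Z), (word 5 B).
have nB : word 5 B \notin <[word 5 X * word 5 Y]>.
  rewrite -word_cat; apply/negP => /cyclePmin[m].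
  rewrite (@order_word _ 3)// wordX => m3 /eqP; apply/negP; apply: word_neq => //.
    by case: m m3 => [|[|[|]]].
  by case: m m3 => [|[|[|]]].
have cB : commute (word 5 X * word 5 Y) (word 5 B).
  rewrite /commute -(word_cat 5 X) -(word_cat 5 (X ++ Y)) -(word_cat 5 B).
  by apply: word_eq; vm_compute.
have XYg : <<[set word 5 X; word 5 Y; word 5 Z]>> = 'Alt_('I_6).
  apply: (@Alt6_generated _ _ _ (word 5 B)).
  - by rewrite !finset.subUset !finset.sub1set !word_even.
  - have [xK yK zK] : [/\ word 5 X \in <<[set word 5 X; word 5 Y; word 5 Z]>>,
        word 5 Y \in <<[set word 5 X; word 5 Y; word 5 Z]>> &
        word 5 Z \in <<[set word 5 X; word 5 Y; word 5 Z]>>].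
      by split; apply: mem_gen; rewrite !inE eqxx ?orbT.
    rewrite /B !word_cat; move: (word 5 X) (word 5 Y) (word 5 Z) xK yK zK.
    by move=> x y z xK yK zK; rewrite !groupM.
  - exact: order_word.
  - exact: order_word.
  - rewrite -word_cat.
    apply: order4.
      by rewrite wordX word_eq1.
    by apply/eqP; rewrite wordX word_eq1.
  - by rewrite -!word_cat; apply: word_neq.
  - by rewrite conjYZ -word_cat; apply: order_word.
  - by rewrite -word_cat; apply: order_word.
  - exact: order_word.
  - exact: cB.
  exact: nB.
split; last first.
  split; [exact: word_even| |exact: order_word|exact: cB|exact: nB].
  by rewrite -word_cat; apply: order_word.
split=> //.
- by split; rewrite ?inv ?word_eq1.
- by rewrite word_eq1.
- split; rewrite ?word_neq// -word_cat wordX; by apply/eqP; rewrite word_eq1.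
rewrite conjYZ; split; rewrite ?word_neq// -word_cat wordX ?word_eq1//;
  by apply/eqP; rewrite word_eq1.
Qed.

End Permutations.

(** * A generating triple of PSL(2,7) *)

Section KleinGroup.
Local Open Scope set_scope.
Local Open Scope group_scope.

(** Matrices over F_7 are represented by quadruples of natural numbers, row by
    row, so that identities between given matrices hold by evaluation. *)
Definition qmul (p q : quad) : quad :=
  let: (a, b, c, d) := p in let: (a', b', c', d') := q in
  ((a * a' + b * c') %% 7, (a * b' + b * d') %% 7,
   (c * a' + d * c') %% 7, (c * b' + d * d') %% 7)%N.

Definition qred (q : quad) : quad :=
  let: (a, b, c, d) := q in (a %% 7, b %% 7, c %% 7, d %% 7)%N.

Definition qdet1 (q : quad) : bool :=
  let: (a, b, c, d) := q in (a * d == b * c + 1 %[mod 7])%N.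

Definition qmx (q : quad) : 'M['F_7]_2 :=
  let: (a, b, c, d) := q in
  (\matrix_(i < 2, j < 2) nth 0 (nth [::] [:: [:: a%:R; b%:R]; [:: c%:R; d%:R]] i) j)%R.

Lemma F7_natE (a b : nat) : (a%:R == b%:R :> 'F_7)%R = (a == b %[mod 7])%N.
Proof.
by rewrite -(inj_eq val_inj)/= !(@val_Fp_nat 7).
Qed.

Lemma F7_nat_mod (a : nat) : ((a %% 7)%:R = a%:R :> 'F_7)%R.
Proof. by apply/eqP; rewrite F7_natE modn_mod. Qed.

Lemma I2_ind (P : 'I_2 -> Prop) : P 0%R -> P 1%R -> forall i, P i.
Proof.
move=> P0 P1 [[|[|//]] i2].
- by rewrite (_ : Ordinal i2 = 0%R) //; apply: val_inj.
- by rewrite (_ : Ordinal i2 = 1%R) //; apply: val_inj.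
Qed.

Lemma qmxM p q : (qmx p *m qmx q)%R = qmx (qmul p q).
Proof.
case: p q => [[[a b] c] d] [[[a' b'] c'] d'].
apply/matrixP; apply: I2_ind; apply: I2_ind; rewrite !mxE !big_ord_recl big_ord0 !mxE /=;
  by rewrite addr0 F7_nat_mod natrD !natrM.
Qed.

Lemma det_qmxE a b c d :
  (\det (qmx (a, b, c, d)) = a%:R * d%:R - b%:R * c%:R)%R.
Proof.
rewrite (expand_det_row _ ord0) !big_ord_recl big_ord0 /cofactor !det_mx11 !mxE /=.
by rewrite /bump /= !addn0 !expr0 !expr1 !mul1r mulN1r addr0 mulrN.
Qed.

Lemma det_qmx q : (\det (qmx q) == 1)%R = qdet1 q.
Proof.
case: q => [[[a b] c] d]; rewrite det_qmxE /= -F7_natE natrD !natrM.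
by rewrite subr_eq addrC.
Qed.

Lemma qmx_inj p q : qmx p = qmx q -> qred p = qred q.
Proof.
case: p q => [[[a b] c] d] [[[a' b'] c'] d'] /matrixP e.
move: (e 0 0)%R (e 0 1)%R (e 1 0)%R (e 1 1)%R; rewrite !mxE /=.
by move=> /eqP + /eqP + /eqP + /eqP; rewrite !F7_natE => /eqP-> /eqP-> /eqP-> /eqP->.
Qed.

(** Specified through a sigma type to make [sl] opaque: otherwise conversion
    would compute with matrices over F_7. *)
Lemma sl_subproof :
  {f : quad -> {'GL_2(7)} | forall q, f q = insubd (1 : {'GL_2(7)}) (qmx q)}.
Proof. by exists (fun q => insubd (1 : {'GL_2(7)}) (qmx q)). Qed.

Definition sl : quad -> {'GL_2(7)} := sval sl_subproof.

Lemma slE q : sl q = insubd (1 : {'GL_2(7)}) (qmx q).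
Proof. exact: (svalP sl_subproof). Qed.

Lemma GLval_sl q : qdet1 q -> GLval (sl q) = qmx q.
Proof.
move=> q1; rewrite slE; apply: insubdK.
rewrite -[X in is_true X]/(qmx q \in unitmx) unitmxE.
have /eqP -> : (\det (qmx q) == 1)%R by rewrite det_qmx.
exact: unitr1.
Qed.

Lemma sl_mem q : qdet1 q -> sl q \in SL2_7.
Proof. by move=> q1; rewrite inE GLval_sl// det_qmx. Qed.

Lemma slM p q : qdet1 p -> qdet1 q -> qdet1 (qmul p q) -> sl p * sl q = sl (qmul p q).
Proof.
by move=> p1 q1 pq1; apply: val_inj; rewrite [LHS]GL_MxE [RHS]GLval_sl// !GLval_sl// qmxM.
Qed.

Lemma qmx_congr p q : qred p = qred q -> qmx p = qmx q.
Proof.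
move: p q => [[[a b] c] d] [[[a' b'] c'] d'] [ea eb ec ed].
apply/matrixP; apply: I2_ind; apply: I2_ind;
  by rewrite !mxE /=; apply/eqP; rewrite F7_natE; apply/eqP.
Qed.

Lemma sl_congr p q : qred p = qred q -> sl p = sl q.
Proof. by move=> /qmx_congr e; rewrite !slE e. Qed.

Lemma sl_inj p q : qdet1 p -> qdet1 q -> sl p = sl q -> qred p = qred q.
Proof. by move=> p1 q1 e; apply: qmx_inj; rewrite -!GLval_sl// e. Qed.

Lemma sl_1 : sl (1, 0, 0, 1)%N = 1.
Proof.
apply: val_inj; rewrite [LHS]GLval_sl//.
by apply/matrixP; apply: I2_ind; apply: I2_ind; rewrite !mxE.
Qed.

Lemma qdet1M p q : qdet1 p -> qdet1 q -> qdet1 (qmul p q).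
Proof.
move: p q => [[[a b] c] d] [[[a' b'] c'] d'] /=.
rewrite -!F7_natE !(natrD, natrM) !F7_nat_mod !(natrD, natrM).
move=> /eqP e /eqP e'; apply/eqP.
move: e e'; move: (a%:R)%R (b%:R)%R (c%:R)%R (d%:R)%R (a'%:R)%R (b'%:R)%R (c'%:R)%R (d'%:R)%R.
move=> {a b c d a' b' c' d'} a b c d a' b' c' d' e e'.
transitivity ((a * b' + b * d') * (c * a' + d * c') + (a * d - b * c) * (a' * d' - b' * c'))%R.
  by ring.
have -> : (a * d - b * c = 1)%R by rewrite e addrAC subrr add0r.
have -> : (a' * d' - b' * c' = 1)%R by rewrite e' addrAC subrr add0r.
by rewrite mulr1.
Qed.

(** Opaque for the same reason as [sl]. *)
Lemma psl_subproof :
  {f : quad -> coset_of 'Z(SL2_7) | forall q, f q = coset 'Z(SL2_7) (sl q)}.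
Proof. by exists (fun q => coset 'Z(SL2_7) (sl q)). Qed.

Definition psl : quad -> coset_of 'Z(SL2_7) := sval psl_subproof.

Lemma pslE q : psl q = coset 'Z(SL2_7) (sl q).
Proof. exact: (svalP psl_subproof). Qed.

Lemma SL_normZ : SL2_7 \subset 'N('Z(SL2_7)).
Proof. exact: normal_norm (center_normal _). Qed.

Lemma sl_normZ q : qdet1 q -> sl q \in 'N('Z(SL2_7)).
Proof. by move=> q1; apply: (fintype.subsetP SL_normZ); apply: sl_mem. Qed.

Lemma pslM p q : qdet1 p -> qdet1 q -> psl p * psl q = psl (qmul p q).
Proof.
by move=> p1 q1; rewrite !pslE -slM ?qdet1M// morphM ?sl_normZ.
Qed.

Fixpoint qexp (q : quad) (k : nat) : quad :=
  if k is k'.+1 then qmul q (qexp q k') else (1, 0, 0, 1)%N.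

Lemma pslX q k : qdet1 q -> psl q ^+ k = psl (qexp q k).
Proof.
move=> q1; have qk1 j : qdet1 (qexp q j) by elim: j => [|j IH] //; apply: qdet1M.
elim: k => [|k IH]; first by rewrite expg0 pslE sl_1 morph1.
by rewrite expgS IH (pslM q1 (qk1 k)).
Qed.

(** A scalar matrix is central. *)
Lemma psl_eq1 q : qdet1 q -> (qred q == (1, 0, 0, 1)%N) || (qred q == (6, 0, 0, 6)%N) ->
  psl q = 1.
Proof.
move=> q1 qs; rewrite pslE; apply: coset_id; apply/centerP; split=> [|u _]; first exact: sl_mem.
apply: val_inj; rewrite [LHS]GL_MxE [RHS]GL_MxE GLval_sl//.
have [k ->] : exists k : 'F_7, qmx q = (k%:M)%R.
  move: q q1 qs => [[[a b] c] d] _ /orP[] /eqP [ea eb ec ed];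
    [exists 1%R|exists (6%:R)%R]; apply/matrixP; apply: I2_ind; apply: I2_ind;
    by rewrite !mxE /= -F7_nat_mod ?ea ?eb ?ec ?ed.
by rewrite mul_scalar_mx mul_mx_scalar.
Qed.

(** It suffices to exhibit an element [p] of SL(2,7) that does not commute with
    [q]. *)
Lemma psl_neq1 p q : qdet1 p -> qdet1 q -> qred (qmul p q) != qred (qmul q p) ->
  psl q != 1.
Proof.
move=> p1 q1; rewrite pslE; apply: contraNneq => /coset_idr; rewrite sl_normZ// => /(_ isT).
case/centerP => _ /(_ _ (sl_mem p1)).
rewrite /commute (slM q1 p1) ?qdet1M// (slM p1 q1) ?qdet1M//.
by move=> /sl_inj ->; rewrite ?qdet1M.
Qed.

Lemma psl_mem q : qdet1 q -> psl q \in PSL2_7.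
Proof. by move=> q1; rewrite pslE; apply: mem_quotient; apply: sl_mem. Qed.

Definition upper (x : nat) : quad := (1, x, 0, 1)%N.
Definition lower (x : nat) : quad := (1, 0, x, 1)%N.

Definition inv7 (x : nat) : nat := nth 0%N [:: 0; 1; 4; 5; 2; 3; 6]%N x.

(** Gaussian elimination: an element of SL(2,7) as a product of elementary
    matrices. *)
Definition gauss (q : quad) : quad := (
  let: (a, b, c, d) := q in
  if c == 0 then
    qmul (upper ((a + b + 6) * inv7 d %% 7))
      (qmul (lower d) (qmul (upper ((d + 6) * inv7 d %% 7)) (lower 6)))
  else qmul (upper ((a + 6) * inv7 c %% 7)) (qmul (lower c) (upper ((d + 6) * inv7 c %% 7))))%N.

Lemma gaussP : all (fun a => all (fun b => all (fun c => all (fun d =>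
    qdet1 (a, b, c, d) ==> (gauss (a, b, c, d) == (a, b, c, d)))
  (iota 0 7)) (iota 0 7)) (iota 0 7)) (iota 0 7).
Proof. by vm_compute. Qed.

Lemma sl_surj (u : {'GL_2(7)}) : u \in SL2_7 ->
  exists2 q, qdet1 q & u = sl q /\ gauss q = q.
Proof.
rewrite inE => /eqP du; pose e i j : nat := val (GLval u i j).
pose q : quad := (e 0 0, e 0 1, e 1 0, e 1 1)%R.
have uq : GLval u = qmx q.
  by apply/matrixP; apply: I2_ind; apply: I2_ind; rewrite !mxE /= natr_Zp.
have q1 : qdet1 q by move: du; rewrite uq -det_qmx => /eqP ->.
exists q => //; split; first by apply: val_inj; rewrite [RHS]GLval_sl.
have lt7 i j : e i j \in iota 0 7 by rewrite mem_iota; apply: ltn_ord.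
have /allP/(_ _ (lt7 0 0)%R)/allP/(_ _ (lt7 0 1)%R)/allP/(_ _ (lt7 1 0)%R) := gaussP.
by move=> /allP/(_ _ (lt7 1 1)%R) /implyP/(_ q1)/eqP.
Qed.

Lemma upper_det1 k : qdet1 (upper k).
Proof. by rewrite /= muln1 muln0. Qed.

Lemma lower_det1 k : qdet1 (lower k).
Proof. by rewrite /= muln1 mul0n. Qed.

Lemma sl_upperS k : sl (upper k.+1) = sl (upper 1) * sl (upper k).
Proof.
have q1 := qdet1M (upper_det1 1) (upper_det1 k).
rewrite (slM (upper_det1 1) (upper_det1 k) q1); apply: sl_congr; congr (_, _, _, _);
  by rewrite modn_mod ?mul1n ?mul0n ?muln0 ?muln1 ?addn0 ?add0n ?addn1.
Qed.

Lemma sl_lowerS k : sl (lower k.+1) = sl (lower 1) * sl (lower k).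
Proof.
have q1 := qdet1M (lower_det1 1) (lower_det1 k).
rewrite (slM (lower_det1 1) (lower_det1 k) q1); apply: sl_congr; congr (_, _, _, _);
  by rewrite modn_mod ?mul1n ?mul0n ?muln0 ?muln1 ?addn0 ?add0n ?add1n.
Qed.

Lemma sl_upper0 : sl (upper 0%N) = 1. Proof. exact: sl_1. Qed.
Lemma sl_lower0 : sl (lower 0%N) = 1. Proof. exact: sl_1. Qed.

Lemma SL2_7_generated (L : {group {'GL_2(7)}}) :
  sl (upper 1) \in L -> sl (lower 1) \in L -> SL2_7 \subset L.
Proof.
move=> U1 L1.
have UL k : sl (upper k) \in L.
  elim: k => [|k IH]; first by rewrite sl_upper0; exact: group1.
  by rewrite sl_upperS; exact: groupM U1 IH.
have LL k : sl (lower k) \in L.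
  elim: k => [|k IH]; first by rewrite sl_lower0; exact: group1.
  by rewrite sl_lowerS; exact: groupM L1 IH.
have mulL p q : qdet1 p -> qdet1 q -> sl p \in L -> sl q \in L -> sl (qmul p q) \in L.
  by move=> p1 q1 pL qL; rewrite -(slM p1 q1 (qdet1M p1 q1)); exact: groupM pL qL.
have Uq := upper_det1; have Lq := lower_det1.
apply/fintype.subsetP => u /sl_surj[[[[a b] c] d] _ [-> <-]]; rewrite /gauss.
case: (c == 0%N).
  apply: (mulL _ _ (Uq _) _ (UL _)); first by apply: qdet1M (Lq _) (qdet1M (Uq _) (Lq _)).
  apply: (mulL _ _ (Lq _) (qdet1M (Uq _) (Lq _)) (LL _)).
  exact: (mulL _ _ (Uq _) (Lq _) (UL _) (LL _)).
apply: (mulL _ _ (Uq _) (qdet1M (Lq _) (Uq _)) (UL _)).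
exact: (mulL _ _ (Lq _) (Uq _) (LL _) (UL _)).
Qed.

(** The elements [g] of order 7 and [h] of order 3 generate a Frobenius group of
    order 21. *)
Lemma PSL2_7_triple : exists x y z g h : coset_of 'Z(SL2_7),
  [/\ [/\ x * x = 1, y * y = 1, z * z = 1, x != 1 & y != 1], z != 1,
     [/\ x != y, (x * y) ^+ 3 = 1, y != z & (y * z) ^+ 3 = 1],
     [/\ (x * z) ^+ 2 != 1, (x * z) ^+ 4 = 1, x != z ^ y & (x * z ^ y) ^+ 4 = 1] &
     <<[set x; y; z]>> = PSL2_7] /\
  [/\ g \in PSL2_7, h \in PSL2_7, g ^+ 7 = 1, g != 1 & h * g = g ^+ 2 * h].
Proof.
pose X : quad := (0, 1, 6, 0)%N.
pose Y : quad := (1, 3, 4, 6)%N.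
pose Z : quad := (3, 1, 4, 4)%N.
have [qX qY qZ] : [/\ qdet1 X, qdet1 Y & qdet1 Z] by [].
have XX : psl X * psl X = 1 by rewrite pslM//; apply: psl_eq1.
have YY : psl Y * psl Y = 1 by rewrite pslM//; apply: psl_eq1.
have ZZ : psl Z * psl Z = 1 by rewrite pslM//; apply: psl_eq1.
have neq p q : psl q * psl q = 1 -> psl p * psl q != 1 -> psl p != psl q.
  by move=> qq; apply: contraNneq => ->; apply/eqP.
have ZY : psl Z ^ psl Y = psl (qmul Y (qmul Z Y)).
  rewrite conjgE -[(psl Y)^-1]mul1g -{1}YY mulgK.
  by rewrite (pslM qZ qY) (pslM qY (qdet1M qZ qY)).
have qZY : qdet1 (qmul Y (qmul Z Y)) by [].
have ZYZY : psl (qmul Y (qmul Z Y)) * psl (qmul Y (qmul Z Y)) = 1.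
  by rewrite pslM//; apply: psl_eq1.
exists (psl X), (psl Y), (psl Z), (psl (upper 1%N)), (psl (3, 0, 0, 5)%N).
split; last first.
  split; try exact: psl_mem.
  - by rewrite pslX//; apply: psl_eq1.
  - exact: (@psl_neq1 (lower 1%N)).
  by rewrite pslX// !pslM.
split.
- by split=> //; apply: (@psl_neq1 (upper 1%N)).
- exact: (@psl_neq1 (upper 1%N)).
- split.
  + by apply: neq => //; rewrite pslM//; apply: (@psl_neq1 (upper 1%N)).
  + by rewrite pslM// pslX//; apply: psl_eq1.
  + by apply: neq => //; rewrite pslM//; apply: (@psl_neq1 (upper 1%N)).
  + by rewrite pslM// pslX//; apply: psl_eq1.
- rewrite ZY; split.
  + by rewrite pslM// pslX//; apply: (@psl_neq1 (upper 1%N)).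
  + by rewrite pslM// pslX//; apply: psl_eq1.
  + by apply: neq => //; rewrite pslM//; apply: (@psl_neq1 (upper 1%N)).
  + by rewrite pslM// pslX//; apply: psl_eq1.
have gen : <<[set sl X; sl Y; sl Z]>> = SL2_7.
  apply/eqP; rewrite finset.eqEsubset; apply/andP; split.
    by rewrite gen_subG !finset.subUset !finset.sub1set !sl_mem.
  pose K := <<[set sl X; sl Y; sl Z]>>%G.
  have [xK yK zK] : [/\ sl X \in K, sl Y \in K & sl Z \in K].
    by split; apply: mem_gen; rewrite !inE eqxx ?orbT.
  apply: (@SL2_7_generated K); move: (K) xK yK zK => {K} K xK yK zK.
    have -> : sl (upper 1%N) = sl Y * (sl Z * sl X) by rewrite (@slM Z X)// slM.
    by move: (sl X) (sl Y) (sl Z) xK yK zK => a b c aK bK cK; rewrite !groupM.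
  have -> : sl (lower 1%N) = sl X * (sl X * (sl Z * (sl Y * sl X))).
    by rewrite (@slM Y X)// (@slM Z)// (@slM X)// slM.
  by move: (sl X) (sl Y) (sl Z) xK yK zK => a b c aK bK cK; rewrite !groupM.
have e : coset 'Z(SL2_7) @* <<[set sl X; sl Y; sl Z]>> = <<[set psl X; psl Y; psl Z]>>.
  rewrite morphim_gen; last by rewrite !finset.subUset !finset.sub1set !sl_normZ.
  by rewrite !morphimU !morphim_set1 ?sl_normZ// !pslE.
by rewrite -e gen.
Qed.

End KleinGroup.

(** * Real matrices of finite order *)

Section RealMatrices.
Variable R : rcfType.
Implicit Types (M N : 'M[R]_3) (g h : PGL R 3).

Lemma cube_root (x : R) : exists y, y ^+ 3 = x.
Proof.
pose b := 1 + `|x|; pose p : {poly R} := 'X^3 - x%:P.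
have hp y : p.[y] = y ^+ 3 - x by rewrite /p !hornerE.
have x0 := normr_ge0 x; have xle := ler_norm x.
have xge : - `|x| <= x by rewrite lerNl -normrN ler_norm.
have b1 : 1 <= b by rewrite /b lerDl.
have bb : b <= b ^+ 3 by rewrite -[X in X <= _]expr1 ler_weXn2l.
have : p.[- b] <= 0 <= p.[b].
  rewrite !hp exprNn -signr_odd /= expr1 mulN1r.
  by move: bb; rewrite /b => bb; apply/andP; split; lra.
have : - b <= b by rewrite /b; lra.
move=> h1 h2; have [y _ /rootP] := poly_ivt h1 h2.
by rewrite hp => /eqP; rewrite subr_eq0 => /eqP yx; exists y.
Qed.

Lemma cube_eq1 (x : R) : x ^+ 3 = 1 -> x = 1.
Proof.
move=> x3; have /eqP : (x - 1) * (x ^+ 2 + x + 1) = 0.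
  by transitivity (x ^+ 3 - 1); [ring|rewrite x3 subrr].
rewrite mulf_eq0 subr_eq0 => /orP[/eqP//|/eqP e].
have := sqr_ge0 (x + 1 / 2); rewrite (_ : _ ^+ 2 = x ^+ 2 + x + 1 - 3 / 4); last by field.
by rewrite e => ?; exfalso; lra.
Qed.

(** The middle coefficient of the characteristic polynomial is expressed by
    traces, so that taking traces relates those of the powers of [M]. *)
Lemma Cayley_Hamilton3 M :
  M *m M *m M - \tr M *: (M *m M)
  + ((\tr M ^+ 2 - \tr (M *m M)) / 2) *: M - (\det M)%:M = 0.
Proof.
rewrite det_mx3 /mxtrace !big_ord_recl big_ord0.
pose m i j := M (inord i) (inord j).
have ME i j : M i j = m (val i) (val j) by rewrite /m !inord_val.
apply/matrixP; apply: I3_ind; apply: I3_ind;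
  rewrite !(mxE, big_ord_recl, big_ord0) !ME /= /bump /= ?mulr1n ?mulr0n; by field.
Qed.

Lemma det_mxX M n : \det (M ^+ n) = \det M ^+ n.
Proof. by elim: n => [|n IH]; rewrite ?expr0 ?det1// !exprS det_mulmx IH. Qed.

(** The determinant is 1, so the Cayley-Hamilton relation reduces to
    [t M ^ 2 = e M], and [M] would be a scalar matrix if [t] were not 0. *)
Lemma mxtrace_order3 M : M ^+ 3 = 1 -> M != 1 -> \tr M = 0.
Proof.
move=> M3 M1.
have d1 : \det M = 1 by apply: cube_eq1; rewrite -det_mxX M3 det1.
have := Cayley_Hamilton3 M; rewrite d1 (_ : M *m M *m M = 1); last first.
  by rewrite -M3 !exprS expr0 mulr1 -mulmxA.
set t := \tr M; set e := _ / 2; rewrite [1 - _]addrC [_ + e *: M]addrAC.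
rewrite -[1%:M]/(1 : 'M_3) addrK addrC => /eqP; rewrite subr_eq0 => /eqP E.
have uM : M \in unitmx by rewrite unitmxE d1 unitr1.
have tM : t *: M = e%:M.
  have := congr1 (fun A => A *m invmx M) E.
  by rewrite -!scalemxAl -mulmxA mulmxV// mulmx1 scalemx1.
apply/eqP; apply: contraNT M1 => t0.
have Mk : M = (e / t)%:M.
  apply: (scalerI t0); rewrite tM scale_scalar_mx mulrCA divff// mulr1 //.
rewrite Mk; apply/eqP; congr (_ %:M); apply: cube_eq1.
have : (e / t)%:M ^+ 3 = 1%:M :> 'M_3 by rewrite -Mk M3.
rewrite -rmorphXn/= => /(congr1 (fun A : 'M_3 => A 0 0)).
by rewrite !mxE.
Qed.

Lemma mxtrace_order3_sqr M : M ^+ 3 = 1 -> M != 1 -> \tr M = 0 /\ \tr (M * M) = 0.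
Proof.
move=> M3 M1; split; first exact: mxtrace_order3.
apply: mxtrace_order3; first by rewrite -expr2 -exprM mulnC exprM M3 expr1n.
apply: contra_neq M1 => M2; transitivity (M * (M * M)); first by rewrite M2 mulr1.
by rewrite -M3 !exprS expr0 mulr1.
Qed.

(** Every nontrivial element of the group of type (3, 3) generated by [M] and
    [N] has trace 0, so the trace of the sum of its nine elements is 3; but that
    sum is 9 times a projection. *)
Lemma no_commuting_real_order3 M N :
  M ^+ 3 = 1 -> N ^+ 3 = 1 -> M * N = N * M ->
  M != 1 -> N != 1 -> M * N != 1 -> M * (N * N) != 1 -> False.
Proof.
move=> M3 N3 MN M1 N1 MN1 MN21.
have cMN : GRing.comm M N by [].
have cMNN : GRing.comm M (N * N) by apply: commrM.
have sum3 (X : 'M[R]_3) : X ^+ 3 = 1 ->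
    (1 + X + X * X) * (1 + X + X * X) = 3 *: (1 + X + X * X).
  move=> X3; have X3' : X * (X * X) = 1 by rewrite -X3 !exprS expr0 mulr1.
  have XA : X * (1 + X + X * X) = 1 + X + X * X.
    by rewrite !mulrDr mulr1 X3' addrC addrA.
  rewrite {1}[1 + X]addrC !mulrDl mul1r -mulrA !XA.
  by rewrite scaler_nat mulrS mulr2n addrA.
(* P / 9 is the projection on the vectors fixed by M and N; its trace is 3 / 9. *)
pose P := (1 + M + M * M) * (1 + N + N * N).
have PP : P * P = 9 *: P.
  rewrite /P mulrA -(mulrA (1 + M + M * M)).
  have -> : (1 + N + N * N) * (1 + M + M * M) = (1 + M + M * M) * (1 + N + N * N).
    apply: commr_sym; suff c : GRing.comm M (1 + N + N * N).
      have c' := commr_sym c; apply: commr_sym.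
      exact: commrD (commrD (commr1 _) c') (commrM c' c').
    exact: commrD (commrD (commr1 _) cMN) cMNN.
  rewrite mulrA sum3// -mulrA sum3//.
  by rewrite -scalerAl -scalerAr scalerA -natrM.
have trP : \tr P = 3.
  have [tM tM2] := mxtrace_order3_sqr M3 M1.
  have [tN tN2] := mxtrace_order3_sqr N3 N1.
  have MN3 : (M * N) ^+ 3 = 1 by rewrite exprMn_comm// M3 N3 mulr1.
  have [tMN] := mxtrace_order3_sqr MN3 MN1.
  have -> : M * N * (M * N) = M * M * (N * N) by rewrite mulrA -(mulrA M N M) -MN !mulrA.
  move=> tM2N2.
  have MNN3 : (M * (N * N)) ^+ 3 = 1.
    by rewrite exprMn_comm// M3 mul1r -expr2 -exprM mulnC exprM N3 expr1n.
  have [tMNN] := mxtrace_order3_sqr MNN3 MN21.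
  have -> : M * (N * N) * (M * (N * N)) = M * M * N.
    rewrite mulrA -(mulrA M (N * N) M) -cMNN -!mulrA; congr (M * (M * _)).
    by rewrite -[RHS]mulr1 -N3 !exprS expr0 mulr1.
  move=> tM2N.
  rewrite /P mulrDr !mulrDl !mul1r !mulrDr !mulr1 !raddfD/=.
  rewrite mxtrace1 tM tM2 tN tN2 tMN tMNN tM2N tM2N2.
  by rewrite !addr0.
have QQ : (9^-1 *: P) *m (9^-1 *: P) = 9^-1 *: P.
  rewrite -scalemxAl -scalemxAr [P *m P]PP !scalerA.
  by congr (_ *: _); field.
have := mxtrace_idempotent QQ; rewrite mxtraceZ trP; move: (\rank _) => r e.
have : (1%N)%:R = (3 * r)%:R :> R by rewrite natrM -e; field.
by move/eqP; rewrite eqr_nat; lia.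
Qed.

(** As [M], [M ^ 2] and [M ^ 4] have the same trace [t], either [t = 0] and
    [M ^ 3 = 1], or [t = 3] and [M] is unipotent, or [t ^ 2 + t + 2 = 0], which
    has no real solution. *)
Lemma no_real_order7 M N : N \in unitmx ->
  M ^+ 7 = 1 -> M != 1 -> N *m M = M *m M *m N -> False.
Proof.
move=> uN M7 M1 NM.
pose t := \tr M.
have tr2 : \tr (M *m M) = t.
  have -> : M *m M = N *m M *m invmx N by rewrite NM mulmxK.
  by rewrite mxtrace_mulC mulKmx.
have tr4 : \tr (M *m M *m M *m M) = t.
  have -> : M *m M *m M *m M = N *m (M *m M) *m invmx N.
    by rewrite (mulmxA N) NM -(mulmxA (M *m M) N M) NM !mulmxA mulmxK.
  by rewrite mxtrace_mulC mulKmx.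
have d1 : \det M = 1.
  have : \det N * \det M = \det M * \det M * \det N by rewrite -!det_mulmx NM.
  rewrite mulrC => /(mulIf _) -/(_ _)/esym; rewrite -unitfE -unitmxE => /(_ uN).
  have d0 : \det M != 0.
    apply: contra_eq_neq M7 => d0; apply: contraTneq isT => /(congr1 determinant).
    by rewrite det_mxX d0 expr0n det1 => /esym/eqP; rewrite oner_eq0.
  by move=> e; apply: (mulfI d0); rewrite e mulr1.
(* M, M ^ 2 and M ^ 4 are conjugate and have the same trace t; the traces of
   the Cayley-Hamilton relation and of its product with M are equations in t. *)
have CH := Cayley_Hamilton3 M; rewrite d1 tr2 -/t in CH.
set e := _ / 2 in CH.
pose p3 := \tr (M *m M *m M).
have e3 : p3 = t * t - e * t + 3.
  have := congr1 mxtrace CH; rewrite !raddfD/= !raddfN/= !mxtraceZ tr2 mxtrace1 -/t -/p3 mxtrace0.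
  by move=> H; transitivity (p3 - (p3 - t * t + e * t - 3)); [rewrite H subr0|ring].
have e4 : t * p3 = e * t.
  have := congr1 (fun A => \tr (A *m M)) CH; rewrite !mulmxDl !mulNmx -!scalemxAl mul1mx mul0mx.
  rewrite !raddfD/= !raddfN/= !mxtraceZ tr2 -/t tr4 -/p3 mxtrace0.
  by move=> H; transitivity (t * p3 + (t - t * p3 + e * t - t)); [rewrite H addr0|ring].
have : t * (p3 - e) = 0 by rewrite mulrBr e4 mulrC subrr.
move/eqP; rewrite mulf_eq0 subr_eq0 => /orP[/eqP t0|/eqP pe].
  have M3 : M *m M *m M = 1.
    by apply/eqP; rewrite -subr_eq0 -CH /e t0 expr0n subrr mul0r !scale0r subr0 addr0.
  have M3' : M ^+ 3 = 1 by rewrite -[RHS]M3 !exprS expr0 mulr1 mulrA.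
  by case/eqP: M1; rewrite -[RHS]M7 (exprD M 1 6) (exprM M 3 2) M3' expr1n mulr1 expr1.
have : (t - 3) * (t ^+ 2 + t + 2) = 0.
  have -> : (t - 3) * (t ^+ 2 + t + 2) = - 2 * (t * t - e * t + 3 - e) by rewrite /e; field.
  by rewrite -e3 pe subrr mulr0.
move/eqP; rewrite mulf_eq0 subr_eq0 => /orP[/eqP t3|/eqP tq]; last first.
  have := sqr_ge0 (t + 1 / 2); rewrite (_ : _ ^+ 2 = t ^+ 2 + t + 2 - 7 / 4); last by field.
  by rewrite tq => H; clear -H; lra.
have e3' : e = 3 by rewrite /e t3; field.
have cube : (M - 1%:A) * ((M - 1%:A) * (M - 1)) = 0.
  rewrite !scale1r -[RHS]CH t3 e3' !mulrBl !mul1r !mulrBr !mulr1 -[1%:M]/(1 : 'M_3).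
  rewrite -[M *m M *m M]/(M * M * M) -[M *m M]/(M * M) (mulrA M M M).
  move: (M * M * M) (M * M) (1 : 'M[R]_3) => A3 A2 A0.
  by apply/matrixP => i j; rewrite !mxE; ring.
have h1 := semisimple_eigen (isT : (0 < 7)%N) M7 cube.
have h2 : (M - 1%:A) * ((M - 1%:A) * 1) = 0 by rewrite mulr1 -[RHS]h1 !scale1r.
have := semisimple_eigen (isT : (0 < 7)%N) M7 h2.
by rewrite mulr1 scale1r => /eqP; rewrite subr_eq0 (negPf M1).
Qed.

End RealMatrices.

(** * A_6 and PSL(2,7) do not descend to the reals *)

Section RealForms.
Variable R : realType.
Local Notation C := R[i].
Local Notation rc := (@map_PGL R C (real_complex R) 3).

(** A complex factor between two real matrices is real. *)
Lemma real_PGL_inj : injective rc.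
Proof.
move=> g h; have [M uM ->] := mxclass_surj g; have [N uN ->] := mxclass_surj h.
rewrite !map_PGL_mxclass// => /mxclassP; rewrite !map_unitmx => /(_ uM uN)[c c0 E].
have M0 : M != 0 by apply: contraTneq uM => ->; rewrite unitmxE det0 unitr0.
have /matrix0Pn[i [j Mij]] := M0.
have cE : c = real_complex R (N i j / M i j).
  have /matrixP/(_ i j) := E; rewrite !mxE => e.
  by rewrite rmorphM fmorphV/= [X in X / _]e mulfK// fmorph_eq0.
have N0 : N i j / M i j != 0.
  by apply: contra_neq c0 => e; rewrite cE e rmorph0.
apply/mxclassP => //; exists (N i j / M i j) => //.
by apply: (@map_mx_inj _ _ (real_complex R)); rewrite E cE map_mxZ.
Qed.

(** Divide by the cube root of the determinant. *)
Lemma PGL3_det1_lift (g : PGL R 3) :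
  exists M : 'M[R]_3, \det M = 1 /\ g = mxclass M.
Proof.
have [M uM ->] := mxclass_surj g; have [y yE] := cube_root (\det M).
have y0 : y != 0.
  apply: contraTneq uM => y0; rewrite unitmxE -yE y0 expr0n/= unitr0 //.
exists (y^-1 *: M); split; first by rewrite detZ -yE exprVn mulVf// expf_neq0.
apply/mxclassP => //; first by rewrite unitmxZ// unitfE invr_eq0.
by exists y^-1; rewrite ?invr_eq0.
Qed.

Lemma PGL3_det1_lift_uniq (M N : 'M[R]_3) : \det M = 1 -> \det N = 1 ->
  mxclass M = mxclass N -> M = N.
Proof.
move=> dM dN /mxclassP; rewrite !unitmxE dM dN unitr1 => /(_ isT isT)[c c0 E].
by move: dN; rewrite E detZ dM mulr1 => /cube_eq1 ->; rewrite scale1r.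
Qed.

(** Existence and uniqueness of real cube roots make SL_3(R) -> PGL_3(R) an
    isomorphism, of which [L] is the inverse. *)
Lemma PGL3_section : exists L : PGL R 3 -> 'M[R]_3,
  [/\ forall g, \det (L g) = 1, forall g, g = mxclass (L g) &
      {morph L : g h / (g * h)%g >-> g *m h}].
Proof.
have [L LP] := choice PGL3_det1_lift; exists L; split=> [g|g|g h]; try by case: (LP g).
have [dg eg] := LP g; have [dh eh] := LP h; have [d e] := LP (g * h)%g.
apply: PGL3_det1_lift_uniq => //; first by rewrite det_mulmx dg dh mulr1.
by rewrite -e mxclassM ?unitmxE ?dg ?dh ?unitr1// -eg -eh.
Qed.

(** Composition of a real form with the inverse of SL_3(R) -> PGL_3(R). *)
Lemma real_representation (hT : finGroupType) (H : {group hT}) (G : set (PGL C 3)) :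
  isomorphic_to H G -> definable_over_R G ->
  exists r : hT -> 'M[R]_3,
    [/\ {in H &, {morph r : x y / (x * y)%g >-> x *m y}},
        {in H, forall x, r x \in unitmx}, r 1%g = 1 &
        {in H, forall x, r x = 1 -> x = 1%g}].
Proof.
move=> [f [fM [fG fI _]]] [_ [x ->] GR].
have /choice[k kP] : forall y, exists g : PGL R 3, y \in H -> rc g = (f y ^ x)%g.
  move=> y; have [yH|] := boolP (y \in H); last by exists 1%g.
  have [|g _ e] := GR (f y ^ x)%g; first by exists (f y) => //; apply: fG.
  by exists g.
have [L [Ld LE LM]] := PGL3_section.
have f1 := pmorph1 fM.
have kM : {in H &, {morph k : y z / (y * z)%g}}.
  move=> y z Hy Hz; apply: real_PGL_inj.
  by rewrite map_PGLM !kP ?groupM// fM// conjMg.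
have rc1 : rc 1%g = 1%g.
  by apply: (mulgI (rc 1%g)); rewrite -map_PGLM !mulg1.
have k1 : k 1%g = 1%g by apply: real_PGL_inj; rewrite kP ?group1// f1 conj1g rc1.
have L1 : L 1%g = 1%:M.
  by apply: PGL3_det1_lift_uniq; rewrite ?det1// -LE mxclass1.
exists (fun y => L (k y)); split=> [y z Hy Hz|y Hy||y Hy e].
- by rewrite kM// LM.
- by rewrite unitmxE Ld unitr1.
- by rewrite k1 L1.
apply: fI; rewrite ?inE//= f1; apply: (conjg_inj x).
by rewrite conj1g -kP// [k y]LE e mxclass1 rc1.
Qed.

Lemma A6_not_definable (G : set (PGL C 3)) : is_A6 G -> ~ definable_over_R G.
Proof.
pose A6 : {group {perm 'I_6}} := ('Alt_('I_6))%G.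
move=> GA6 /(real_representation GA6)[r [rM _ r1 rI]].
have [x [y [z [b [[_ _ _ _ gen] [bA oa ob cab nb]]]]]] := Alt6_triple.
have [xA yA] : x \in A6 /\ y \in A6.
  by rewrite /= -gen; split; apply: mem_gen; rewrite !inE eqxx ?orbT.
have aA := groupM xA yA; set a := (x * y)%g in aA oa cab nb.
have a3 : (a ^+ 3 = 1)%g by have := expg_order a; rewrite oa.
have b3 : (b ^+ 3 = 1)%g by have := expg_order b; rewrite ob.
have rX u n : u \in A6 -> r (u ^+ n)%g = r u ^+ n.
  by move=> uA; elim: n => [|n IH]; rewrite ?expg0 ?expr0// expgS exprS rM ?groupX// IH.
have rne u : u \in A6 -> u != 1%g -> r u != 1.
  by move=> uA; apply: contra_neq; apply: rI.
apply: (@no_commuting_real_order3 _ (r a) (r b)).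
- by rewrite -rX// a3 r1.
- by rewrite -rX// b3 r1.
- by rewrite -[LHS]rM// -[RHS]rM// cab.
- by apply: rne => //; rewrite -order_gt1 oa.
- by apply: rne => //; rewrite -order_gt1 ob.
- rewrite -[_ * _]rM//; apply: rne; first exact: groupM.
  apply: contraNneq nb => ab1.
  by rewrite -(mulKg a b) ab1 mulg1 groupV cycle_id.
rewrite -[r b * r b]rM// -[_ * _]rM ?groupM//; apply: rne; first by rewrite !groupM.
apply: contraNneq nb => abb1.
have bb : (b * b = b^-1)%g.
  by apply: (mulIg b); rewrite mulVg -b3 !expgS expg0 mulg1 mulgA.
have <- : a = b by apply: (mulIg b^-1%g); rewrite mulgV -abb1 bb.
exact: cycle_id.
Qed.

Lemma PSL2_7_not_definable (G : set (PGL C 3)) : is_PSL2_7 G -> ~ definable_over_R G.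
Proof.
move=> GP /(real_representation GP)[r [rM rU r1 rI]].
have [x [y [z [g [h [_ [gP hP g7 g1 hg]]]]]]] := PSL2_7_triple.
have rX u n : u \in PSL2_7 -> r (u ^+ n)%g = r u ^+ n.
  by move=> uA; elim: n => [|n IH]; rewrite ?expg0 ?expr0// expgS exprS rM ?groupX// IH.
apply: (@no_real_order7 _ (r g) (r h)); first exact: rU.
- by rewrite -rX// g7 r1.
- by apply: contra_neq g1; apply: rI.
by rewrite -!rM ?groupM// hg expgS expg1.
Qed.

End RealForms.

(** * A_6 and PSL(2,7) have real moduli *)

Section RealModuli.
Variable R : realType.
Local Notation C := R[i].

Lemma sigmaM : {morph @sigma R : g h / (g * h)%g}.
Proof. exact: map_PGLM. Qed.

Lemma has_real_moduli_generated (A : set (PGL C 3)) (x : PGL C 3) :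
  @sigma R @` A = conj_set A x -> has_real_moduli (generated A).
Proof.
move=> e; apply: conjugate_sets_sym; exists x.
by rewrite conj_set_generated -e; apply: image_generated sigmaM A.
Qed.

Lemma has_real_moduli_conj (G H : set (PGL C 3)) :
  conjugate_sets G H -> has_real_moduli G -> has_real_moduli H.
Proof.
move=> [x ->] [y e]; exists ((sigma x)^-1 * y * x)%g.
have <- : conj_set (@sigma R @` G) (sigma x) = @sigma R @` conj_set G x.
  apply/seteqP; split=> [_ [_ [g Gg <-] <-]|_ [_ [g Gg <-] <-]].
    exists (g ^ x)%g; first by exists g.
    by rewrite !conjgE !sigmaM (morphVg sigmaM).
  exists (sigma g); first by exists g.
  by rewrite !conjgE !sigmaM (morphVg sigmaM).
by rewrite conj_setM !mulgA mulgV mul1g -conj_setM -e.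
Qed.

Lemma definable_conj (G H : set (PGL C 3)) :
  conjugate_sets G H -> definable_over_R H -> definable_over_R G.
Proof. by move=> GH [K HK KR]; exists K => //; apply: conjugate_sets_trans GH HK. Qed.

(** Conjugation permutes the three generators up to a common inner
    automorphism. *)
Lemma real_moduli_of_relations (gT : finGroupType) (H : {group gT}) (x y z : gT)
    (m : nat) (G : set (PGL C 3)) :
  isomorphic_to H G -> <<[set x; y; z]%SET>>%g = H ->
  [/\ x * x = 1, y * y = 1, z * z = 1, x != 1 & y != 1]%g -> z != 1%g ->
  [/\ x != y, (x * y) ^+ 3 = 1, y != z & (y * z) ^+ 3 = 1]%g ->
  [/\ (x * z) ^+ 2 != 1, (x * z) ^+ 4 = 1, x != z ^ y & (x * z ^ y) ^+ m = 1]%g ->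
  (m == 4) || (m == 5) -> has_real_moduli G.
Proof.
move=> [f [fM fG]] gen [xx yy zz x1 y1] z1 [xy xy3 yz yz3] [xz2 xz4 xzy xzym] m45.
have [xH yH zH] : [/\ x \in H, y \in H & z \in H].
  by rewrite -gen; split; apply: mem_gen; rewrite !inE eqxx ?orbT.
have f1 := pmorph1 fM; have fX := pmorphX fM.
have fI u v : u \in H -> v \in H -> u != v -> f u != f v.
  have [_ + _] := fG; move=> inj uH vH; apply: contra_neq => /inj; apply; rewrite inE//.
have fJ := pmorphJ fM.
pose h (i : 'I_3) : PGL C 3 := f (nth 1%g [:: x; y; z] i).
have GE : G = generated (range h).
  rewrite (isomorphic_generated fM fG gen); congr generated.
  apply/seteqP; split=> [_ [u /= + <-]|_ [i _ <-]].
    rewrite !inE => /orP[/orP[]|] /eqP ->; [exists 0|exists 1|exists 2] => //.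
  by exists (nth 1%g [:: x; y; z] i) => //; move: i; apply: I3_ind; rewrite /= !inE eqxx ?orbT.
have [|||||||||||s [p [pp hE]]] := @conj_permutes_involutions C h m => //.
- by apply: I3_ind; rewrite /h /= -fM// ?xx ?yy ?zz f1.
- by apply: I3_ind; rewrite /h /= -f1 fI.
- by rewrite fI.
- by rewrite /h /= -fM// -fX ?groupM// xy3 f1.
- by rewrite fI.
- by rewrite /h /= -fM// -fX ?groupM// yz3 f1.
- by rewrite /h /= -fM// -fX ?groupM// -f1 fI// ?groupX// groupM.
- by rewrite /h /= -fM// -fX ?groupM// xz4 f1.
- by rewrite /h /= -fJ// fI// groupJ.
- have zyH : (z ^ y)%g \in H by rewrite groupJ.
  by rewrite /h /= -fJ// -fM// -fX; [rewrite xzym f1|exact: groupM].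
rewrite GE; apply: (@has_real_moduli_generated _ s).
apply/seteqP; split=> [_ [_ [i _ <-] <-]|_ [_ [i _ <-] <-]].
  by exists (h (p i)); [exists (p i)|rewrite -hE].
by exists (h (p i)); [exists (p i)|rewrite -[LHS]/(map_PGL Num.conj _) hE pp].
Qed.

Lemma A6_real_moduli (G : set (PGL C 3)) : is_A6 G -> has_real_moduli G.
Proof.
move=> GA; have [x [y [z [b [[h1 h2 h3 h4 gen] _]]]]] := Alt6_triple.
exact: (real_moduli_of_relations GA gen h1 h2 h3 h4).
Qed.

Lemma PSL2_7_real_moduli (G : set (PGL C 3)) : is_PSL2_7 G -> has_real_moduli G.
Proof.
move=> GP; have [x [y [z [g [h [[h1 h2 h3 h4 gen] _]]]]]] := PSL2_7_triple.
exact: (real_moduli_of_relations GP gen h1 h2 h3 h4).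
Qed.

End RealModuli.

(** * The copies of A_5 form one conjugacy class *)

Definition triple (gT : groupType) (x y z : gT) (i : 'I_3) : gT :=
  nth 1%g [:: x; y; z] i.

Section Icosahedral.
Variable F : numClosedFieldType.
Implicit Types (x y z : PGL F 3) (h : 'I_3 -> PGL F 3).

(** In terms of the Gram matrix, a triple of involutions that satisfies the
    relations of type H_3.  The parameter [t] distinguishes the two algebraically
    conjugate representations of A_5 of degree 3. *)
Definition icosahedral (t : F) h : Prop :=
  exists (v : 'I_3 -> 'cV[F]_3) (w : 'I_3 -> 'rV[F]_3),
  [/\ forall i, dot (w i) (v i) = 1, forall i, h i = homology (v i) (w i),
      dot (w 0) (v 1) * dot (w 1) (v 0) = 1 / 4,
      dot (w 1) (v 2) * dot (w 2) (v 1) = t &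
      dot (w 0) (v 2) = 0 /\ dot (w 2) (v 0) = 0].

(** The triangular products are 0, so [t] is the only invariant left. *)
Lemma icosahedral_rigid t h h' : t != 0 -> t != 3 / 4 ->
  icosahedral t h -> icosahedral t h' -> exists x, forall i, h' i = (h i ^ x)%g.
Proof.
move=> t0 t34 [v [w [d hE t01 t12 [g02 g20]]]] [v' [w' [d' hE' t01' t12' [g02' g20']]]].
(* the Gram determinant is 3 / 4 - t *)
have [] := @triple_rigid _ v v' w w' => //=.
- by rewrite t01 t01'.
- by rewrite t01 mulf_neq0 ?oner_neq0// invr_eq0 pnatr_eq0.
- by rewrite t12 t12'.
- by rewrite t12.
- by rewrite g20 g20' !mulr0.
- by rewrite g02 g02' !mul0r.
- rewrite t01 t12 g20 g02 !mulr0 !mul0r !addr0 subr0.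
  rewrite (_ : 1 - 1 / 4 - t = 3 / 4 - t); last by field.
  by rewrite subr_eq0 eq_sym.
by move=> x hx; exists x => i; rewrite hE hE'.
Qed.

Lemma icosahedral_homologies (v : 'I_3 -> 'cV[F]_3) (w : 'I_3 -> 'rV[F]_3) :
  (forall i, dot (w i) (v i) = 1) ->
  let h i := homology (v i) (w i) in
  icosahedral_relations (h 0) (h 1) (h 2) ->
  exists t, [/\ icosahedral t h, t = dot (w 1) (v 2) * dot (w 2) (v 1)
              & 16 * t ^+ 2 - 12 * t + 1 = 0].
Proof.
move=> d h [_ [_ [[n01 o01 n12 o12] [n02 o02]]]].
exists (dot (w 1) (v 2) * dot (w 2) (v 1)); split=> //; last first.
  exact: homology_product_order5 (d 1) (d 2) n12 o12.
exists v, w; split=> //; first exact: homology_product_order3 (d 0) (d 1) n01 o01.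
exact: homology_commute (d 0) (d 2) n02 o02.
Qed.

Lemma icosahedral_of_relations x y z : icosahedral_relations x y z ->
  exists t, icosahedral t (triple x y z) /\ 16 * t ^+ 2 - 12 * t + 1 = 0.
Proof.
move=> rel; have [[xx yy zz x1 y1] [z1 _]] := rel.
have [||v [w vw]] := @involutions_homologies _ (triple x y z).
- exact: I3_ind.
- exact: I3_ind.
have d i : dot (w i) (v i) = 1 by case: (vw i).
have hE i : triple x y z i = homology (v i) (w i) by case: (vw i).
have [||t [[v' [w' [d' hE' ? ? ?]]] _ te]] := @icosahedral_homologies v w => //.
  by move: rel; rewrite -!hE.
by exists t; split=> //; exists v', w'; split=> // i; rewrite hE hE'.
Qed.

(** As [y * (y ^ z)] is the square of [y * z], its eigenvalue is the square
    of that of [y * z]. *)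
Lemma icosahedral_switch t x y z x' : icosahedral t (triple x y z) ->
  icosahedral_relations x' y (y ^ z)%g ->
  icosahedral ((2 * t - 1) ^+ 2) (triple x' y (y ^ z)%g).
Proof.
move=> [v [w [d hE t01 t12 _]]] rel; have [[x'x' _ _ x'1 _] _] := rel.
have [v' [w' [d' hx']]] := involution_homology x'x' x'1.
have hy : y = homology (v 1) (w 1) by rewrite -hE.
have hz : z = homology (v 2) (w 2) by rewrite -hE.
pose v3 := homology_mx (v 2) (w 2) *m v 1; pose w3 := w 1 *m homology_mx (v 2) (w 2).
have yz : (y ^ z)%g = homology v3 w3 by rewrite hy hz homology_conj.
have d3 : dot w3 v3 = 1.
  rewrite /dot /w3 /v3 mulmxA -(mulmxA (w 1)) [_ *m homology_mx _ _]homology_mxK//.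
  by rewrite mulmx1 -/(dot _ _) d.
pose V (i : 'I_3) := nth 0 [:: v'; v 1; v3] i; pose W (i : 'I_3) := nth 0 [:: w'; w 1; w3] i.
have D i : dot (W i) (V i) = 1 by move: i; apply: I3_ind; rewrite /V /W /=;
  [exact: d'|exact: d|exact: d3].
have hV i : triple x' y (y ^ z)%g i = homology (V i) (W i).
  by move: i; apply: I3_ind; rewrite /triple /= ?hx' ?yz.
have [|s [[V' [W' [D' HE a b c]]] sE _]] := @icosahedral_homologies V W D.
  by rewrite -!hV.
have -> : (2 * t - 1) ^+ 2 = s.
  rewrite sE /V /W /= /v3 /w3 homology_mxv dotBZ homology_vmx dotBZl d -t12.
  ring.
by exists V', W'; split=> // i; rewrite hV HE.
Qed.

End Icosahedral.

Section A5.
Variable R : realType.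
Local Notation C := R[i].

Lemma icosahedral_relations_image (hT : finGroupType) (H : {group hT})
    (gT : groupType) (f : hT -> gT) x y z :
  {in H &, {morph f : x y / (x * y)%g}} -> {in H &, injective f} ->
  [/\ x \in H, y \in H & z \in H] ->
  icosahedral_relations x y z -> icosahedral_relations (f x) (f y) (f z).
Proof.
move=> fM fI [Hx Hy Hz] [[xx yy zz x1 y1] [z1 [[nxy xy3 nyz yz5] [nxz xz2]]]].
have f1 := pmorph1 fM; have ne u v : u \in H -> v \in H -> u != v -> f u != f v.
  by move=> Hu Hv; apply: contra_neq; apply: fI.
by do 3 ?split; rewrite -?fM// -?(pmorphX fM) ?groupM// -?f1 ?ne ?xx ?yy ?zz ?xy3 ?yz5 ?xz2.
Qed.

Lemma generated_triple (hT : finGroupType) (H : {group hT}) (gT : groupType)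
    (f : hT -> gT) (G : set gT) x y z :
  {in H &, {morph f : x y / (x * y)%g}} -> set_bij [set` H] G f ->
  <<[set x; y; z]%SET>>%g = H -> G = generated (range (triple (f x) (f y) (f z))).
Proof.
move=> fM fG gen; rewrite (isomorphic_generated fM fG gen); congr generated.
apply/seteqP; split=> [_ [u /= + <-]|_ [i _ <-]].
  by rewrite !inE => /orP[/orP[]|] /eqP ->; [exists 0|exists 1|exists 2].
exists (nth 1%g [:: x; y; z] i); move: i;
  by apply: I3_ind; rewrite /triple /= ?inE ?eqxx ?orbT.
Qed.

(** Whatever the root given by one generating triple, the pair of triples
    [Alt5_triples] provides both. *)
Lemma A5_icosahedral (t : C) (G : set (PGL C 3)) :
  16 * t ^+ 2 - 12 * t + 1 = 0 -> is_A5 G ->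
  exists2 h : 'I_3 -> PGL C 3, icosahedral t h & G = generated (range h).
Proof.
move=> te [f [fM fG]]; have [_ + _] := fG => fI'.
have fI : {in ('Alt_('I_5))%G &, injective f}.
  by move=> u v Hu Hv; apply: fI'; rewrite inE.
have [x [y [z [x' [rel rel' gen gen']]]]] := Alt5_triples.
have [xA yA zA] : [/\ x \in ('Alt_('I_5))%G, y \in ('Alt_('I_5))%G & z \in ('Alt_('I_5))%G].
  by rewrite /= -gen; split; apply: mem_gen; rewrite !inE eqxx ?orbT.
have x'A : x' \in ('Alt_('I_5))%G.
  by rewrite /= -gen'; apply: mem_gen; rewrite !inE eqxx ?orbT.
have fJ : f (y ^ z)%g = (f y ^ f z)%g := pmorphJ fM yA zA.
have frel := icosahedral_relations_image fM fI (And3 xA yA zA) rel.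
have frel' := icosahedral_relations_image fM fI (And3 x'A yA (groupJ yA zA)) rel'.
have [s [ico se]] := icosahedral_of_relations frel.
have /eqP : (s - t) * (s - (3 / 4 - t)) = 0.
  transitivity ((16 * s ^+ 2 - 12 * s + 1 - (16 * t ^+ 2 - 12 * t + 1)) / 16); first by field.
  by rewrite se te subrr mul0r.
rewrite mulf_eq0 !subr_eq0 => /orP[/eqP st|/eqP st].
  by exists (triple (f x) (f y) (f z)); [rewrite -st|exact: generated_triple fM fG gen].
rewrite fJ in frel'.
exists (triple (f x') (f y) (f y ^ f z)%g); last first.
  by rewrite -fJ; exact: generated_triple fM fG gen'.
rewrite (_ : t = (2 * s - 1) ^+ 2); first exact: icosahedral_switch ico frel'.
transitivity (3 / 4 - s); first by rewrite st; field.
transitivity ((2 * s - 1) ^+ 2 - (16 * s ^+ 2 - 12 * s + 1) / 4); first by field.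
by rewrite se mul0r subr0.
Qed.

End A5.

(** * The rotation group of a regular dodecahedron *)

(** The kernel of [f] is a normal subgroup that does not contain [x]. *)
Lemma simple_injective (hT : finGroupType) (gT : groupType) (H : {group hT})
    (f : hT -> gT) (x : hT) :
  {in H &, {morph f : x y / (x * y)%g}} -> simple H -> x \in H -> f x != 1%g ->
  {in H &, injective f}.
Proof.
move=> fM /simpleP[_ simH] xH fx; have f1 := pmorph1 fM.
pose K := [set y in H | f y == 1%g]%SET.
have gK : group_set K.
  apply/group_setP; split=> [|u v]; first by rewrite inE group1 f1 eqxx.
  rewrite !inE => /andP[uH /eqP fu] /andP[vH /eqP fv].
  by rewrite groupM//= fM// fu fv mulg1.
have nK : (Group gK <| H)%g.
  apply/normalP; split=> [|y yH]; first by apply/fintype.subsetP => u; rewrite inE => /andP[].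
  apply/eqP; rewrite eqEcard cardJg leqnn andbT; apply/fintype.subsetP => u.
  rewrite mem_conjg !inE groupJr ?groupV// => /andP[uH].
  rewrite (pmorphJ fM) ?groupV// (pmorphV fM)// -(conj1g (f y)^-1%g) => /eqP /conjg_inj fu.
  by rewrite uH fu conj1g/=.
have {simH} [K1|KH] := simH _ nK; last first.
  have : x \in Group gK by rewrite KH.
  by rewrite inE (negPf fx) andbF.
move=> u v uH vH fuv; have : (u * v^-1)%g \in Group gK.
  by rewrite inE groupM ?groupV//= fM ?groupV// (pmorphV fM)// fuv mulgV.
by rewrite K1 => /set1P/(congr1 (fun y => y * v)%g); rewrite mulgVK mul1g.
Qed.

Section Dodecahedron.
Variables (F : numFieldType) (phi : F).
Hypothesis phi2 : phi ^+ 2 = phi + 1.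
Local Notation psi := (phi - 1).

Definition row3 (a b c : F) : 'rV[F]_3 := \row_j nth 0 [:: a; b; c] j.

Lemma row3M a b c a1 a2 a3 b1 b2 b3 c1 c2 c3 :
  row3 a b c *m mx3 [:: [:: a1; a2; a3]; [:: b1; b2; b3]; [:: c1; c2; c3]]
  = row3 (a * a1 + b * b1 + c * c1) (a * a2 + b * b2 + c * c2)
         (a * a3 + b * b3 + c * c3).
Proof.
by apply/rowP; apply: I3_ind; rewrite !(mxE, big_ord_recl, big_ord0) /= addr0 addrA.
Qed.

(** The vertices of a regular dodecahedron, indexed by the ordered pairs of
    distinct elements of {0, ..., 4}: A_5 permutes the vertices as it permutes
    the pairs, and opposite vertices are transposed pairs.  Here [phi] is the
    golden ratio or its algebraic conjugate; on the diagonal the value is 0. *)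
Definition vertex (i j : nat) : 'rV[F]_3 :=
  nth 0 (nth [::] [::
    [:: 0; row3 0 (- phi) psi; row3 psi 0 (- phi); row3 (- phi) psi 0; row3 1 1 1];
    [:: row3 0 phi (- psi); 0; row3 (- phi) (- psi) 0; row3 psi 0 phi; row3 1 (- 1) (- 1)];
    [:: row3 (- psi) 0 phi; row3 phi psi 0; 0; row3 0 (- phi) (- psi); row3 (- 1) 1 (- 1)];
    [:: row3 phi (- psi) 0; row3 (- psi) 0 (- phi); row3 0 phi psi; 0; row3 (- 1) (- 1) 1];
    [:: row3 (- 1) (- 1) (- 1); row3 (- 1) 1 1; row3 1 (- 1) 1; row3 1 1 (- 1); 0]] i) j.

Definition vertex_action (s : {perm 'I_5}) (M : 'M[F]_3) : Prop :=
  forall i j : 'I_5, vertex i j *m M = vertex (s i) (s j).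

(** The vertices (0, 4), (1, 4) and (2, 4) form a basis. *)
Lemma vertex_action_uniq s M N : vertex_action s M -> vertex_action s N -> M = N.
Proof.
move=> HM HN.
pose V : 'M[F]_3 := mx3 [:: [:: 1; 1; 1]; [:: 1; - 1; - 1]; [:: - 1; 1; - 1]].
have uV : V \in unitmx.
  rewrite unitmxE unitfE det_mx3 !mxE /=.
  by rewrite (_ : _ + _ = 4) ?pnatr_eq0//; ring.
have rV i : row i V = vertex i 4%N.
  by move: i; apply: I3_ind; apply/rowP; apply: I3_ind; rewrite !mxE.
have MN (i : 'I_3) : vertex i 4%N *m M = vertex i 4%N *m N.
  pose i5 := widen_ord (isT : 3 <= 5)%N i; pose j5 := Ordinal (isT : 4 < 5)%N.
  by have := HM i5 j5; rewrite -(HN i5 j5).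
suff : V *m M = V *m N.
  by move=> /(congr1 (mulmx (invmx V))); rewrite !mulmxA mulVmx// !mul1mx.
by apply/row_matrixP => i; rewrite !row_mul rV.
Qed.

Lemma vertex_actionM s s' M M' : vertex_action s M -> vertex_action s' M' ->
  vertex_action (s * s')%g (M *m M').
Proof. by move=> H H' i j; rewrite mulmxA H H' !permM. Qed.

Lemma vertex_action1 : vertex_action 1%g 1%:M.
Proof. by move=> i j; rewrite mulmx1 !perm1. Qed.

Lemma vertex_action_word l M : small 4 l ->
  (forall i j, (i < 5)%N -> (j < 5)%N -> vertex i j *m M = vertex (act l i) (act l j)) ->
  vertex_action (word 4 l) M.
Proof. by move=> sl H i j; rewrite !val_word//; apply: H. Qed.

Definition rho_x : 'M[F]_3 := mx3 [:: [:: 1; 0; 0]; [:: 0; - 1; 0]; [:: 0; 0; - 1]].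
Definition rho_y : 'M[F]_3 :=
  mx3 [:: [:: - 1 / 2; psi / 2; phi / 2]; [:: psi / 2; - phi / 2; 1 / 2];
          [:: phi / 2; 1 / 2; psi / 2]].
Definition rho_z : 'M[F]_3 := mx3 [:: [:: - 1; 0; 0]; [:: 0; 1; 0]; [:: 0; 0; - 1]].

Lemma vertex_action_x : vertex_action alt5x rho_x.
Proof.
apply: vertex_action_word => //.
by move=> [|[|[|[|[|i]]]]] [|[|[|[|[|j]]]]] //;
  rewrite /vertex /rho_x /= ?mul0mx ?row3M//; move=> _ _;
  congr row3; ring.
Qed.

Lemma vertex_action_z : vertex_action alt5z rho_z.
Proof.
apply: vertex_action_word => //.
by move=> [|[|[|[|[|i]]]]] [|[|[|[|[|j]]]]] //;
  rewrite /vertex /rho_z /= ?mul0mx ?row3M//; move=> _ _;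
  congr row3; ring.
Qed.

Lemma vertex_action_y : vertex_action alt5y rho_y.
Proof.
apply: vertex_action_word => //.
by move=> [|[|[|[|[|i]]]]] [|[|[|[|[|j]]]]] //;
  rewrite /vertex /rho_y /= ?mul0mx ?row3M//; move=> _ _;
  congr row3; field: phi2.
Qed.

Lemma Alt5_vertex_action s : s \in ('Alt_('I_5))%G -> exists M, vertex_action s M.
Proof.
pose K := [set s : {perm 'I_5} | `[< exists M, vertex_action s M >]]%SET.
have gK : group_set K.
  apply/group_setP; split=> [|u v].
    by rewrite inE; apply/asboolP; exists 1%:M; apply: vertex_action1.
  rewrite !inE => uK vK; case: uK vK => [M HM] [N HN].
  by exists (M *m N); apply: vertex_actionM.
move=> sA'; have sA : s \in <<[set alt5x; alt5y; alt5z]%SET>>%g.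
  by rewrite Alt5_generated_xyz.
suff : s \in Group gK by rewrite inE => /asboolP.
apply: (fintype.subsetP _ _ sA); rewrite gen_subG !finset.subUset !finset.sub1set.
rewrite -!andbA; apply/and3P; split; rewrite inE; apply/asboolP.
- by exists rho_x; apply: vertex_action_x.
- by exists rho_y; apply: vertex_action_y.
by exists rho_z; apply: vertex_action_z.
Qed.

(** The matrix that realises a permutation on the vertices is unique, hence
    multiplicative; A_5 being simple, it suffices that one element acts
    nontrivially. *)
Lemma A5_embedding : exists G : set (PGL F 3), isomorphic_to ('Alt_('I_5))%G G.
Proof.
have /choice[r rP] : forall s, exists M, s \in ('Alt_('I_5))%G -> vertex_action s M.
  move=> s; have [sA|nA] := boolP (s \in ('Alt_('I_5))%G); last by exists 0.
  by have [M HM] := Alt5_vertex_action sA; exists M.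
have rM : {in ('Alt_('I_5))%G &, {morph r : s u / (s * u)%g >-> s *m u}}.
  move=> s u sA uA; apply: (vertex_action_uniq (s := (s * u)%g)).
    by apply: rP; apply: groupM.
  by apply: vertex_actionM; apply: rP.
have r1 : r 1%g = 1%:M.
  by apply: (vertex_action_uniq _ vertex_action1); apply: rP; apply: group1.
have rU s : s \in ('Alt_('I_5))%G -> r s \in unitmx.
  move=> sA; have : r s *m r s^-1%g = 1%:M by rewrite -rM ?groupV// mulgV.
  by case/mulmx1_unit.
pose f s : PGL F 3 := mxclass (r s).
have fM : {in ('Alt_('I_5))%G &, {morph f : s u / (s * u)%g}}.
  by move=> s u sA uA; rewrite /f rM// mxclassM ?rU.
have xA : alt5x \in ('Alt_('I_5))%G by apply: word_even.
have fI : {in ('Alt_('I_5))%G &, injective f}.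
  apply: (simple_injective fM _ xA); first by apply: simple_Alt5_base; rewrite card_ord.
  rewrite /f (_ : r _ = rho_x); last first.
    by apply: (vertex_action_uniq (rP _ xA)); apply: vertex_action_x.
  have ux : rho_x \in unitmx.
    by rewrite -(vertex_action_uniq (rP _ xA) vertex_action_x) rU.
  apply/eqP; rewrite -mxclass1 => /mxclassP; rewrite ux unitmx1 => /(_ isT isT)[c _ /matrixP e].
  have := e 1 1; have := e 0 0; rewrite !mxE /= mulr1 => <- /eqP.
  by rewrite mulrN1 eq_sym -subr_eq0 -opprD oppr_eq0 -(natrD _ 1 1) pnatr_eq0.
exists (f @` [set` ('Alt_('I_5))%G]); exists f; split; first exact: fM.
split; first by move=> s sA; exists s.
  by move=> s u; rewrite !inE; apply: fI.
by [].
Qed.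

End Dodecahedron.

(** * The copy of A_5 generated by A, B and C *)

Local Open Scope complex_scope.

Section Pentagon.
Variable R : realType.
Local Notation C := R[i].
Local Notation c2 := (cos (2 * pi / 5 : R)).
Local Notation s2 := (sin (2 * pi / 5 : R)).
Local Notation c4 := (cos (4 * pi / 5 : R)).

Lemma sin_fifth_gt0 : 0 < s2.
Proof.
have p0 := pi_gt0 R; apply: sin_gt0_pi.
by apply/andP; split; lra.
Qed.

Lemma cos_fifth_gt0 : 0 < c2.
Proof.
have p0 := pi_gt0 R; apply: cos_gt0_pihalf.
by apply/andP; split; lra.
Qed.

Lemma cos_fifth2 : c4 = 2 * c2 ^+ 2 - 1.
Proof.
rewrite (_ : 4 * pi / 5 = (2 * pi / 5) *+ 2 :> R); last by rewrite mulr2n; field.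
by rewrite cos_mulr2n -[X in X - 1]mulr_natl.
Qed.

Lemma cos_fifthE : 4 * c2 ^+ 2 + 2 * c2 - 1 = 0.
Proof.
have s0 := sin_fifth_gt0; have cs := cos2Dsin2 (2 * pi / 5 : R).
have c1 : c2 - 1 != 0.
  rewrite subr_eq0; apply/eqP => c1; move: cs; rewrite c1 expr1n => /eqP.
  by rewrite -subr_eq0 addrAC subrr add0r sqrf_eq0 (gt_eqF s0).
(* cos (6 pi / 5) = cos (4 pi / 5) gives a cubic equation with the root 1. *)
apply: (mulfI c1); rewrite mulr0.
have e : cos (2 * pi / 5 + 4 * pi / 5 : R) = c4.
  rewrite (_ : 2 * pi / 5 + 4 * pi / 5 = pi *+ 2 - 4 * pi / 5 :> R); last by rewrite mulr2n; field.
  by rewrite cosB cos2pi sin2pi mul1r mul0r addr0.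
have s4 : sin (4 * pi / 5 : R) = 2 * c2 * s2.
  rewrite (_ : 4 * pi / 5 = (2 * pi / 5) *+ 2 :> R); last by rewrite mulr2n; field.
  by rewrite sin_mulr2n -mulr_natl mulrA.
move: e; rewrite cosD s4 cos_fifth2 => e.
transitivity (c2 * (2 * c2 ^+ 2 - 1) - s2 * (2 * c2 * s2) - (2 * c2 ^+ 2 - 1)
  + 2 * c2 * (c2 ^+ 2 + s2 ^+ 2 - 1)); first by ring.
by rewrite e cs !subrr mulr0 addr0.
Qed.

Lemma cos_fifth4 : c4 = - c2 - 1 / 2.
Proof. by rewrite cos_fifth2; have := cos_fifthE; lra. Qed.

Lemma sin_fifth4 : sin (8 * pi / 5 : R) = - s2.
Proof.
rewrite (_ : 8 * pi / 5 = pi *+ 2 - 2 * pi / 5 :> R); last by rewrite mulr2n; field.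
by rewrite sinB cos2pi sin2pi mul1r mul0r sub0r.
Qed.

Local Notation z := (zeta R 5).
Local Notation c := (real_complex R c2).

Lemma zeta5E : z = c2 +i* s2. Proof. by []. Qed.

Lemma zeta5_quad : z ^+ 2 = 2 * c * z - 1.
Proof.
have cs := cos2Dsin2 (2 * pi / 5 : R).
rewrite zeta5E expr2; apply/eqP; rewrite eq_complex /=; apply/andP; split; apply/eqP.
  transitivity (c2 ^+ 2 - s2 ^+ 2); first by rewrite !expr2.
  transitivity (2 * c2 ^+ 2 - (c2 ^+ 2 + s2 ^+ 2)); first by ring.
  by rewrite cs; ring.
by ring.
Qed.

Lemma zeta5V : z^-1 = 2 * c - z.
Proof.
have e : z * (2 * c - z) = 1.
  transitivity (2 * c * z - z ^+ 2); first by ring.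
  by rewrite zeta5_quad; ring.
have z0 : z != 0 by apply: contra_eq_neq e => ->; rewrite mul0r eq_sym oner_neq0.
by apply: (mulfI z0); rewrite e divff.
Qed.

Lemma cos_fifthC : 4 * c ^+ 2 + 2 * c - 1 = 0.
Proof.
have <- : real_complex R (4 * c2 ^+ 2 + 2 * c2 - 1) = 4 * c ^+ 2 + 2 * c - 1.
  by rewrite !expr2 rmorphB rmorphD !rmorphM rmorph1 !rmorph_nat.
by rewrite cos_fifthE rmorph0.
Qed.

Lemma cos_fifthC4 : real_complex R c4 = - c - 1 / 2.
Proof. by rewrite cos_fifth4 rmorphB rmorphN rmorphM fmorphV rmorph1 rmorph_nat. Qed.

End Pentagon.

Section KleinTriple.
Variable F : numClosedFieldType.
Implicit Types (M N : 'M[F]_3).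

Definition col3 (a b c : F) : 'cV[F]_3 := \col_i nth 0 [:: a; b; c] i.

Lemma dot3 a b c a' b' c' :
  dot (row3 a b c) (col3 a' b' c') = a * a' + b * b' + c * c'.
Proof. by rewrite /dot !(mxE, big_ord_recl, big_ord0) /= addr0 addrA. Qed.

Lemma homology_mx3 a b c a' b' c' :
  homology_mx (col3 a b c) (row3 a' b' c') =
  mx3 [:: [:: 2 * (a * a') - 1; 2 * (a * b'); 2 * (a * c')];
          [:: 2 * (b * a'); 2 * (b * b') - 1; 2 * (b * c')];
          [:: 2 * (c * a'); 2 * (c * b'); 2 * (c * c') - 1]].
Proof.
apply/matrixP; apply: I3_ind; apply: I3_ind;
  by rewrite !(mxE, big_ord_recl, big_ord0) /= ?mulr1n ?mulr0n ?subr0 addr0 mulr_natl.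
Qed.

Lemma diag_mx3X (a b d : F) k :
  mx3 [:: [:: a; 0; 0]; [:: 0; b; 0]; [:: 0; 0; d]] ^+ k =
  mx3 [:: [:: a ^+ k; 0; 0]; [:: 0; b ^+ k; 0]; [:: 0; 0; d ^+ k]].
Proof.
elim: k => [|k IH].
  by apply/matrixP; apply: I3_ind; apply: I3_ind; rewrite !mxE.
rewrite exprS IH -[LHS]/(_ *m _) mul_mx3 !exprS.
by congr (mx3 [:: [:: _; _; _]; [:: _; _; _]; [:: _; _; _]]); ring.
Qed.

Variables (c z : F).
Hypotheses (cE : 4 * c ^+ 2 + 2 * c - 1 = 0) (zE : z ^+ 2 = 2 * c * z - 1).

(** The centres of the homologies C, A^2 B and B; [klein_w] gives their axes. *)
Definition klein_v (i : 'I_3) : 'cV[F]_3 :=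
  nth 0 [:: col3 1 (2 * c) (2 * c); col3 0 1 (- z ^+ 2); col3 0 1 (- 1)] i.

Definition klein_w (i : 'I_3) : 'rV[F]_3 :=
  let k := (2 - 2 * c)^-1 in
  nth 0 [:: row3 k (k * c) (k * c); row3 0 (1 / 2) (- (2 * c - z) ^+ 2 / 2);
            row3 0 (1 / 2) (- 1 / 2)] i.

Lemma klein_c_neq1 : 2 - 2 * c != 0.
Proof.
apply/eqP => c1; have : (5 : F) = 0.
  transitivity (4 * c ^+ 2 + 2 * c - 1 + (2 - 2 * c) * (2 * c + 3)); first by ring.
  by rewrite cE c1 mul0r addr0.
by move/eqP; rewrite pnatr_eq0.
Qed.

Lemma klein_c_sqr : c ^+ 2 = (1 - 2 * c) / 4.
Proof.
transitivity ((4 * c ^+ 2 + 2 * c - 1 + 1 - 2 * c) / 4); first by field.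
by rewrite cE add0r.
Qed.

Lemma root_of_unity5 : z ^+ 5 = 1.
Proof.
apply/eqP; rewrite -subr_eq0; apply/eqP.
transitivity ((z ^+ 2 - (2 * c * z - 1)) *
    (z ^+ 3 + 2 * c * z ^+ 2 + (4 * c ^+ 2 - 1) * z + (8 * c ^+ 3 - 4 * c))
  + (4 * c ^+ 2 + 2 * c - 1) * ((4 * c ^+ 2 - 2 * c - 1) * z - (2 * c - 1))).
  by ring.
by rewrite zE cE subrr !mul0r addr0.
Qed.

Lemma dot_klein_vw i : dot (klein_w i) (klein_v i) = 1.
Proof.
have c1 := klein_c_neq1.
have zV : z * (2 * c - z) = 1 by rewrite mulrBr -expr2 zE; ring.
move: i; apply: I3_ind; rewrite /klein_v /klein_w /= dot3.
- apply: (mulfI c1); transitivity (1 + 4 * c ^+ 2); first by field.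
  by rewrite klein_c_sqr; field.
- transitivity (1 / 2 + (z * (2 * c - z)) ^+ 2 / 2); first by field.
  by rewrite zV; field.
by field.
Qed.

(** The parameter is [cos (2 pi / 5) ^ 2]. *)
Lemma klein_icosahedral :
  icosahedral (c ^+ 2) (fun i => homology (klein_v i) (klein_w i)).
Proof.
have c1 := klein_c_neq1; have c2 := klein_c_sqr.
have zV : z * (2 * c - z) = 1.
  by rewrite mulrBr -expr2 zE; ring.
exists klein_v, klein_w; split=> //; first exact: dot_klein_vw.
- rewrite /klein_v /klein_w /= !dot3.
  transitivity (c ^+ 2 / (2 - 2 * c) * (1 + (z * (2 * c - z)) ^+ 2
    + 2 * (z * (2 * c - z)) - (2 * c) ^+ 2)); first by field.
  rewrite zV; transitivity (c ^+ 2 * (2 + 2 * c)); first by field.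
  rewrite c2; transitivity ((2 - 2 * c - 4 * c ^+ 2) / 4); first by field.
  by rewrite c2; field.
- rewrite /klein_v /klein_w /= !dot3.
  transitivity ((1 + (z * (2 * c - z)) ^+ 2 - 2 * (z * (2 * c - z)) + (2 * c) ^+ 2) / 4).
    by field.
  by rewrite zV; field.
by rewrite /klein_v /klein_w /= !dot3; split; field.
Qed.

Lemma klein_c_neq0 : c != 0.
Proof.
by apply: contra_eq_neq cE => ->; rewrite expr0n !mulr0 !add0r oppr_eq0 oner_neq0.
Qed.

Lemma klein_homology_C :
  homology_mx (klein_v 0) (klein_w 0) = (2 * c / (1 - c)) *:
    mx3 [:: [:: 1 / 2; 1 / 2; 1 / 2]; [:: 1; - c - 1 / 2; c]; [:: 1; c; - c - 1 / 2]].
Proof.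
have c1 := klein_c_neq1; have c1' : 1 - c != 0.
  by apply: contra_neq c1 => e; transitivity (2 * (1 - c)); [ring|rewrite e mulr0].
rewrite /klein_v /klein_w /= homology_mx3 scale_mx3.
have c2 : 2 * c * (- c - 1 / 2) / (1 - c) = 2 * (2 * c * (c / (2 - 2 * c))) - 1.
  transitivity ((- 2 * c ^+ 2 - c) / (1 - c)); first by field.
  transitivity ((2 * c ^+ 2 + c - 1) / (1 - c)); last by field; rewrite ?c1 ?c1'.
  by rewrite klein_c_sqr; field.
congr (mx3 [:: [:: _; _; _]; [:: _; _; _]; [:: _; _; _]]); try (field; by rewrite ?c1 ?c1').
  by rewrite [RHS]mulrAC c2 [c / _]mulrC.
by rewrite [RHS]mulrAC c2 [c / _]mulrC.
Qed.

Lemma klein_homology_B :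
  homology_mx (klein_v 2) (klein_w 2) =
    (- 1) *: mx3 [:: [:: 1; 0; 0]; [:: 0; 0; 1]; [:: 0; 1; 0]].
Proof.
rewrite /klein_v /klein_w /= homology_mx3 scale_mx3.
by congr (mx3 [:: [:: _; _; _]; [:: _; _; _]; [:: _; _; _]]); field.
Qed.

Lemma klein_homology_AAB (M := mx3 [:: [:: 1; 0; 0]; [:: 0; 2 * c - z; 0]; [:: 0; 0; z]]) :
  homology_mx (klein_v 1) (klein_w 1) =
    (- 1) *: (M *m M *m mx3 [:: [:: 1; 0; 0]; [:: 0; 0; 1]; [:: 0; 1; 0]]).
Proof.
rewrite /klein_v /klein_w /= homology_mx3 !mul_mx3 scale_mx3.
congr (mx3 [:: [:: _; _; _]; [:: _; _; _]; [:: _; _; _]]); try by field.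
have zV : z * (2 * c - z) = 1 by rewrite mulrBr -expr2 zE; ring.
transitivity ((z * (2 * c - z)) ^+ 2 - 1); first by field.
by rewrite zV; ring.
Qed.

End KleinTriple.

Section StandardA5.
Variable R : realType.
Local Notation C := R[i].
Local Notation z := (zeta R 5).
Local Notation c := (real_complex R (cos (2 * pi / 5 : R))).

Lemma homology_mxclass (F : numClosedFieldType) (v : 'cV[F]_3) w k M :
  dot w v = 1 -> homology_mx v w = k *: M -> k != 0 -> M \in unitmx /\ homology v w = mxclass M.
Proof.
move=> wv e k0; have uM : M \in unitmx.
  by rewrite -(@unitmxZ _ _ k) ?unitfE// -e unit_homology_mx.
by split=> //; rewrite /homology e mxclassZ.
Qed.

Definition klein_triple (i : 'I_3) : PGL C 3 := homology (klein_v c z i) (klein_w c z i).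

Lemma dot_klein i : dot (klein_w c z i) (klein_v c z i) = 1.
Proof. exact: dot_klein_vw (cos_fifthC R) (zeta5_quad R) i. Qed.

Lemma A5_C_homology : A5_C (2^-1 : R) = klein_triple 0.
Proof.
have cE := cos_fifthC R; have c0 := klein_c_neq0 cE; have c1 := klein_c_neq1 cE.
have c1' : 1 - c != 0.
  by apply: contra_neq c1 => e; transitivity (2 * (1 - c)); [ring|rewrite e mulr0].
have mu0 : 2 * c / (1 - c) != 0 by rewrite !mulf_neq0 ?invr_eq0 ?pnatr_eq0.
rewrite /klein_triple; have [_ ->] := homology_mxclass (dot_klein 0) (klein_homology_C z cE) mu0.
congr mxclass; apply/matrixP; apply: I3_ind; apply: I3_ind; rewrite !mxE /= ?cos_fifthC4 ?rmorph1//.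
all: by rewrite fmorphV rmorph_nat mul1r.
Qed.

Lemma A5_B_homology : A5_B R = klein_triple 2 /\
  mx3 [:: [:: 1; 0; 0]; [:: 0; 0; 1]; [:: 0; 1; 0]] \in @unitmx C 3.
Proof.
have n1 : - 1 != 0 :> C by rewrite oppr_eq0 oner_neq0.
by rewrite /klein_triple; have [? ->] := homology_mxclass (dot_klein 2) (klein_homology_B c z) n1.
Qed.

Local Notation MA := (mx3 [:: [:: 1; 0; 0]; [:: 0; 2 * c - z; 0]; [:: 0; 0; z]]).

Lemma unit_A5_A_mx : MA \in @unitmx C 3.
Proof.
have d : \det (MA : 'M[C]_3) = 2 * c * z - z ^+ 2.
  by rewrite det_mx3 !mxE /=; move: z c => u a; ring.
by rewrite unitmxE unitfE d (zeta5_quad R) opprB addrCA subrr addr0 oner_neq0.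
Qed.

Lemma A5_AE : A5_A R = mxclass MA.
Proof. by rewrite /A5_A /class3 (zeta5V R). Qed.

Lemma A5_AAB_homology : (A5_A R * A5_A R * A5_B R)%g = klein_triple 1.
Proof.
have n1 : - 1 != 0 :> C by rewrite oppr_eq0 oner_neq0.
rewrite /klein_triple.
have [_ ->] := homology_mxclass (dot_klein 1) (klein_homology_AAB (zeta5_quad R)) n1.
have [_ uB] := A5_B_homology.
have uA := unit_A5_A_mx; have uAA : MA *m MA \in @unitmx C 3 by rewrite unitmx_mul uA.
rewrite A5_AE; apply/esym; apply: etrans (mxclassM uAA uB) _.
by congr (_ * _)%g; exact: (mxclassM uA uA).
Qed.

Lemma A5_A_order : (A5_A R ^+ 5)%g = 1%g.
Proof.
rewrite A5_AE; apply: etrans (mxclassX 5 unit_A5_A_mx) _.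
rewrite -mxclass1; congr mxclass.
have z5 : z ^+ 5 = 1 := root_of_unity5 (cos_fifthC R) (zeta5_quad R).
have zV : z * (2 * c - z) = 1 by rewrite mulrBr -expr2 zeta5_quad; ring.
have zV5 : (2 * c - z) ^+ 5 = 1.
  by rewrite -[LHS]mul1r -[X in X * _]z5 -exprMn zV expr1n.
apply: etrans (diag_mx3X _ _ _ _) _; rewrite z5 zV5 expr1n.
by apply/matrixP; apply: I3_ind; apply: I3_ind; rewrite !mxE.
Qed.

(** As [a ^ 5 = 1], the element [a] is the cube of [a * a], which is itself
    [(a * a * b) * b]. *)
Lemma generated_change (gT : groupType) (a b x : gT) (k : 'I_3 -> gT) :
  (a ^+ 5 = 1)%g -> (b * b = 1)%g -> x = k 0 -> (a * a * b)%g = k 1 -> b = k 2 ->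
  generated [set a; b; x]%classic = generated (range k).
Proof.
move=> a5 bb k0 k1 k2; apply: generated_eq.
  have K i : generated (range k) (k i) by exact: (sub_generated (imageT _ _)).
  have [_ GM _] := generated_subgroup (range k).
  have GAA : generated (range k) (a * a)%g.
    rewrite -[X in generated _ X]mulg1 -bb mulgA k1 k2.
    exact: (GM _ _ (K 1) (K 2)).
  move=> _ [[->|->]|->].
  - rewrite -[X in generated _ X]mul1g -a5.
    suff -> : (a ^+ 5 * a = a * a * (a * a * (a * a)))%g.
      exact: (GM _ _ GAA (GM _ _ GAA GAA)).
    by rewrite !expgS expg0 mulg1 !mulgA.
  - rewrite k2; exact: K.
  - rewrite k0; exact: K.
have [_ GM _] := generated_subgroup [set a; b; x]%classic.
have Ga : generated [set a; b; x]%classic a by apply: sub_generated; left; left.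
have Gb : generated [set a; b; x]%classic b by apply: sub_generated; left; right.
move=> _ [i _ <-]; move: i; apply: I3_ind.
- by rewrite -k0; apply: sub_generated; right.
- rewrite -k1; exact: (GM _ _ (GM _ _ Ga Ga) Gb).
rewrite -k2; exact: Gb.
Qed.

Lemma A5_ABC_generated : A5_ABC R = generated (range klein_triple).
Proof.
have [eB _] := A5_B_homology.
have BB : (A5_B R * A5_B R)%g = 1%g by rewrite eB; exact: homologyK (dot_klein 2).
exact: (generated_change A5_A_order BB A5_C_homology A5_AAB_homology eB).
Qed.

Lemma isomorphic_conj (hT : finGroupType) (H : {group hT}) (gT : groupType)
    (G K : set gT) : isomorphic_to H G -> conjugate_sets G K -> isomorphic_to H K.
Proof.
move=> [f [fM [fG fI fS]]] [x ->]; exists (fun u => (f u ^ x)%g); split.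
  by move=> u v Hu Hv; rewrite fM// conjMg.
split.
- by move=> u Hu; exists (f u) => //; apply: fG.
- by move=> u v Hu Hv /conjg_inj; apply: fI.
by move=> _ [g /fS[u Hu <-] <-]; exists u.
Qed.

(** Both groups are generated by icosahedral triples with the same parameter. *)
Lemma A5_conjugate_ABC (G : set (PGL C 3)) : is_A5 G -> conjugate_sets G (A5_ABC R).
Proof.
move=> GA5; have cE := cos_fifthC R; have c0 := klein_c_neq0 cE; have c2 := klein_c_sqr cE.
have tE : 16 * (c ^+ 2) ^+ 2 - 12 * c ^+ 2 + 1 = 0 :> C.
  by rewrite c2; transitivity (4 * c ^+ 2 + 2 * c - 1); [field|].
have [h ico ->] := A5_icosahedral tE GA5.
have ico' := klein_icosahedral cE (zeta5_quad R).
have [||x hx] := icosahedral_rigid _ _ ico ico'.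
- by rewrite expf_neq0.
- apply/eqP => c34; have cN : c = - 1.
    transitivity ((1 - 4 * c ^+ 2) / 2); last by rewrite c34; field.
    by rewrite c2; field.
  have /eqP : (1 : C) = 0 by rewrite -cE cN; ring.
  by rewrite oner_eq0.
exists x; rewrite A5_ABC_generated conj_set_generated; congr generated.
apply/seteqP; split=> [_ [i _ <-]|_ [_ [i _ <-] <-]].
  by exists (h i); [exists i|rewrite -hx].
by exists i; rewrite // -hx.
Qed.

(** The dodecahedral group is some copy of A_5, and <A, B, C> is conjugate to
    every copy. *)
Lemma A5_ABC_is_A5 : is_A5 (A5_ABC R).
Proof.
have phi2 : (2 * c + 1) ^+ 2 = (2 * c + 1) + 1 :> C.
  have cE := cos_fifthC R.
  by transitivity (4 * c ^+ 2 + 2 * c - 1 + (2 * c + 1) + 1); [ring|rewrite cE add0r].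
have [G GA5] := A5_embedding phi2.
exact: isomorphic_conj GA5 (A5_conjugate_ABC GA5).
Qed.

End StandardA5.

(** * The Hessian groups *)

Section ConjugateGenerators.
Variables (gT : groupType) (f : gT -> gT) (S T U V : gT).
Hypothesis fM : {morph f : x y / (x * y)%g}.
Hypotheses (f_S : f S = S^-1%g) (f_T : f T = T) (f_U : f U = U^-1%g) (f_V : f V = V^-1%g).
Hypotheses (US : (U * S = S * U)%g) (SUT : (S * (U * T) = T * U)%g).

Lemma conj_of_generators (A : set (gT)) x :
  (forall g, A g -> generated A (f g ^ x)%g) ->
  (forall g, A g -> generated [set (f h ^ x)%g | h in A] g) ->
  conjugate_sets (f @` generated A) (generated A).
Proof.
move=> AG GA; exists x.
rewrite (image_generated fM) conj_set_generated; apply: generated_eq => //.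
  by move=> g /GA; congr (generated _ g); rewrite /conj_set image_comp.
by move=> _ [_ [g Ag <-] <-]; apply: AG.
Qed.

Lemma Hess36_conj :
  conjugate_sets (f @` generated [set S; T; V]) (generated [set S; T; V]).
Proof.
apply: (@conj_of_generators _ 1%g) => g.
  set G := generated _; have [_ _ GV] : is_subgroup G by apply: generated_subgroup.
  have GS : G S by apply: sub_generated; left; left.
  have GT : G T by apply: sub_generated; left; right.
  have GV' : G V by apply: sub_generated; right.
  rewrite conjg1 => -[[->|->]|->]; rewrite ?f_S ?f_T ?f_V; [exact: GV|exact: GT|exact: GV].
set G := generated _; have [_ _ GV] : is_subgroup G by apply: generated_subgroup.
have GS : G (f S) by apply: sub_generated; exists S; rewrite ?conjg1//; left; left.
have GT : G (f T) by apply: sub_generated; exists T; rewrite ?conjg1//; left; right.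
have GV' : G (f V) by apply: sub_generated; exists V; rewrite ?conjg1//; right.
move=> [[->|->]|->]; [|by rewrite -f_T|].
- by rewrite -[S]invgK -f_S; apply: GV.
- by rewrite -[V]invgK -f_V; apply: GV.
Qed.

Lemma Hess216_conj :
  conjugate_sets (f @` generated [set S; T; U; V]) (generated [set S; T; U; V]).
Proof.
apply: (@conj_of_generators _ 1%g) => g.
  set G := generated _; have [_ _ GV] : is_subgroup G by apply: generated_subgroup.
  have GS : G S by apply: sub_generated; left; left; left.
  have GT : G T by apply: sub_generated; left; left; right.
  have GU : G U by apply: sub_generated; left; right.
  have GV' : G V by apply: sub_generated; right.
  rewrite conjg1 => -[[[->|->]|->]|->]; rewrite ?f_S ?f_T ?f_U ?f_V;
    [exact: GV|exact: GT|exact: GV|exact: GV].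
set G := generated _; have [_ _ GV] : is_subgroup G by apply: generated_subgroup.
have GS : G (f S) by apply: sub_generated; exists S; rewrite ?conjg1//; left; left; left.
have GT : G (f T) by apply: sub_generated; exists T; rewrite ?conjg1//; left; left; right.
have GU : G (f U) by apply: sub_generated; exists U; rewrite ?conjg1//; left; right.
have GV' : G (f V) by apply: sub_generated; exists V; rewrite ?conjg1//; right.
move=> [[[->|->]|->]|->]; [|by rewrite -f_T| |].
- by rewrite -[S]invgK -f_S; apply: GV.
- by rewrite -[U]invgK -f_U; apply: GV.
- by rewrite -[V]invgK -f_V; apply: GV.
Qed.

(** The map [f] sends S, T, V and [U * V * U^-1] to S^-1, T, V^-1 and
    [U^-1 * V^-1 * U]; conjugating by U brings these back into the group, since
    U normalises <S, T>. *)
Lemma Hess72_conj (W := (U * V * U^-1)%g) :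
  conjugate_sets (f @` generated [set S; T; V; W]) (generated [set S; T; V; W]).
Proof.
have conjU g : (g ^ U^-1 = U * g * U^-1)%g by rewrite conjgE invgK mulgA.
have eS : (f S ^ U^-1 = S^-1)%g by rewrite f_S conjVg conjU US mulgK.
have eT : (f T ^ U^-1 = S^-1 * T)%g.
  rewrite f_T conjU; apply: (mulgI S).
  by rewrite (mulgA S (U * T)%g) SUT mulgK mulKVg.
have eV : (f V ^ U^-1 = W^-1)%g by rewrite f_V conjVg conjU.
have eW : (f W ^ U^-1 = V^-1)%g.
  rewrite /W !fM (morphVg fM) f_U f_V invgK conjU.
  by rewrite !mulgA mulgV mul1g mulgK.
clearbody W.
apply: (@conj_of_generators _ U^-1%g) => g.
  set G := generated _; have [_ GM GV] : is_subgroup G by apply: generated_subgroup.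
  have GS : G S by apply: sub_generated; left; left; left.
  have GT : G T by apply: sub_generated; left; left; right.
  have GV' : G V by apply: sub_generated; left; right.
  have GW : G W by apply: sub_generated; right.
  move=> [[[->|->]|->]|->]; rewrite ?eS ?eT ?eV ?eW;
    [exact: GV|exact: (GM _ _ (GV _ GS) GT)|exact: GV|exact: GV].
set G := generated _; have [_ GM GV] : is_subgroup G by apply: generated_subgroup.
have GS : G (f S ^ U^-1)%g by apply: sub_generated; exists S => //; left; left; left.
have GT : G (f T ^ U^-1)%g by apply: sub_generated; exists T => //; left; left; right.
have GV' : G (f V ^ U^-1)%g by apply: sub_generated; exists V => //; left; right.
have GW : G (f W ^ U^-1)%g by apply: sub_generated; exists W => //; right.
have GS' : G S by rewrite -[S]invgK -eS; apply: GV.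
move=> [[[->|->]|->]|->] //.
- by rewrite -[T](mulKVg S) -eT; apply: GM.
- by rewrite -[V]invgK -eW; apply: GV.
- by rewrite -[W]invgK -eV; apply: GV.
Qed.

End ConjugateGenerators.

(** If two commuting classes descend to PGL_3(R), their lifts of determinant 1
    commute, and so does every other pair of lifts. *)
Lemma noncommuting_lifts_not_definable (R : realType) (M N : 'M[R[i]]_3) (a : R[i])
    (G : set (PGL R[i] 3)) :
  M \in unitmx -> N \in unitmx -> a != 1 -> N *m M = a *: (M *m N) ->
  (mxclass M * mxclass N = mxclass N * mxclass M)%g ->
  G (mxclass M) -> G (mxclass N) -> ~ definable_over_R G.
Proof.
move=> uM uN a1 NM; set S := mxclass M; set T := mxclass N => ST GS GT [_ [x ->] GR].
have [s _ sE] : PGL3R R (S ^ x)%g by apply: GR; exists S.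
have [t _ tE] : PGL3R R (T ^ x)%g by apply: GR; exists T.
have [L [Ld LE LM]] := PGL3_section R.
have st : (s * t = t * s)%g.
  by apply: real_PGL_inj; rewrite !map_PGLM sE tE -!conjMg ST.
have LL : L s *m L t = L t *m L s by rewrite -!LM st.
have [X uX xE] := mxclass_surj x.
have lift (K : 'M[R[i]]_3) g : K \in unitmx ->
    map_PGL (real_complex R) g = (mxclass K ^ x)%g ->
    exists2 b, b != 0 & X *m map_mx (real_complex R) (L g) = b *: (K *m X).
  move=> uK; have uL : L g \in unitmx by rewrite unitmxE Ld unitr1.
  have uL' : map_mx (real_complex R) (L g) \in unitmx by rewrite map_unitmx.
  have uKX : K *m X \in unitmx by rewrite unitmx_mul uK uX.
  have uXL : X *m map_mx (real_complex R) (L g) \in unitmx by rewrite unitmx_mul uX uL'.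
  rewrite {1}[g]LE map_PGL_mxclass// conjgE => e.
  apply/(mxclassP uKX uXL).
  rewrite (mxclassM uK uX) (mxclassM uX uL') e -xE.
  by rewrite mulgA mulgV mul1g.
have [b b0 bE] := lift _ _ uM sE; have [c c0 cE] := lift _ _ uN tE.
have : X *m map_mx (real_complex R) (L s *m L t) = X *m map_mx (real_complex R) (L t *m L s).
  by rewrite LL.
rewrite !map_mxM !mulmxA bE cE -!scalemxAl -!mulmxA bE cE -!scalemxAr !scalerA !mulmxA.
rewrite [c * b]mulrC NM -scalemxAl => /(scalerI (mulf_neq0 b0 c0)).
move=> /(congr1 (fun A => A *m invmx X)); rewrite -scalemxAl !mulmxK// => /eqP.
rewrite -subr_eq0 -[Y in Y - _]scale1r -scalerBl scaler_eq0 subr_eq0 eq_sym (negPf a1)/=.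
have uMN : M *m N \in unitmx by rewrite unitmx_mul uM uN.
by move=> /eqP MN0; move: uMN; rewrite MN0 unitmxE det0 unitr0.
Qed.

Section Hessian.
Variable R : realType.
Local Notation C := R[i].
Local Notation w := (zeta R 3).
Local Notation c3 := (cos (2 * pi / 3 : R)).
Local Notation s3 := (sin (2 * pi / 3 : R)).

Lemma sin_third_gt0 : 0 < s3.
Proof.
have p0 := pi_gt0 R; apply: sin_gt0_pi.
by apply/andP; split; lra.
Qed.

(** From [cos (4 pi / 3) = cos (2 pi / 3)]. *)
Lemma cos_third : c3 = - 1 / 2.
Proof.
have s0 := sin_third_gt0; have cs := cos2Dsin2 (2 * pi / 3 : R).
have c1 : c3 - 1 != 0.
  rewrite subr_eq0; apply/eqP => c1; move: cs; rewrite c1 expr1n => /eqP.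
  by rewrite -subr_eq0 addrAC subrr add0r sqrf_eq0 (gt_eqF s0).
have e : cos ((2 * pi / 3) *+ 2 : R) = c3.
  rewrite (_ : (2 * pi / 3) *+ 2 = pi *+ 2 - 2 * pi / 3 :> R); last by rewrite !mulr2n; field.
  by rewrite cosB cos2pi sin2pi mul1r mul0r addr0.
apply: (mulfI c1); move: e; rewrite cos_mulr2n -[X in X - 1]mulr_natl => e.
transitivity ((2 * c3 ^+ 2 - 1 - c3) / 2 - (c3 - 1) / 2); first by field.
by rewrite e subrr mul0r sub0r; field.
Qed.

Lemma zeta3V : w^-1 = - 1 - w /\ w * (- 1 - w) = 1.
Proof.
have e : w * (- 1 - w) = 1.
  have cs := cos2Dsin2 (2 * pi / 3 : R); rewrite cos_third in cs.
  rewrite /zeta cos_third; apply/eqP; rewrite eq_complex /=; apply/andP; split; apply/eqP.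
    transitivity ((- 1 / 2) ^+ 2 + s3 ^+ 2); first by field.
    by rewrite cs.
  by field.
split=> //; have w0 : w != 0.
  by apply: contra_eq_neq e => ->; rewrite mul0r eq_sym oner_neq0.
by apply: (mulfI w0); rewrite e divff.
Qed.

Lemma zeta3_neq1 : w != 1.
Proof.
rewrite /zeta eq_complex /= negb_and.
by rewrite (gt_eqF sin_third_gt0) orbT.
Qed.

Lemma conj_zeta3 : conjc w = w^-1.
Proof.
have [-> _] := zeta3V; rewrite /zeta cos_third; apply/eqP; rewrite eq_complex /=.
by apply/andP; split; apply/eqP; field.
Qed.

Definition mxS : 'M[C]_3 := mx3 [:: [:: 1; 0; 0]; [:: 0; w; 0]; [:: 0; 0; w^-1]].
Definition mxT : 'M[C]_3 := mx3 [:: [:: 0; 1; 0]; [:: 0; 0; 1]; [:: 1; 0; 0]].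
Definition mxU : 'M[C]_3 := mx3 [:: [:: 1; 0; 0]; [:: 0; 1; 0]; [:: 0; 0; w]].
Definition mxV : 'M[C]_3 := mx3 [:: [:: 1; 1; 1]; [:: 1; w; w^-1]; [:: 1; w^-1; w]].

Let wwi : w * w^-1 = 1. Proof. by have [-> ->] := zeta3V. Qed.
Let w3 : 1 + w + w^-1 = 0. Proof. by have [-> _] := zeta3V; ring. Qed.

Let cw : conjc w = w^-1 := conj_zeta3.
Let cwi : conjc w^-1 = w.
Proof. by rewrite -cw conjcK. Qed.
Let cj0 : conjc (0 : C) = 0. Proof. exact: rmorph0. Qed.
Let cj1 : conjc (1 : C) = 1. Proof. exact: rmorph1. Qed.
Let wiw : w^-1 * w = 1. Proof. by rewrite mulrC wwi. Qed.

Lemma S_conj : mxS *m map_mx (@conjc R) mxS = 1%:M.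
Proof.
rewrite map_mx3 cw cwi cj0 cj1 mul_mx3 mx3_scalar.
congr (mx3 [:: [:: _; _; _]; [:: _; _; _]; [:: _; _; _]]);
  by rewrite ?(mulr0, mul0r, addr0, add0r, mul1r, mulr1, wwi, wiw).
Qed.

Lemma U_conj : mxU *m map_mx (@conjc R) mxU = 1%:M.
Proof.
rewrite map_mx3 cw cj0 cj1 mul_mx3 mx3_scalar.
congr (mx3 [:: [:: _; _; _]; [:: _; _; _]; [:: _; _; _]]);
  by rewrite ?(mulr0, mul0r, addr0, add0r, mul1r, mulr1, wwi, wiw).
Qed.

Lemma V_conj : mxV *m map_mx (@conjc R) mxV = 3%:M.
Proof.
rewrite map_mx3 cw cwi cj1 mul_mx3 mx3_scalar.
have wiE : w^-1 = - 1 - w by have [-> _] := zeta3V.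
have w2 : w * w = w^-1.
  by transitivity (w * (1 + w + w^-1) - w * w^-1 - w); [ring|rewrite w3 wwi wiE; ring].
have wi2 : w^-1 * w^-1 = w.
  transitivity (w^-1 * (1 + w + w^-1) - w * w^-1 - w^-1); first by ring.
  by rewrite w3 wwi wiE; ring.
congr (mx3 [:: [:: _; _; _]; [:: _; _; _]; [:: _; _; _]]);
  by rewrite ?(mul1r, mulr1, wwi, wiw, w2, wi2) ?wiE; ring.
Qed.

Lemma T_transpose : mxT *m mxT^T = 1%:M.
Proof.
rewrite (_ : mxT^T = mx3 [:: [:: 0; 0; 1]; [:: 1; 0; 0]; [:: 0; 1; 0]]); last first.
  by apply/matrixP; apply: I3_ind; apply: I3_ind; rewrite !mxE.
rewrite mul_mx3 mx3_scalar.
congr (mx3 [:: [:: _; _; _]; [:: _; _; _]; [:: _; _; _]]);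
  by rewrite ?(mulr0, mul0r, addr0, add0r, mul1r, mulr1).
Qed.

Lemma T_conj : map_mx (@conjc R) mxT = mxT.
Proof. by rewrite map_mx3 cj0 cj1. Qed.

Local Notation S := (Hess_S R).
Local Notation T := (Hess_T R).
Local Notation U := (Hess_U R).
Local Notation V := (Hess_V R).

Lemma unit_mxSTUV : [/\ mxS \in unitmx, mxT \in unitmx, mxU \in unitmx & mxV \in unitmx].
Proof.
split.
- by have [] := mulmx1_unit S_conj.
- by have [] := mulmx1_unit T_transpose.
- by have [] := mulmx1_unit U_conj.
have n3 : (3 : C) != 0 by rewrite pnatr_eq0.
by have [] := mxclass_scalar_inv n3 V_conj.
Qed.

Lemma sigma_S : sigma S = S^-1%g.
Proof.
have [uS _ _ _] := unit_mxSTUV; apply: etrans (map_PGL_mxclass _ uS) _.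
by have [] := mxclass_scalar_inv (oner_neq0 _) S_conj.
Qed.

Lemma sigma_T : sigma T = T.
Proof.
have [_ uT _ _] := unit_mxSTUV; apply: etrans (map_PGL_mxclass _ uT) _.
by rewrite [X in mxclass X]T_conj.
Qed.

Lemma sigma_U : sigma U = U^-1%g.
Proof.
have [_ _ uU _] := unit_mxSTUV; apply: etrans (map_PGL_mxclass _ uU) _.
by have [] := mxclass_scalar_inv (oner_neq0 _) U_conj.
Qed.

Lemma sigma_V : sigma V = V^-1%g.
Proof.
have [_ _ _ uV] := unit_mxSTUV; apply: etrans (map_PGL_mxclass _ uV) _.
have n3 : (3 : C) != 0 by rewrite pnatr_eq0.
by have [] := mxclass_scalar_inv n3 V_conj.
Qed.

Lemma US_commute : (U * S = S * U)%g.
Proof.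
have [uS uT uU uV] := unit_mxSTUV.
apply: etrans (esym (mxclassM uU uS)) (etrans _ (mxclassM uS uU)); congr mxclass.
rewrite !mul_mx3; congr (mx3 [:: [:: _; _; _]; [:: _; _; _]; [:: _; _; _]]);
  by rewrite ?(mulr0, mul0r, addr0, add0r, mul1r, mulr1, wwi, wiw).
Qed.

(** This says that U normalises <S, T>: [U * T * U^-1 = S^-1 * T]. *)
Lemma SUT_TU : (S * (U * T) = T * U)%g.
Proof.
have [uS uT uU uV] := unit_mxSTUV.
have uUT : mxU *m mxT \in unitmx by rewrite unitmx_mul uU uT.
have UT : (U * T)%g = mxclass (mxU *m mxT) := esym (mxclassM uU uT).
apply: etrans (congr1 (fun g => S * g)%g UT) _.
apply: etrans (esym (mxclassM uS uUT)) (etrans _ (mxclassM uT uU)); congr mxclass.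
rewrite !mul_mx3; congr (mx3 [:: [:: _; _; _]; [:: _; _; _]; [:: _; _; _]]);
  by rewrite ?(mulr0, mul0r, addr0, add0r, mul1r, mulr1, wwi, wiw).
Qed.

(** The commutator of the lifts of S and T is a scalar of order 3. *)
Lemma TS_matrix : mxT *m mxS = w *: (mxS *m mxT).
Proof.
have wiE : w^-1 = - 1 - w by have [-> _] := zeta3V.
have w2 : w * w = w^-1.
  by transitivity (w * (1 + w + w^-1) - w * w^-1 - w); [ring|rewrite w3 wwi wiE; ring].
rewrite !mul_mx3; apply/matrixP; apply: I3_ind; apply: I3_ind; rewrite !mxE /=;
  by rewrite ?(mulr0, mul0r, addr0, add0r, mul1r, mulr1, wwi, wiw, w2).
Qed.

Lemma ST_commute : (S * T = T * S)%g.
Proof.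
have [uS uT uU uV] := unit_mxSTUV.
have w0 : w != 0.
  by apply: contraTneq isT => w0; have := wwi; rewrite w0 mul0r => /esym/eqP; rewrite oner_eq0.
have uST : mxS *m mxT \in unitmx by rewrite unitmx_mul uS uT.
have uTS : mxT *m mxS \in unitmx by rewrite unitmx_mul uS uT.
apply: etrans (esym (mxclassM uS uT)) (etrans _ (mxclassM uT uS)).
by apply/(mxclassP uST uTS); exists w; rewrite ?TS_matrix.
Qed.

Lemma ST_not_definable (G : set (PGL C 3)) : G S -> G T -> ~ definable_over_R G.
Proof.
have [uS uT _ _] := unit_mxSTUV; have uST : mxS *m mxT \in unitmx by rewrite unitmx_mul uS uT.
exact: (noncommuting_lifts_not_definable uS uT zeta3_neq1 TS_matrix ST_commute).
Qed.

Lemma Hess_pseudo_real (G : set (PGL C 3)) :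
  conjugate_sets (Hess216 R) G \/ conjugate_sets (Hess72 R) G \/ conjugate_sets (Hess36 R) G ->
  pseudo_real G.
Proof.
have key (A : set (PGL C 3)) : A S -> A T -> has_real_moduli (generated A) ->
    conjugate_sets (generated A) G -> pseudo_real G.
  move=> AS AT HA AG; split; first exact: has_real_moduli_conj AG HA.
  move=> /(definable_conj AG).
  by apply: ST_not_definable; apply: sub_generated.
case=> [|[]]; apply: key.
- by left; left; left.
- by left; left; right.
- exact: (@Hess216_conj _ _ S T U V (@sigmaM R) sigma_S sigma_T sigma_U sigma_V).
- by left; left; left.
- by left; left; right.
- exact: (@Hess72_conj _ _ S T U V (@sigmaM R) sigma_S sigma_T sigma_U sigma_V US_commute SUT_TU).
- by left; left.
- by left; right.
exact: (@Hess36_conj _ _ S T V (@sigmaM R) sigma_S sigma_T sigma_V).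
Qed.

End Hessian.

(** * The real form of A_5 defined by phi *)

Section RealForm.
Variable R : realType.
Local Notation C := R[i].
Local Notation c2 := (cos (2 * pi / 5 : R)).
Local Notation s2 := (sin (2 * pi / 5 : R)).
Local Notation c4 := (cos (4 * pi / 5 : R)).
Local Notation z := (zeta R 5).
Variables ar ai br bi : R.
Let a : C := ar +i* ai.
Let b : C := br +i* bi.
Let d : R := ai * br - ar * bi.
Hypothesis uphi : phi_mx a b \in unitmx.

(** The determinant of [phi_mx a b] is [2 i d]. *)
Lemma phi_det_neq0 : d != 0.
Proof.
move: uphi; rewrite unitmxE unitfE det_mx3 !mxE /=; apply: contra_neq => d0.
apply/eqP; rewrite eq_complex /=; apply/andP; split; apply/eqP; first by ring.
by transitivity (2 * d); [rewrite /d; ring|rewrite d0 mulr0].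
Qed.

(** An identity of matrices without inverses, to be checked entry by entry. *)
Lemma phi_conj (M : 'M[C]_3) (N : 'M[R]_3) : M \in unitmx ->
  phi_mx a b *m map_mx (real_complex R) N = (2 * d)%:C *: (M *m phi_mx a b) ->
  N \in unitmx /\
  ((mxclass (phi_mx a b))^-1 * mxclass M * mxclass (phi_mx a b))%g =
  mxclass (map_mx (real_complex R) N).
Proof.
move=> uM e; have d0 : (2 * d)%:C != 0.
  by rewrite fmorph_eq0 mulf_neq0 ?pnatr_eq0// phi_det_neq0.
have [uN ->] := mxclass_conj uM uphi d0 e.
by split=> //; move: uN; rewrite map_unitmx.
Qed.

Lemma zeta5VE : z^-1 = c2 +i* (- s2).
Proof.
rewrite zeta5V zeta5E; apply/eqP; rewrite eq_complex /=.
by apply/andP; split; apply/eqP; ring.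
Qed.

Lemma zeta5_exp4 : z ^+ 4 = z^-1.
Proof.
have z5 := root_of_unity5 (cos_fifthC R) (zeta5_quad R).
have z0 : z != 0 by apply: contra_eq_neq z5 => ->; rewrite expr0n/= eq_sym oner_neq0.
by apply: (mulfI z0); rewrite divff// -exprS.
Qed.

Lemma normc_sqr (x y : R) : complex.Re (`|x +i* y| ^+ 2) = x ^+ 2 + y ^+ 2.
Proof. by rewrite -add_Re2_Im2. Qed.

Lemma phi_conj_A : exists2 N : 'M[R]_3, N \in unitmx &
  real_A a b = mxclass (map_mx (real_complex R) N) /\
  ((mxclass (phi_mx a b))^-1 * A5_A R * mxclass (phi_mx a b))%g = real_A a b.
Proof.
rewrite /real_A zeta5_exp4 invrK sin_fifth4 /real_class !normc_sqr zeta5VE.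
set N := mx3 _; rewrite A5_AE.
suff e : phi_mx a b *m map_mx (real_complex R) N =
   (2 * d)%:C *: (mx3 [:: [:: 1; 0; 0]; [:: 0; 2 * c2%:C - z; 0]; [:: 0; 0; z]] *m phi_mx a b).
  have [uN eN] := phi_conj (unit_A5_A_mx R) e.
  exists N; first exact: uN.
  split; [exact: erefl | exact: eN].
rewrite -zeta5V zeta5VE zeta5E /N map_mx3 /phi_mx !mul_mx3 scale_mx3 /d.
by congr (mx3 [:: [:: _; _; _]; [:: _; _; _]; [:: _; _; _]]);
  apply/eqP; rewrite eq_complex /=; apply/andP; split; apply/eqP; ring.
Qed.

Lemma phi_conj_B : exists2 N : 'M[R]_3, N \in unitmx &
  real_B a b = mxclass (map_mx (real_complex R) N) /\
  ((mxclass (phi_mx a b))^-1 * A5_B R * mxclass (phi_mx a b))%g = real_B a b.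
Proof.
rewrite /real_B /real_class; set N := mx3 _; have [_ uB] := A5_B_homology R.
suff e : phi_mx a b *m map_mx (real_complex R) N =
   (2 * d)%:C *: (mx3 [:: [:: 1; 0; 0]; [:: 0; 0; 1]; [:: 0; 1; 0]] *m phi_mx a b).
  have [uN eN] := phi_conj uB e.
  exists N; first exact: uN.
  split; [exact: erefl | exact: eN].
rewrite /N map_mx3 /phi_mx !mul_mx3 scale_mx3 /d.
by congr (mx3 [:: [:: _; _; _]; [:: _; _; _]; [:: _; _; _]]);
  apply/eqP; rewrite eq_complex /=; apply/andP; split; apply/eqP; ring.
Qed.

Lemma unit_A5_C (k : R) : k != 0 -> A5_C_mx k \in unitmx.
Proof.
move=> k0; rewrite map_unitmx unitmxE unitfE det_mx3 !mxE /= cos_fifth4.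
have p := cos_fifth_gt0 R; have p' : c2 + 1 / 4 != 0 by apply: lt0r_neq0; lra.
rewrite [X in X != 0](_ : _ = 5 * k * (c2 + 1 / 4)); last by field.
by rewrite !mulf_neq0 ?pnatr_eq0.
Qed.

Lemma phi_conj_C (k : R) : k != 0 -> exists2 N : 'M[R]_3, N \in unitmx &
  real_C k a b = mxclass (map_mx (real_complex R) N) /\
  ((mxclass (phi_mx a b))^-1 * A5_C k * mxclass (phi_mx a b))%g = real_C k a b.
Proof.
move=> k0; rewrite /real_C /real_class; set N := mx3 _; have uC := unit_A5_C k0.
suff e : phi_mx a b *m map_mx (real_complex R) N =
   (2 * d)%:C *: (A5_C_mx k *m phi_mx a b).
  have [uN eN] := phi_conj uC e.
  exists N; first exact: uN.
  split; [exact: erefl | exact: eN].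
rewrite /N /A5_C_mx !map_mx3 /phi_mx !mul_mx3 scale_mx3 /d.
by congr (mx3 [:: [:: _; _; _]; [:: _; _; _]; [:: _; _; _]]);
  apply/eqP; rewrite eq_complex /=; apply/andP; split; apply/eqP; ring.
Qed.
End RealForm.

Section PGL3R.
Variable R : realType.
Local Notation C := R[i].

Lemma PGL3R_subgroup : is_subgroup (PGL3R R).
Proof.
split.
- by exists 1%g => //; exact: (morph1g (@map_PGLM _ _ (real_complex R) 3)).
- move=> _ _ [x _ <-] [y _ <-]; exists (x * y)%g => //; exact: map_PGLM.
move=> _ [x _ <-]; exists x^-1%g => //; exact: (morphVg (@map_PGLM _ _ (real_complex R) 3) x).
Qed.

Lemma sigma_PGL3R (g : PGL C 3) : PGL3R R g -> sigma g = g.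
Proof.
move=> [x _ <-]; have [M uM ->] := mxclass_surj x.
rewrite (map_PGL_mxclass _ uM).
have uM' : map_mx (real_complex R) M \in unitmx by rewrite map_unitmx.
rewrite /sigma (map_PGL_mxclass _ uM'); congr mxclass.
by apply/matrixP => i j; rewrite !mxE; exact: conjc_real.
Qed.

(** Conjugation fixes PGL_3(R) pointwise. *)
Lemma definable_real_moduli (G : set (PGL C 3)) : definable_over_R G -> has_real_moduli G.
Proof.
move=> [K GK KR]; apply: has_real_moduli_conj (conjugate_sets_sym GK) _.
suff sK : sigma (R:=R) @` K = K by exists 1%g; rewrite sK conj_set1.
apply/seteqP; split=> [_ [g Kg <-]|g Kg]; first by rewrite (sigma_PGL3R (KR _ Kg)).
by exists g => //; exact: sigma_PGL3R (KR _ Kg).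
Qed.

End PGL3R.

Section Final.
Variable R : realType.
Local Notation C := R[i].

Lemma real_mxclass (N : 'M[R]_3) : N \in unitmx ->
  PGL3R R (mxclass (map_mx (real_complex R) N)).
Proof. by move=> uN; exists (mxclass N); [exact: I|exact: map_PGL_mxclass uN]. Qed.

Lemma phi_admissible_1i : phi_admissible (1 : C) (0 +i* 1 : C).
Proof.
split; first exact: oner_neq0; first by rewrite eq_complex /= oner_eq0 andbF.
rewrite unitmxE unitfE det_mx3 !mxE /= eq_complex /= negb_and; apply/orP; right.
rewrite (_ : _ + _ = -2); last by ring.
by rewrite oppr_eq0 pnatr_eq0.
Qed.

Lemma conj_A5_ABC_real (a b : C) : phi_admissible a b ->
  conj_set (A5_ABC R) (mxclass (phi_mx a b)) `<=` PGL3R R.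
Proof.
case: a b => [ar ai] [br bi] [_ _ uphi].
rewrite conj_set_generated; apply: (generated_min (PGL3R_subgroup R)).
have [NA uA [eA eA']] := phi_conj_A uphi.
have [NB uB [eB eB']] := phi_conj_B uphi.
have k0 : 2^-1 != 0 :> R by rewrite invr_eq0 pnatr_eq0.
have [NC uC [eC eC']] := phi_conj_C uphi k0.
move=> _ [_ [[->|->]|->] <-]; rewrite conjgE mulgA.
- rewrite eA' eA; exact: real_mxclass.
- rewrite eB' eB; exact: real_mxclass.
- rewrite eC' eC; exact: real_mxclass.
Qed.

Lemma A5_definable (G : set (PGL C 3)) : is_A5 G -> definable_over_R G.
Proof.
move=> GA5; exists (conj_set (A5_ABC R) (mxclass (phi_mx 1 (0 +i* 1)))).
  apply: conjugate_sets_trans (A5_conjugate_ABC GA5) _.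
  by exists (mxclass (phi_mx 1 (0 +i* 1))).
exact: conj_A5_ABC_real phi_admissible_1i.
Qed.
End Final.

Theorem theorem2p5 (R : realType) :
  (forall G : set (PGL R[i] 3), type_P G -> (pseudo_real G <-> ~ is_A5 G)) /\
  (forall G : set (PGL R[i] 3), is_A5 G -> has_real_moduli G) /\
  is_A5 (A5_ABC R) /\
  (exists alpha beta : R[i], phi_admissible alpha beta) /\
  (forall alpha beta : R[i], phi_admissible alpha beta ->
     let phi : PGL R[i] 3 := mxclass (phi_mx alpha beta) in
     (forall G : set (PGL R[i] 3), is_A5 G -> conjugate_sets G (conj_set (A5_ABC R) phi)) /\
     conj_set (A5_ABC R) phi `<=` PGL3R R /\
     (phi^-1 * A5_A R * phi)%g = real_A alpha beta /\
     (phi^-1 * A5_B R * phi)%g = real_B alpha beta /\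
     (phi^-1 * A5_C (2^-1 : R) * phi)%g = real_C (2^-1 : R) alpha beta /\
     (phi^-1 * A5_C (2 : R) * phi)%g = real_C (2 : R) alpha beta).
Proof.
split=> [G GP|].
  split=> [[_ nGR] /A5_definable //|nGA5].
  case: GP => [/Hess_pseudo_real //|[//|[GA6|G7]]].
    by split; [exact: A6_real_moduli GA6|exact: A6_not_definable GA6].
  by split; [exact: PSL2_7_real_moduli G7|exact: PSL2_7_not_definable G7].
split=> [G /A5_definable|]; first exact: definable_real_moduli.
split; first exact: A5_ABC_is_A5.
split; first by exists 1, (0 +i* 1); exact: phi_admissible_1i.
move=> alpha beta adm phi.
split=> [G /A5_conjugate_ABC GA|]; first by apply: conjugate_sets_trans GA _; exists phi.
split; first exact: conj_A5_ABC_real adm.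
rewrite {}/phi; case: alpha beta adm => [ar ai] [br bi] [_ _ uphi].
have h0 : 2^-1 != 0 :> R by rewrite invr_eq0 pnatr_eq0.
have t0 : 2 != 0 :> R by rewrite pnatr_eq0.
have [_ _ [_ eA]] := phi_conj_A uphi; have [_ _ [_ eB]] := phi_conj_B uphi.
have [_ _ [_ eC]] := phi_conj_C uphi h0; have [_ _ [_ eC2]] := phi_conj_C uphi t0.
split; first exact: eA.
split; first exact: eB.
split; [exact: eC|exact: eC2].
Qed.
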